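(* A non-symmetric left-invariant Riemannian metric on $\mathbb{R}\ltimes E(1,1)$ or $\mathbb{R}\ltimes\widetilde{E}(2)$ is $\mathcal{F}_t$-critical (for $t\in\mathbb{R}$) if and only if it is isomorphically homothetic to one of the following left-invariant metrics, each given by its non-zero Lie brackets in an orthonormal basis $\{e_1,e_2,e_3,e_4\}$ of the Lie algebra, with $t$ as indicated (the stated value of the energy $\mathcal{E}_t$ is that of the listed metric): (1) The direct product $E(1,1)\times\mathbb{R}$ with $[e_1,e_3]=e_2$, $[e_2,e_3]=e_1$. In this case $t=-1$ and $\mathcal{E}_{-1}=0$. (2) $[e_1,e_3]=-\lambda e_2$, $[e_1,e_4]=be_1$, $[e_2,e_3]=e_1$, $[e_2,e_4]=be_2$, with $\lambda\in(-1,0)\cup(0,1)$. For a fixed $\lambda$, the parameter $b$ is given by the two positive solutions of $4b^4-(3\lambda^2-2\lambda+3)b^2-(\lambda-1)^2\lambda=0$ if $\lambda\in(-1,0)$, and by the unique positive solution of this equation if $\lambda\in(0,1)$. In both cases $t=-\frac{3\lambda^2-2\lambda+3}{12b^2+(\lambda-1)^2}$ and $\mathcal{E}_t=4\lambda(\lambda-1)^2$. (3) $[e_1,e_3]=-e_2$, $[e_1,e_4]=e_1$, $[e_2,e_3]=e_1$, $[e_2,e_4]=e_2$, $[e_3,e_4]=De_2$, with $D>0$. In this case $t=-\frac{3D^2+4}{D^2+12}$ and $\mathcal{E}_t=-5D^2$. (4) $[e_1,e_3]=-\lambda e_2$, $[e_1,e_4]=be_1$, $[e_2,e_3]=e_1$,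 $[e_2,e_4]=be_2$, $[e_3,e_4]=De_2$, with $\lambda\in(0,1)$. For a fixed $\lambda$, the parameters $D$ and $b$ are the only positive solutions of $D^2+\lambda^2=1$ and $2b^4-(5\lambda^2-\lambda-2)b^2+\lambda(\lambda-1)=0$, respectively. In this case $t=-\frac{3b^2-2\lambda+3}{12b^2-2\lambda+2}$ and $\mathcal{E}_t=(\lambda-1)\left(3(\lambda+3)b^2-2\lambda\right)$. (5) $[e_1,e_3]=e_2$, $[e_1,e_4]=be_1+Ae_2$, $[e_2,e_3]=e_1$, $[e_2,e_4]=Ae_1+be_2$, with $b>0$, $A\geq0$ and $b^2-A^2\neq1$. In this case $t=-\frac{A^2+b^2+1}{A^2+3b^2+1}$ and $\mathcal{E}_t=-16b^2$. Moreover, up to isomorphic homothety, the metrics in (1) are the only non-Einstein algebraic Ricci solitons on $\mathbb{R}\ltimes E(1,1)$, and there are no non-Einstein algebraic Ricci solitons on $\mathbb{R}\ltimes\widetilde{E}(2)$.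
   Context: **Critical metrics and energy.** On a homogeneous Riemannian $4$-manifold $(M,g)$ let $R$ be the curvature tensor, $\rho$ the Ricci tensor and $\tau$ the scalar curvature. For $t\in\mathbb{R}$ let $\mathcal{F}_t(g)=\int_M\{\|\rho\|^2+t\tau^2\}\,\mathrm{dvol}_g$. A homogeneous metric is called $\mathcal{F}_t$-critical if it satisfies the Euler-Lagrange equation of $\mathcal{F}_t$ for variations of constant volume, which in the homogeneous four-dimensional case is $$-\Delta\rho+\tfrac12(\|\rho\|^2+t\tau^2)g-2R[\rho]-2t\tau\rho=0,$$ where $\Delta\rho$ is the rough Laplacian (trace of $\nabla^2\rho$), and $R[\rho]_{ij}=R_{ikj\ell}\rho^{k\ell}$, with sign convention such that $R_{ikj\ell}g^{k\ell}=\rho_{ij}$. The energy is $\mathcal{E}_t=\|\rho\|^2+t\tau^2$. The equation is invariant under homotheties. **Groups.** $\mathfrak{e}(2)$ (resp. $\mathfrak{e}(1,1)$) is the three-dimensional Lie algebra with basis $v_1,v_2,v_3$ and brackets $[v_2,v_3]=\lambda_1v_1$, $[v_3,v_1]=\lambda_2v_2$, $[v_1,v_2]=0$, where $\lambda_1\lambda_2>0$ (resp. $\lambda_1\lambda_2<0$); $\widetilde{E}(2)$ (resp. $E(1,1)$) is the corresponding simply connected Lie group. $\mathbb{R}\ltimes E(1,1)$ and $\mathbb{R}\ltimes\widetilde{E}(2)$ denote any simply connected Lie group whose Lie algebra is a semi-direct extension $\mathbb{R}\ltimes\mathfrak{g}_3$ of $\mathfrak{g}_3=\mathfrak{e}(1,1)$,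 resp. $\mathfrak{e}(2)$, by a derivation of $\mathfrak{g}_3$. **Terminology.** ''Non-symmetric'' means not locally symmetric. Two left-invariant metrics are isomorphically homothetic if there is a Lie algebra isomorphism which is a homothety of the inner products. A Lie group with left-invariant metric is an algebraic Ricci soliton if its Ricci operator satisfies $\mathrm{Ric}=\lambda\,\mathrm{Id}+\mathfrak{D}$ for some $\lambda\in\mathbb{R}$ and some derivation $\mathfrak{D}$ of the Lie algebra. Brackets of basis elements not listed (up to antisymmetry) are zero. *)

(* Defs.v *)
From HB Require Import structures.
From mathcomp Require Import all_boot all_order all_algebra.
From mathcomp Require Import reals.

Set Implicit Arguments.
Unset Strict Implicit.
Unset Printing Implicit Defensive.

Import Order.TTheory GRing.Theory Num.Theory.
Local Open Scope ring_scope.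

(* A left-invariant metric on a simply connected Lie group is given by its Lie
   algebra and an inner product on it.  The Lie algebra is modelled on the row
   vectors R^n by a bracket br, the inner product by its Gram matrix G in the
   standard basis (which is not assumed to be orthonormal).  Left-invariant
   tensors are multilinear functions on 'rV[R]_n. *)

Definition bracket (R : realType) (n : nat) : Type :=
  'rV[R]_n -> 'rV[R]_n -> 'rV[R]_n.

Definition is_lie_bracket (R : realType) (n : nat) (br : bracket R n) : Prop :=
  [/\ forall z, linear (fun x => br x z),
      forall z, linear (br z),
      forall x, br x x = 0
    & forall x y z, br (br x y) z + br (br y z) x + br (br z x) y = 0].

Definition is_inner_product (R : realType) (n : nat) (G : 'M[R]_n) : Prop :=
  G^T = G /\ forall x : 'rV[R]_n, x != 0 -> 0 < (x *m G *m x^T) 0 0.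

Definition ip (R : realType) (n : nat) (G : 'M[R]_n) (x y : 'rV[R]_n) : R :=
  (x *m G *m y^T) 0 0.

Definition e_ (R : realType) (n : nat) (i : 'I_n) : 'rV[R]_n := delta_mx 0 i.

Definition is_derivation (R : realType) (n : nat) (br : bracket R n)
    (D : {linear 'rV[R]_n -> 'rV[R]_n}) : Prop :=
  forall x y, D (br x y) = br (D x) y + br x (D y).

Definition is_lie_iso (R : realType) (n : nat) (br br' : bracket R n)
    (f : {linear 'rV[R]_n -> 'rV[R]_n}) : Prop :=
  bijective f /\ forall x y, f (br x y) = br' (f x) (f y).

Definition lie_isomorphic (R : realType) (n : nat) (br br' : bracket R n) : Prop :=
  exists f : {linear 'rV[R]_n -> 'rV[R]_n}, is_lie_iso br br' f.

Definition isomorphically_homothetic (R : realType) (n : nat)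
    (br : bracket R n) (G : 'M[R]_n) (br' : bracket R n) (G' : 'M[R]_n) : Prop :=
  exists f : {linear 'rV[R]_n -> 'rV[R]_n}, exists c : R,
    [/\ is_lie_iso br br' f, 0 < c
      & forall x y, ip G' (f x) (f y) = c * ip G x y].

(* Levi-Civita connection of left-invariant fields, by the Koszul formula
   2<nabla_x y, z> = <[x,y],z> - <[y,z],x> + <[z,x],y>. *)

Definition koszul (R : realType) (n : nat) (br : bracket R n) (G : 'M[R]_n)
    (x y z : 'rV[R]_n) : R :=
  2%:R^-1 * (ip G (br x y) z - ip G (br y z) x + ip G (br z x) y).

(* The vector dual to a covector. *)
Definition sharp (R : realType) (n : nat) (G : 'M[R]_n) (u : 'rV[R]_n -> R) :
    'rV[R]_n :=
  (\row_k u (e_ R k)) *m invmx G.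

Definition nabla (R : realType) (n : nat) (br : bracket R n) (G : 'M[R]_n)
    (x y : 'rV[R]_n) : 'rV[R]_n :=
  sharp G (koszul br G x y).

(* R(x,y)z = nabla_x nabla_y z - nabla_y nabla_x z - nabla_[x,y] z *)
Definition curv (R : realType) (n : nat) (br : bracket R n) (G : 'M[R]_n)
    (x y z : 'rV[R]_n) : 'rV[R]_n :=
  nabla br G x (nabla br G y z) - nabla br G y (nabla br G x z)
  - nabla br G (br x y) z.

(* (nabla_v R)(x,y)z *)
Definition nabla_curv (R : realType) (n : nat) (br : bracket R n) (G : 'M[R]_n)
    (v x y z : 'rV[R]_n) : 'rV[R]_n :=
  nabla br G v (curv br G x y z) - curv br G (nabla br G v x) y z
  - curv br G x (nabla br G v y) z - curv br G x y (nabla br G v z).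

Definition locally_symmetric (R : realType) (n : nat) (br : bracket R n)
    (G : 'M[R]_n) : Prop :=
  forall v x y z, nabla_curv br G v x y z = 0.

(* The (0,4)-tensor R_{xyzw} := <R(x,y)w, z>.  With this sign and order of the
   arguments g^{kl} R_{ikjl} = rho_{ij}. *)
Definition curv4 (R : realType) (n : nat) (br : bracket R n) (G : 'M[R]_n)
    (x y z w : 'rV[R]_n) : R :=
  ip G (curv br G x y w) z.

(* rho(x,y) = trace of z |-> R(z,x)y *)
Definition ricci (R : realType) (n : nat) (br : bracket R n) (G : 'M[R]_n)
    (x y : 'rV[R]_n) : R :=
  \tr (lin1_mx (fun z => curv br G z x y)).

Definition ricci_op (R : realType) (n : nat) (br : bracket R n) (G : 'M[R]_n)
    (x : 'rV[R]_n) : 'rV[R]_n :=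
  sharp G (ricci br G x).

(* g^{ij} T_{ij} *)
Definition metric_trace (R : realType) (n : nat) (G : 'M[R]_n)
    (T : 'rV[R]_n -> 'rV[R]_n -> R) : R :=
  \sum_(i < n) \sum_(j < n) invmx G i j * T (e_ R i) (e_ R j).

(* T^{kl} = g^{ka} g^{lb} T_{ab} *)
Definition raise2 (R : realType) (n : nat) (G : 'M[R]_n)
    (T : 'rV[R]_n -> 'rV[R]_n -> R) (k l : 'I_n) : R :=
  \sum_(a < n) \sum_(b < n) invmx G k a * invmx G l b * T (e_ R a) (e_ R b).

Definition norm2 (R : realType) (n : nat) (G : 'M[R]_n)
    (T : 'rV[R]_n -> 'rV[R]_n -> R) : R :=
  \sum_(k < n) \sum_(l < n) raise2 G T k l * T (e_ R k) (e_ R l).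

Definition scal (R : realType) (n : nat) (br : bracket R n) (G : 'M[R]_n) : R :=
  metric_trace G (ricci br G).

(* (nabla_v T)(x,y) and (nabla^2_{u,v} T)(x,y); the functions T(x,y) of
   left-invariant fields are constant. *)
Definition nabla_form (R : realType) (n : nat) (br : bracket R n) (G : 'M[R]_n)
    (T : 'rV[R]_n -> 'rV[R]_n -> R) (v x y : 'rV[R]_n) : R :=
  - T (nabla br G v x) y - T x (nabla br G v y).

Definition nabla2_form (R : realType) (n : nat) (br : bracket R n) (G : 'M[R]_n)
    (T : 'rV[R]_n -> 'rV[R]_n -> R) (u v x y : 'rV[R]_n) : R :=
  - nabla_form br G T (nabla br G u v) x y
  - nabla_form br G T v (nabla br G u x) y
  - nabla_form br G T v x (nabla br G u y).

Definition rough_laplacian (R : realType) (n : nat) (br : bracket R n)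
    (G : 'M[R]_n) (T : 'rV[R]_n -> 'rV[R]_n -> R) (x y : 'rV[R]_n) : R :=
  metric_trace G (fun u v => nabla2_form br G T u v x y).

(* R[rho]_{ij} = R_{ikjl} rho^{kl} *)
Definition curv_ricci (R : realType) (n : nat) (br : bracket R n) (G : 'M[R]_n)
    (x y : 'rV[R]_n) : R :=
  \sum_(k < n) \sum_(l < n)
    curv4 br G x (e_ R k) y (e_ R l) * raise2 G (ricci br G) k l.

Definition energy (R : realType) (n : nat) (br : bracket R n) (G : 'M[R]_n)
    (t : R) : R :=
  norm2 G (ricci br G) + t * scal br G ^+ 2.

(* The Euler-Lagrange equation of F_t for variations of constant volume, for
   homogeneous metrics in dimension four. *)
Definition F_critical (R : realType) (br : bracket R 4) (G : 'M[R]_4) (t : R) :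
    Prop :=
  forall x y,
    - rough_laplacian br G (ricci br G) x y
    + 2%:R^-1 * energy br G t * ip G x y
    - 2%:R * curv_ricci br G x y
    - 2%:R * t * scal br G * ricci br G x y = 0.

Definition is_einstein (R : realType) (n : nat) (br : bracket R n)
    (G : 'M[R]_n) : Prop :=
  exists c : R, forall x y, ricci br G x y = c * ip G x y.

Definition is_algebraic_ricci_soliton (R : realType) (n : nat)
    (br : bracket R n) (G : 'M[R]_n) : Prop :=
  exists l : R, exists D : {linear 'rV[R]_n -> 'rV[R]_n},
    is_derivation br D /\ forall x, ricci_op br G x = l *: x + D x.

(* The bracket with [e_i, e_j] = v for each entry (i, j, v) of s, extended
   bilinearly and antisymmetrically; brackets of basis vectors not in s are 0. *)
Definition lie_table (R : realType) (n : nat)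
    (s : seq ('I_n * 'I_n * 'rV[R]_n)) : bracket R n :=
  fun x y => \sum_(p <- s)
    (x 0 p.1.1 * y 0 p.1.2 - x 0 p.1.2 * y 0 p.1.1) *: p.2.

(* One-based names, so that e_ R i1 is the basis vector usually written e_1. *)
Definition i1 (n : nat) : 'I_n.+3 := @Ordinal n.+3 0 isT.
Definition i2 (n : nat) : 'I_n.+3 := @Ordinal n.+3 1 isT.
Definition i3 (n : nat) : 'I_n.+3 := @Ordinal n.+3 2 isT.
Definition i4 (n : nat) : 'I_n.+4 := @Ordinal n.+4 3 isT.
Arguments i1 {n}.
Arguments i2 {n}.
Arguments i3 {n}.
Arguments i4 {n}.

Definition e_bracket (R : realType) (l1 l2 : R) : bracket R 3 :=
  lie_table [:: (i2, i3, l1 *: e_ R i1); (i3, i1, l2 *: e_ R i2)].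

(* The semi-direct extension of a Lie algebra R^m by D:
   on pairs (x, a), [(x,a), (y,b)] = ([x,y] + a D y - b D x, 0). *)
Definition semidirect (R : realType) (m : nat) (br : bracket R m)
    (D : 'rV[R]_m -> 'rV[R]_m) : bracket R (m + 1) :=
  fun u v =>
    row_mx (br (lsubmx u) (lsubmx v)
            + rsubmx u 0 0 *: D (lsubmx v) - rsubmx v 0 0 *: D (lsubmx u)) 0.

Definition extends_e11 (R : realType) (br : bracket R 4) : Prop :=
  exists l1 l2 : R, exists D : {linear 'rV[R]_3 -> 'rV[R]_3},
    [/\ l1 * l2 < 0, is_derivation (e_bracket l1 l2) D
      & lie_isomorphic br (semidirect (e_bracket l1 l2) D)].

Definition extends_e2 (R : realType) (br : bracket R 4) : Prop :=
  exists l1 l2 : R, exists D : {linear 'rV[R]_3 -> 'rV[R]_3},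
    [/\ 0 < l1 * l2, is_derivation (e_bracket l1 l2) D
      & lie_isomorphic br (semidirect (e_bracket l1 l2) D)].

(* The direct product of e(1,1) and R. *)
Definition is_e11_times_line (R : realType) (br : bracket R 4) : Prop :=
  exists l1 l2 : R,
    l1 * l2 < 0 /\ lie_isomorphic br (semidirect (e_bracket l1 l2) (fun=> 0)).

Definition bracket1 (R : realType) : bracket R 4 :=
  lie_table [:: (i1, i3, e_ R i2); (i2, i3, e_ R i1)].

Arguments bracket1 R : clear implicits.

Definition bracket2 (R : realType) (l b : R) : bracket R 4 :=
  lie_table [:: (i1, i3, - l *: e_ R i2); (i1, i4, b *: e_ R i1);
                (i2, i3, e_ R i1); (i2, i4, b *: e_ R i2)].

Definition bracket3 (R : realType) (D : R) : bracket R 4 :=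
  lie_table [:: (i1, i3, - e_ R i2); (i1, i4, e_ R i1);
                (i2, i3, e_ R i1); (i2, i4, e_ R i2);
                (i3, i4, D *: e_ R i2)].

Definition bracket4 (R : realType) (l b D : R) : bracket R 4 :=
  lie_table [:: (i1, i3, - l *: e_ R i2); (i1, i4, b *: e_ R i1);
                (i2, i3, e_ R i1); (i2, i4, b *: e_ R i2);
                (i3, i4, D *: e_ R i2)].

Definition bracket5 (R : realType) (A b : R) : bracket R 4 :=
  lie_table [:: (i1, i3, e_ R i2); (i1, i4, b *: e_ R i1 + A *: e_ R i2);
                (i2, i3, e_ R i1); (i2, i4, A *: e_ R i1 + b *: e_ R i2)].

Definition equation2 (R : realType) (l b : R) : Prop :=
  4%:R * b ^+ 4 - (3%:R * l ^+ 2 - 2%:R * l + 3%:R) * b ^+ 2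
  - (l - 1) ^+ 2 * l = 0.

Definition equation4 (R : realType) (l b : R) : Prop :=
  2%:R * b ^+ 4 - (5%:R * l ^+ 2 - l - 2%:R) * b ^+ 2 + l * (l - 1) = 0.

(* listed br t E: br is the bracket, in an orthonormal basis, of one of the
   metrics of the classification, with the values t and E attached to it. *)
Inductive listed (R : realType) : bracket R 4 -> R -> R -> Prop :=
| Listed1 : listed (bracket1 R) (-1) 0
| Listed2 (l b : R) :
    (-1 < l /\ l < 0) \/ (0 < l /\ l < 1) -> 0 < b -> equation2 l b ->
    listed (bracket2 l b)
      (- ((3%:R * l ^+ 2 - 2%:R * l + 3%:R)
          / (12%:R * b ^+ 2 + (l - 1) ^+ 2)))
      (4%:R * l * (l - 1) ^+ 2)
| Listed3 (D : R) :
    0 < D ->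
    listed (bracket3 D)
      (- ((3%:R * D ^+ 2 + 4%:R) / (D ^+ 2 + 12%:R)))
      (- (5%:R * D ^+ 2))
| Listed4 (l b D : R) :
    0 < l -> l < 1 -> 0 < D -> D ^+ 2 + l ^+ 2 = 1 ->
    0 < b -> equation4 l b ->
    listed (bracket4 l b D)
      (- ((3%:R * b ^+ 2 - 2%:R * l + 3%:R)
          / (12%:R * b ^+ 2 - 2%:R * l + 2%:R)))
      ((l - 1) * (3%:R * (l + 3%:R) * b ^+ 2 - 2%:R * l))
| Listed5 (A b : R) :
    0 < b -> 0 <= A -> b ^+ 2 - A ^+ 2 != 1 ->
    listed (bracket5 A b)
      (- ((A ^+ 2 + b ^+ 2 + 1) / (A ^+ 2 + 3%:R * b ^+ 2 + 1)))
      (- (16%:R * b ^+ 2)).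

(* Main.v *)
(* Every metric on these groups has, up to homothety, an orthonormal basis in
   which span(e_1, e_2) is an abelian ideal, e_4 acts on it by a multiple of the
   identity and e_3 by a commuting matrix with equal diagonal entries: apply
   Gram-Schmidt to a basis adapted to the flag [v_1, v_2] < g_3 < g, rotate
   span(e_1, e_2) to equalise the diagonal of ad e_3, and rotate span(e_3, e_4)
   to remove the trace-free part of ad e_4.  In this basis the Euler-Lagrange
   equation is a system of ten polynomial equations, linear in T = t * tau.
   When [e_3, e_4] = 0 the off-diagonal components give T and the diagonal ones
   the families (1), (2), (5) and the two symmetric families.  When
   [e_3, e_4] <> 0, eliminating T shows that ad e_3 must be trace-free on
   span(e_1, e_2), which leaves (3) and (4).  That the listed metrics are not
   symmetric is read off the covariant derivative of the Ricci tensor. *)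

Require Import Defs.
From HB Require Import structures.
From mathcomp Require Import all_boot all_order all_algebra.
From mathcomp Require Import boolp reals.
From mathcomp Require Import ring lra.

Set Implicit Arguments.
Unset Strict Implicit.
Unset Printing Implicit Defensive.

Import Order.TTheory GRing.Theory Num.Theory.
Local Open Scope ring_scope.

(** * Invariance of the curvature tensors under homotheties *)

Section BilinearForms.
Variables (R : realType) (n : nat).
Implicit Types (x y z : 'rV[R]_n) (G M P : 'M[R]_n).
Implicit Types (S T : 'rV[R]_n -> 'rV[R]_n -> R).

(** The Euler-Lagrange expression has a fixed weight under homotheties, so criticality may be tested
    after rescaling; the value of the energy does change, so the listed energies are carried over by
    isometries only. Ordering the two off-diagonal entries of ad e_3 by absolute value becomes
    [w * s <= 0] in the normal form, and this one sign removes the spurious real branches when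
    [e_3, e_4] <> 0. The obstacle is the case where [e_3, e_4] <> 0 while ad e_3 and ad e_4 both
    have non-zero trace. There the vector (P, Q), half of [e_3, e_4], enters through n = P^2 + Q^2,
    de = Q^2 - P^2 and P Q. These are determined one after the other, and the circle identity de^2 +
    4 (P Q)^2 = n^2 then closes the system on a sum of squares that cannot vanish. Every elimination
    is an explicit polynomial combination of the equations; conversely, criticality of the listed
    metrics is membership in the ideal generated by the relations between their parameters. *)

Definition bilinear_form T :=
  (forall y, scalar (T^~ y)) /\ (forall x, scalar (T x)).

Definition gram T : 'M[R]_n := \matrix_(i, j) T (e_ R i) (e_ R j).

(** The full contraction of two forms. Both [norm2] of the Ricci tensor and [curv_ricci] are
    instances, so one transformation rule serves both. *)
Definition contract G S T :=
  \sum_(k < n) \sum_(l < n) raise2 G S k l * T (e_ R k) (e_ R l).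

Lemma scalar_sum (u : 'rV[R]_n -> R) x : scalar u ->
  u x = \sum_i x 0 i * u (e_ R i).
Proof.
move=> ul; pose L : {scalar 'rV[R]_n} :=
  HB.pack_for {scalar 'rV[R]_n} u (GRing.isLinear.Build _ _ _ _ u ul).
rewrite {1}(row_sum_delta x) -[u]/(L : _ -> _) linear_sum.
by apply: eq_bigr => i _; rewrite linearZ.
Qed.

Lemma lin1_mxE (g : 'rV[R]_n -> 'rV[R]_n) x : linear g -> x *m lin1_mx g = g x.
Proof.
move=> gl; pose L : {linear 'rV[R]_n -> 'rV[R]_n} :=
  HB.pack_for {linear 'rV[R]_n -> 'rV[R]_n} g (GRing.isLinear.Build _ _ _ _ g gl).
exact: (mul_rV_lin1 L).
Qed.

Lemma ipE G x y : ip G x y = \sum_i \sum_j x 0 i * G i j * y 0 j.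
Proof.
rewrite /ip -mulmxA mxE; apply: eq_bigr => i _.
rewrite mxE big_distrr /=; apply: eq_bigr => j _; by rewrite mxE mulrA.
Qed.

Lemma ip_gram T : bilinear_form T -> forall x y, ip (gram T) x y = T x y.
Proof.
move=> [Tl Tr] x y; rewrite ipE (scalar_sum x (Tl y)).
apply: eq_bigr => i _; rewrite (scalar_sum y (Tr _)) big_distrr /=.
by apply: eq_bigr => j _; rewrite mxE -mulrA [T _ _ * _]mulrC.
Qed.

Lemma ip_bilinear G : bilinear_form (ip G).
Proof.
split=> [y a u v | x a u v].
  by rewrite /ip !mulmxDl -!scalemxAl !mxE.
by rewrite /ip linearP /= mulmxDr -scalemxAr !mxE.
Qed.

Lemma ip_delta G (i j : 'I_n) : ip G (e_ R i) (e_ R j) = G i j.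
Proof.
rewrite /ip /e_ trmx_delta -rowE -colE !mxE //.
Qed.

Lemma eq_ip_mx G M : (forall x y, ip G x y = ip M x y) -> G = M.
Proof. by move=> h; apply/matrixP => i j; rewrite -!ip_delta. Qed.

Lemma metric_traceE G T : metric_trace G T = \tr (invmx G *m (gram T)^T).
Proof.
apply: eq_bigr => i _; rewrite mxE; apply: eq_bigr => j _; by rewrite !mxE.
Qed.

Lemma raise2E G T k l : raise2 G T k l = (invmx G *m gram T *m (invmx G)^T) k l.
Proof.
rewrite mxE /raise2 exchange_big; apply: eq_bigr => b _.
rewrite !mxE big_distrl /=; apply: eq_bigr => a _; rewrite !mxE; ring.
Qed.

Lemma contractE G S T :
  contract G S T = \tr (invmx G *m gram S *m (invmx G)^T *m (gram T)^T).
Proof.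
apply: eq_bigr => k _; rewrite [RHS]mxE; apply: eq_bigr => l _.
by rewrite raise2E !mxE.
Qed.

Lemma inner_product_unit G : is_inner_product G -> G \in unitmx.
Proof.
move=> [_ pos]; rewrite unitmxE unitfE; apply/negP => /eqP/eqP/det0P [v v0 vG].
by have := pos v v0; rewrite vG mul0mx mxE ltxx.
Qed.

Lemma ip_sharp G (u : 'rV[R]_n -> R) : G \in unitmx -> scalar u ->
  forall z, ip G (sharp G u) z = u z.
Proof.
move=> Gu ul z; rewrite /ip /sharp -[_ *m invmx G *m G]mulmxA mulVmx // mulmx1.
by rewrite mxE (scalar_sum z ul); apply: eq_bigr => i _; rewrite !mxE mulrC.
Qed.

Lemma ip_injl G : G \in unitmx -> forall x y, (forall z, ip G x z = ip G y z) -> x = y.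
Proof.
move=> Gu x y h.
have {}h : x *m G = y *m G.
  apply/rowP => j; have := h (e_ R j).
  by rewrite /ip /e_ trmx_delta -!colE !mxE.
by rewrite -[x]mulmx1 -[y]mulmx1 -(mulmxV Gu) !mulmxA h.
Qed.

End BilinearForms.

Lemma lincomb3 (R : realType) (n : nat) (a : R) (A A' B B' C C' : 'rV[R]_n) :
  a *: A + A' - (a *: B + B') - (a *: C + C') = a *: (A - B - C) + (A' - B' - C').
Proof. by apply/rowP => j; rewrite !mxE; ring. Qed.

Lemma lincomb3_scalar (R : realType) (a A A' B B' C C' : R) :
  - (a * A + A') - (a * B + B') - (a * C + C') = a * (- A - B - C) + (- A' - B' - C').
Proof. by ring. Qed.

Lemma linear_sub4 (R : realType) (n : nat) (f : {linear 'rV[R]_n -> 'rV[R]_n}) A B C D :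
  f (A - B - C - D) = f A - f B - f C - f D.
Proof. by rewrite !raddfB. Qed.

Lemma eq_mulmxr (R : realType) (n : nat) (A B : 'M[R]_n) :
  (forall z : 'rV_n, z *m A = z *m B) -> A = B.
Proof. by move=> h; apply/row_matrixP => i; rewrite !rowE. Qed.

Section LeviCivita.
Variables (R : realType) (n : nat) (br : bracket R n) (G : 'M[R]_n).
Hypotheses (lie : is_lie_bracket br) (Gip : is_inner_product G).
Implicit Types (x y z u v : 'rV[R]_n).

Let brl z a u v : br (a *: u + v) z = a *: br u z + br v z.
Proof. by case: lie => h _ _ _; rewrite h. Qed.

Let brr z a u v : br z (a *: u + v) = a *: br z u + br z v.
Proof. by case: lie => _ h _ _; rewrite h. Qed.

Let ipl y a u v : ip G (a *: u + v) y = a * ip G u y + ip G v y.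
Proof. exact: (ip_bilinear G).1. Qed.

Let ipr x a u v : ip G x (a *: u + v) = a * ip G x u + ip G x v.
Proof. exact: (ip_bilinear G).2. Qed.

Lemma koszul_linear1 y z : scalar (fun x => koszul br G x y z).
Proof. by move=> a u v; rewrite /koszul brl ipl brr !ipr ipl; ring. Qed.

Lemma koszul_linear2 x z : scalar (fun y => koszul br G x y z).
Proof. by move=> a u v; rewrite /koszul brr brl !ipl ipr; ring. Qed.

Lemma koszul_linear3 x y : scalar (koszul br G x y).
Proof. by move=> a u v; rewrite /koszul brr brl !ipl ipr; ring. Qed.

Lemma ip_nabla x y z : ip G (nabla br G x y) z = koszul br G x y z.
Proof. exact: (ip_sharp (inner_product_unit Gip) (koszul_linear3 x y)). Qed.

Lemma nabla_linear1 y : linear (fun x => nabla br G x y).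
Proof.
move=> a u v; apply: (ip_injl (inner_product_unit Gip)) => z.
by rewrite ipl !ip_nabla koszul_linear1.
Qed.

Lemma nabla_linear2 x : linear (nabla br G x).
Proof.
move=> a u v; apply: (ip_injl (inner_product_unit Gip)) => z.
by rewrite ipl !ip_nabla koszul_linear2.
Qed.

Lemma curv_linear1 y z : linear (fun x => curv br G x y z).
Proof.
by move=> a u v; rewrite /curv brl !nabla_linear1 !nabla_linear2; exact: lincomb3.
Qed.

Lemma curv_linear2 x z : linear (fun y => curv br G x y z).
Proof.
by move=> a u v; rewrite /curv brr !nabla_linear1 !nabla_linear2; exact: lincomb3.
Qed.

Lemma curv_linear3 x y : linear (curv br G x y).
Proof.
by move=> a u v; rewrite /curv !nabla_linear2; exact: lincomb3.
Qed.

Lemma lin1_mxDZ (f g h : 'rV[R]_n -> 'rV[R]_n) a :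
  (forall x, f x = a *: g x + h x) -> lin1_mx f = a *: lin1_mx g + lin1_mx h.
Proof. by move=> e; apply/matrixP => i j; rewrite !mxE e !mxE. Qed.

Lemma ricci_bilinear : bilinear_form (ricci br G).
Proof.
split=> [y a u v | x a u v]; rewrite /ricci -mxtraceZ -mxtraceD;
  congr (\tr _); apply: lin1_mxDZ => z.
  exact: curv_linear2.
exact: curv_linear3.
Qed.

Lemma ip_ricci_op x y : ip G (ricci_op br G x) y = ricci br G x y.
Proof. exact: (ip_sharp (inner_product_unit Gip) (ricci_bilinear.2 x)). Qed.

Lemma curv4_bilinear x y : bilinear_form (fun z w => curv4 br G x z y w).
Proof.
split=> [w a u v | z a u v]; rewrite /curv4.
  by rewrite curv_linear2 ipl.
by rewrite curv_linear3 ipl.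
Qed.

Section Form.
Variable T : 'rV[R]_n -> 'rV[R]_n -> R.
Hypothesis Tb : bilinear_form T.

Let Tl y a u v : T (a *: u + v) y = a * T u y + T v y.
Proof. exact: Tb.1. Qed.

Let Tr x a u v : T x (a *: u + v) = a * T x u + T x v.
Proof. exact: Tb.2. Qed.

Lemma nabla_form_linear1 x y : scalar (fun v => nabla_form br G T v x y).
Proof. by move=> a u v; rewrite /nabla_form !nabla_linear1 Tl Tr; ring. Qed.

Lemma nabla_form_linear2 v y : scalar (fun x => nabla_form br G T v x y).
Proof. by move=> a x z; rewrite /nabla_form nabla_linear2 !Tl; ring. Qed.

Lemma nabla_form_linear3 v x : scalar (nabla_form br G T v x).
Proof. by move=> a y z; rewrite /nabla_form nabla_linear2 !Tr; ring. Qed.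

Lemma nabla2_form_bilinear x y :
  bilinear_form (fun u v => nabla2_form br G T u v x y).
Proof.
split=> [v a u u' | u a v v']; rewrite /nabla2_form.
  rewrite !nabla_linear1 nabla_form_linear1 nabla_form_linear2 nabla_form_linear3.
  exact: lincomb3_scalar.
rewrite nabla_linear2 !nabla_form_linear1; exact: lincomb3_scalar.
Qed.

End Form.

End LeviCivita.

Section Homothety.
Variables (R : realType) (n : nat) (br br' : bracket R n) (G G' : 'M[R]_n).
Hypotheses (lie : is_lie_bracket br) (lie' : is_lie_bracket br').
Hypotheses (Gip : is_inner_product G) (Gip' : is_inner_product G').
Variables (f : {linear 'rV[R]_n -> 'rV[R]_n}) (c : R).
Hypotheses (fbij : bijective f) (c0 : 0 < c).
Hypothesis fbr : forall x y, f (br x y) = br' (f x) (f y).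
Hypothesis fip : forall x y, ip G' (f x) (f y) = c * ip G x y.
Implicit Types (x y z u v : 'rV[R]_n).

Let P := lin1_mx f.

Let Pf x : f x = x *m P. Proof. by rewrite mul_rV_lin1. Qed.

Let Pu : P \in unitmx.
Proof.
rewrite -row_free_unit -kermx_eq0; apply/eqP/row_matrixP => i; rewrite row0.
apply: (bij_inj fbij); rewrite raddf0 Pf -row_mul mulmx_ker; exact: row0.
Qed.

Let eq_f u v : (forall z, ip G' u (f z) = ip G' v (f z)) -> u = v.
Proof.
move=> h; apply: (ip_injl (inner_product_unit Gip')) => z.
by case: fbij => g _ gK; rewrite -(gK z).
Qed.

(** Both sides of the Koszul formula are multiplied by the same factor [c], which therefore
    cancels. *)
Lemma nabla_hom x y : f (nabla br G x y) = nabla br' G' (f x) (f y).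
Proof.
apply: eq_f => z; rewrite fip !ip_nabla // /koszul -!fbr !fip; ring.
Qed.

Lemma curv_hom x y z : f (curv br G x y z) = curv br' G' (f x) (f y) (f z).
Proof. by rewrite /curv !raddfB /= !nabla_hom fbr. Qed.

Lemma nabla_curv_hom v x y z :
  f (nabla_curv br G v x y z) = nabla_curv br' G' (f v) (f x) (f y) (f z).
Proof. by rewrite /nabla_curv linear_sub4 nabla_hom 4!curv_hom 3!nabla_hom. Qed.

Lemma locally_symmetric_hom : locally_symmetric br G -> locally_symmetric br' G'.
Proof.
move=> sym v x y z; case: fbij => g _ gK.
rewrite -(gK v) -(gK x) -(gK y) -(gK z).
by rewrite -nabla_curv_hom sym raddf0.
Qed.

Lemma ricci_hom x y : ricci br' G' (f x) (f y) = ricci br G x y.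
Proof.
rewrite /ricci; set A' := lin1_mx _; set A := lin1_mx _.
have AE z : z *m A = curv br G z x y := lin1_mxE z (curv_linear1 lie Gip x y).
have A'E z : z *m A' = curv br' G' z (f x) (f y) :=
  lin1_mxE z (curv_linear1 lie' Gip' (f x) (f y)).
(* The two endomorphisms are conjugate by [P], hence have equal traces: the Ricci form does not see
   the factor [c]. *)
suff e : A *m P = P *m A'.
  by rewrite -[A](mulmxK Pu) e mxtrace_mulC mulmxA mulVmx // mul1mx.
apply: eq_mulmxr => z; rewrite 2!mulmxA AE -Pf -(Pf z) A'E; exact: curv_hom.
Qed.

Lemma gram_hom T T' : bilinear_form T -> bilinear_form T' ->
  (forall x y, T' (f x) (f y) = T x y) -> P *m gram T' *m P^T = gram T.
Proof.
move=> Tb Tb' e; apply: eq_ip_mx => x y; rewrite ip_gram // -e !Pf.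
by rewrite -(ip_gram Tb') /ip trmx_mul !mulmxA.
Qed.

(** Each contraction with the inverse metric costs a factor [c^-1]; the powers of [c] in the lemmas
    below count contractions. *)
Let G'E : invmx G' = c^-1 *: (P^T *m invmx G *m P).
Proof.
have Gu := inner_product_unit Gip; have Gu' := inner_product_unit Gip'.
have PtU : P^T \in unitmx by rewrite unitmx_tr.
have e : P *m G' *m P^T = c *: G.
  apply: eq_ip_mx => x y.
  have := fip x y; rewrite !Pf /ip trmx_mul !mulmxA => ->.
  by rewrite -scalemxAr -scalemxAl [RHS]mxE.
have e' : P *m G' = c *: G *m invmx P^T by rewrite -e mulmxK.
have cn0 : c != 0 by rewrite gt_eqF.
set X := _ *: _; suff XG : X *m G' = 1%:M by rewrite -[LHS]mul1mx -XG mulmxK.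
rewrite /X -scalemxAl -(mulmxA _ P G') e' -(scalemxAl c) -scalemxAr scalerA.
by rewrite mulVf // scale1r mulmxA -(mulmxA P^T) mulVmx // mulmx1 mulmxV.
Qed.

Lemma metric_trace_hom T T' : bilinear_form T -> bilinear_form T' ->
  (forall x y, T' (f x) (f y) = T x y) ->
  metric_trace G' T' = c^-1 * metric_trace G T.
Proof.
move=> Tb Tb' e; rewrite !metric_traceE -(gram_hom Tb Tb' e) G'E.
rewrite -scalemxAl mxtraceZ; congr (_ * _).
rewrite -!mulmxA mxtrace_mulC !trmx_mul trmxK !mulmxA; congr (\tr _).
Qed.

Lemma contract_hom S S' T T' :
  bilinear_form S -> bilinear_form S' -> bilinear_form T -> bilinear_form T' ->
  (forall x y, S' (f x) (f y) = S x y) -> (forall x y, T' (f x) (f y) = T x y) ->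
  contract G' S' T' = c^-1 ^+ 2 * contract G S T.
Proof.
move=> Sb Sb' Tb Tb' eS eT.
rewrite !contractE -(gram_hom Sb Sb' eS) -(gram_hom Tb Tb' eT) G'E.
rewrite linearZ /= -!scalemxAl -!scalemxAr -!scalemxAl scalerA mxtraceZ.
rewrite expr2; congr (_ * _).
rewrite !trmx_mul !trmxK -!mulmxA [LHS]mxtrace_mulC !mulmxA.
by [].
Qed.

Lemma scal_hom : scal br' G' = c^-1 * scal br G.
Proof. exact: metric_trace_hom (ricci_bilinear _ _) (ricci_bilinear _ _) ricci_hom. Qed.

Lemma energy_hom t : energy br' G' t = c^-1 ^+ 2 * energy br G t.
Proof.
have -> : energy br' G' t = contract G' (ricci br' G') (ricci br' G')
  + t * scal br' G' ^+ 2 by [].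
rewrite (contract_hom (ricci_bilinear _ _) (ricci_bilinear _ _)
  (ricci_bilinear _ _) (ricci_bilinear _ _) ricci_hom ricci_hom) // scal_hom.
by rewrite -[energy _ _ _]/(contract G _ _ + _); ring.
Qed.

Lemma nabla_form_hom T T' : (forall x y, T' (f x) (f y) = T x y) ->
  forall v x y, nabla_form br' G' T' (f v) (f x) (f y) = nabla_form br G T v x y.
Proof. by move=> e v x y; rewrite /nabla_form -!nabla_hom !e. Qed.

Lemma nabla2_form_hom T T' : (forall x y, T' (f x) (f y) = T x y) ->
  forall u v x y,
  nabla2_form br' G' T' (f u) (f v) (f x) (f y) = nabla2_form br G T u v x y.
Proof.
by move=> e u v x y; rewrite /nabla2_form -!nabla_hom !(nabla_form_hom e).
Qed.

Lemma rough_laplacian_hom T T' : bilinear_form T -> bilinear_form T' ->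
  (forall x y, T' (f x) (f y) = T x y) ->
  forall x y,
  rough_laplacian br' G' T' (f x) (f y) = c^-1 * rough_laplacian br G T x y.
Proof.
move=> Tb Tb' e x y; apply: metric_trace_hom => [||u v].
- exact: nabla2_form_bilinear.
- exact: nabla2_form_bilinear.
- exact: nabla2_form_hom.
Qed.

Lemma curv_ricciE (b : bracket R n) H x y :
  curv_ricci b H x y = contract H (ricci b H) (fun z w => curv4 b H x z y w).
Proof. by apply: eq_bigr => k _; apply: eq_bigr => l _; rewrite mulrC. Qed.

Lemma contractZr (H : 'M[R]_n) a S T :
  contract H S (fun z w => a * T z w) = a * contract H S T.
Proof.
rewrite /contract big_distrr; apply: eq_bigr => k _; rewrite big_distrr.
by apply: eq_bigr => l _ /=; ring.
Qed.

Lemma curv_ricci_hom x y :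
  curv_ricci br' G' (f x) (f y) = c^-1 * curv_ricci br G x y.
Proof.
have cn0 : c != 0 by rewrite gt_eqF.
have b4 := curv4_bilinear lie Gip x y.
rewrite !curv_ricciE.
(* [curv4] lowers an index with the metric and so gains a factor [c], which offsets one of the two
   factors [c^-1] of the contraction. *)
rewrite (@contract_hom (ricci br G) _ (fun z w => c * curv4 br G x z y w)).
- by rewrite contractZr; field.
- exact: ricci_bilinear.
- exact: ricci_bilinear.
- by split=> [w a u v | z a u v]; rewrite ?b4.1 ?b4.2; ring.
- exact: curv4_bilinear.
- exact: ricci_hom.
- by move=> z w; rewrite /curv4 -curv_hom fip.
Qed.

Lemma F_critical_expr_hom t x y :
  - rough_laplacian br' G' (ricci br' G') (f x) (f y)
  + 2%:R^-1 * energy br' G' t * ip G' (f x) (f y)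
  - 2%:R * curv_ricci br' G' (f x) (f y)
  - 2%:R * t * scal br' G' * ricci br' G' (f x) (f y) =
  c^-1 * (- rough_laplacian br G (ricci br G) x y
  + 2%:R^-1 * energy br G t * ip G x y
  - 2%:R * curv_ricci br G x y
  - 2%:R * t * scal br G * ricci br G x y).
Proof.
have cn0 : c != 0 by rewrite gt_eqF.
rewrite (rough_laplacian_hom (ricci_bilinear _ _) (ricci_bilinear _ _) ricci_hom) //.
by rewrite energy_hom curv_ricci_hom scal_hom ricci_hom fip; field.
Qed.

Lemma einstein_hom : is_einstein br G -> is_einstein br' G'.
Proof.
have cn0 : c != 0 by rewrite gt_eqF.
move=> [k ek]; exists (c^-1 * k) => x y; case: fbij => g _ gK.
by rewrite -(gK x) -(gK y) ricci_hom ek fip; field.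
Qed.

Lemma ricci_op_hom x : ricci_op br' G' (f x) = c^-1 *: f (ricci_op br G x).
Proof.
have cn0 : c != 0 by rewrite gt_eqF.
apply: eq_f => z; rewrite ip_ricci_op // ricci_hom.
rewrite -[_ *: _]addr0 (ip_bilinear G').1 fip ip_ricci_op // /ip !mul0mx mxE.
by field.
Qed.

End Homothety.

Section Homothetic.
Variables (R : realType) (n : nat).
Implicit Types (br : bracket R n) (G : 'M[R]_n).

Lemma lin1_mx_bij (f : {linear 'rV[R]_n -> 'rV[R]_n}) :
  bijective f -> lin1_mx f \in unitmx.
Proof.
move=> fbij; rewrite -row_free_unit -kermx_eq0; apply/eqP/row_matrixP => i.
rewrite row0; apply: (bij_inj fbij).
by rewrite raddf0 -(mul_rV_lin1 f) -row_mul mulmx_ker; exact: row0.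
Qed.

Lemma linear_scale (g : 'rV[R]_n -> 'rV[R]_n) a u :
  linear g -> g (a *: u) = a *: g u.
Proof.
move=> gl; pose L : {linear 'rV[R]_n -> 'rV[R]_n} := HB.pack_for
  {linear 'rV[R]_n -> 'rV[R]_n} g (GRing.isLinear.Build _ _ _ _ g gl).
exact: (linearZ_LR L).
Qed.

Lemma homothetic_mx br G br' G' (P : 'M[R]_n) (c : R) :
  P \in unitmx -> 0 < c -> (forall x y, br x y *m P = br' (x *m P) (y *m P)) ->
  (forall x y, ip G' (x *m P) (y *m P) = c * ip G x y) ->
  isomorphically_homothetic br G br' G'.
Proof.
move=> Pu c0 Pbr Pip; exists (mulmxr P), c; split=> //; split=> //.
by exists (mulmxr (invmx P)) => x /=; rewrite ?mulmxK ?mulmxKV.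
Qed.

Lemma homothetic_mxP br G br' G' : isomorphically_homothetic br G br' G' ->
  exists P : 'M[R]_n, exists2 c : R, 0 < c & [/\ P \in unitmx,
    forall x y, br x y *m P = br' (x *m P) (y *m P) &
    forall x y, ip G' (x *m P) (y *m P) = c * ip G x y].
Proof.
move=> [f [c [[fbij fbr] c0 fip]]]; exists (lin1_mx f), c => //.
by split=> [|x y|x y]; rewrite ?lin1_mx_bij // !mul_rV_lin1.
Qed.

Lemma homothetic_sym br G br' G' : isomorphically_homothetic br G br' G' ->
  isomorphically_homothetic br' G' br G.
Proof.
move=> /homothetic_mxP [P [c c0 [Pu Pbr Pip]]].
apply: (@homothetic_mx _ _ _ _ (invmx P) c^-1) => [||x y|x y].
- by rewrite unitmx_inv.
- by rewrite invr_gt0.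
- by rewrite -{1}(mulmxKV Pu x) -{1}(mulmxKV Pu y) -Pbr mulmxK.
- have := Pip (x *m invmx P) (y *m invmx P); rewrite !mulmxKV // => ->.
  by rewrite mulKf // gt_eqF.
Qed.

Lemma homothetic_trans br2 G2 br1 G1 br3 G3 :
  isomorphically_homothetic br1 G1 br2 G2 ->
  isomorphically_homothetic br2 G2 br3 G3 ->
  isomorphically_homothetic br1 G1 br3 G3.
Proof.
move=> /homothetic_mxP [P [c c0 [Pu Pbr Pip]]].
move=> /homothetic_mxP [Q [d d0 [Qu Qbr Qip]]].
apply: (@homothetic_mx _ _ _ _ (P *m Q) (d * c)) => [||x y|x y].
- by rewrite unitmx_mul Pu.
- exact: mulr_gt0.
- by rewrite !mulmxA Pbr Qbr.
- by rewrite !mulmxA Qip Pip mulrA.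
Qed.

Lemma inner_product1 : is_inner_product (1%:M : 'M[R]_n).
Proof.
split=> [|x x0]; first exact: trmx1.
rewrite mulmx1 mxE; under eq_bigr do rewrite mxE -expr2.
rewrite lt_def sumr_ge0 ?andbT => [|i _]; last exact: sqr_ge0.
apply: contra x0 => /eqP s0; apply/eqP/rowP => i; rewrite mxE; apply/eqP.
rewrite -sqrf_eq0; apply/eqP.
by apply: (psumr_eq0P _ s0) => // j _; exact: sqr_ge0.
Qed.

Lemma lie_bracket_iso br br' (f : {linear 'rV[R]_n -> 'rV[R]_n}) :
  is_lie_bracket br -> is_lie_iso br br' f -> is_lie_bracket br'.
Proof.
move=> [brl brr br0 brJ] [[g fK gK] fbr].
have fbr' x y : br' x y = f (br (g x) (g y)) by rewrite fbr !gK.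
have gl a u v : g (a *: u + v) = a *: g u + g v.
  by apply: (can_inj fK); rewrite linearP !gK.
split=> [z a u v|z a u v|x|x y z].
- by rewrite !fbr' gl brl linearP.
- by rewrite !fbr' gl brr linearP.
- by rewrite fbr' br0 raddf0.
- by rewrite !fbr' !fK -!raddfD brJ raddf0.
Qed.

Lemma homothetic_lie br G br' G' : is_lie_bracket br ->
  isomorphically_homothetic br G br' G' -> is_lie_bracket br'.
Proof. by move=> lie [f [c [iso _ _]]]; exact: lie_bracket_iso iso. Qed.

Lemma homothetic_locally_symmetric br G br' G' :
  is_lie_bracket br -> is_inner_product G -> is_inner_product G' ->
  isomorphically_homothetic br G br' G' ->
  locally_symmetric br G -> locally_symmetric br' G'.
Proof.
move=> lie ipG ipG' h; have lie' := homothetic_lie lie h.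
by case: h => f [c [[fbij fbr] c0 fip]]; exact: (locally_symmetric_hom _ _ _ _ fbij).
Qed.

Lemma homothetic_einstein br G br' G' :
  is_lie_bracket br -> is_inner_product G -> is_inner_product G' ->
  isomorphically_homothetic br G br' G' ->
  is_einstein br G -> is_einstein br' G'.
Proof.
move=> lie ipG ipG' h; have lie' := homothetic_lie lie h.
by case: h => f [c [[fbij fbr] c0 fip]]; exact: (einstein_hom _ _ _ _ fbij c0).
Qed.

Lemma homothetic_soliton br G br' G' :
  is_lie_bracket br -> is_inner_product G -> is_inner_product G' ->
  isomorphically_homothetic br G br' G' ->
  is_algebraic_ricci_soliton br G -> is_algebraic_ricci_soliton br' G'.
Proof.
move=> lie ipG ipG' h; have lie' := homothetic_lie lie h.
case: h => f [c [[fbij fbr] c0 fip]] [l [D [Dder ricD]]].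
have fop := ricci_op_hom lie lie' ipG ipG' fbij c0 fbr fip.
case: (fbij) => g fK gK.
have gl : linear g by move=> a u v; apply: (can_inj fK); rewrite linearP !gK.
have gbr x y : g (br' x y) = br (g x) (g y).
  by apply: (can_inj fK); rewrite fbr !gK.
(* The Ricci operator is conjugated by [f] and scaled by [c^-1], so the derivation must transform in
   the same way. *)
pose D' x := c^-1 *: f (D (g x)).
have D'l : linear D'.
  by move=> a u v; rewrite /D' gl !linearP.
pose L : {linear 'rV[R]_n -> 'rV[R]_n} := HB.pack_for
  {linear 'rV[R]_n -> 'rV[R]_n} D' (GRing.isLinear.Build _ _ _ _ D' D'l).
exists (c^-1 * l), L; split=> [x y|x]; rewrite -?[L : _ -> _]/D' /=.
  case: lie' => brl' brr' _ _.
  have fD u v : f (u + v) = f u + f v by exact: raddfD.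
  rewrite /D' gbr Dder fD scalerDr !fbr !gK.
  by rewrite (linear_scale _ _ (brl' y)) (linear_scale _ _ (brr' x)).
by rewrite -{1}(gK x) fop ricD linearP scalerDr scalerA gK.
Qed.

End Homothetic.

Lemma homothetic_F_critical (R : realType) (br br' : bracket R 4) G G' t :
  is_lie_bracket br -> is_inner_product G -> is_inner_product G' ->
  isomorphically_homothetic br G br' G' ->
  F_critical br G t -> F_critical br' G' t.
Proof.
move=> lie ipG ipG' h; have lie' := homothetic_lie lie h.
case: h => f [c [[fbij fbr] c0 fip]] crit x y; case: (fbij) => g _ gK.
have := F_critical_expr_hom lie lie' ipG ipG' fbij c0 fbr fip t (g x) (g y).
by rewrite crit mulr0 !gK.
Qed.

(** * Reduction to a normal form *)

(* Cholesky factorisation, by induction on Schur complements. *)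
Lemma trig_orthonormal_basis (R : realType) (n : nat) (G : 'M[R]_n) :
  is_inner_product G ->
  exists2 P : 'M[R]_n, is_trig_mx P & P *m G *m P^T = 1%:M.
Proof.
elim: n G => [|n IHn] G; first by exists 0; [exact: mx0_is_trig | apply/matrixP; case].
have [g [r [r' [G0 ->]]]] : exists (g : 'M[R]_1) r r' (G0 : 'M[R]_n),
    G = block_mx g r r' G0 :> 'M_(1 + n).
  exists (@ulsubmx R 1 n 1 n G), (@ursubmx R 1 n 1 n G), (@dlsubmx R 1 n 1 n G).
  by exists (@drsubmx R 1 n 1 n G); rewrite (@submxK R 1 n 1 n G).
move=> [sym pos].
have /eq_block_mx [gs r's rs G0s] : block_mx g^T r'^T r^T G0^T = block_mx g r r' G0.
  by rewrite -tr_block_mx.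
have mulg m (y : 'M[R]_(m, 1)) : y *m g = g 0 0 *: y.
  by rewrite {1}[g]mx11_scalar mul_mx_scalar.
have pos' (a : 'rV[R]_1) (x : 'rV[R]_n) : row_mx a x != 0 ->
  0 < ((a *m g + x *m r') *m a^T + (a *m r + x *m G0) *m x^T) 0 0.
  move=> h; have := pos (row_mx a x) h; congr (_ < _); congr (_ 0 0).
  by rewrite -mul_row_col -tr_row_mx -mul_row_block.
have g0 : 0 < g 0 0.
  have /pos' : row_mx 1%:M 0 != 0 :> 'rV[R]_(1 + n).
    by rewrite row_mx_eq0 negb_and (matrix_nonzero1 R 0).
  by rewrite !mul1mx !mul0mx !addr0 trmx0 trmx1 mulmx0 addr0 mulmx1.
have gn0 : g 0 0 != 0 by rewrite gt_eqF.
pose S := G0 - (g 0 0)^-1 *: (r' *m r).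
have Sip : is_inner_product S.
  split=> [|x x0]; first by rewrite /S linearB /= linearZ /= trmx_mul r's rs G0s.
  (* This vector is the component of (0, x) orthogonal to the first basis vector; the form on it
     equals the form of [S] on [x]. *)
  have /pos' : row_mx (- (g 0 0)^-1 *: (x *m r')) x != 0 :> 'rV[R]_(1 + n).
    by rewrite row_mx_eq0 negb_and x0 orbT.
  rewrite mulg scalerA mulrN divff // scaleN1r addNr mul0mx add0r.
  by rewrite /S mulmxBr -scalemxAr mulmxA -scalemxAl scaleNr addrC.
have [P Ptr PS] := IHn S Sip.
pose d := (Num.sqrt (g 0 0))^-1.
have dE : d * d * g 0 0 = 1.
  by rewrite -expr2 exprVn sqr_sqrtr ?ltW // mulVf.
pose Q : 'M[R]_(1 + n) := block_mx d%:M 0 (- (g 0 0)^-1 *: (P *m r')) P.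
have Qtr : is_trig_mx Q.
  by rewrite is_trig_block_mx //= eqxx Ptr /= andbT scalar_mx_is_trig.
have QG : Q *m block_mx g r r' G0 *m Q^T = 1%:M.
  rewrite mulmx_block tr_block_mx mulmx_block !mul0mx !addr0.
  have -> : - (g 0 0)^-1 *: (P *m r') *m g + P *m r' = 0.
    by rewrite mulg scalerA mulrN divff // scaleN1r addNr.
  have -> : - (g 0 0)^-1 *: (P *m r') *m r + P *m G0 = P *m S.
    by rewrite /S mulmxBr -scalemxAr mulmxA -scalemxAl scaleNr addrC.
  have -> : d%:M *m g *m (- (g 0 0)^-1 *: (P *m r'))^T + d%:M *m r *m P^T = 0.
    rewrite mulg linearZ /= trmx_mul r's -!mulmxA -!scalemxAl -scalemxAr scalerA.
    by rewrite mulrN divff // scaleN1r addNr.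
  rewrite !mul0mx trmx0 !mulmx0 !addr0 !add0r PS tr_scalar_mx mulg.
  rewrite scale_scalar_mx -scalar_mxM -mulrA mulrC dE -scalar_mx_block.
  by [].
by exists Q.
Qed.

Section Coordinates.
Variable R : realType.
Implicit Types (x y : 'rV[R]_4).

Definition rv4 (a b c d : R) : 'rV[R]_4 := \row_j nth 0 [:: a; b; c; d] j.

Definition mx4 (r1 r2 r3 r4 : 'rV[R]_4) : 'M[R]_4 :=
  \matrix_i nth 0 [:: r1; r2; r3; r4] i.

(* The brackets with [e_1, e_2] = 0 and all values in span(e_1, e_2):
   [e_1, e_3] = (a, b), [e_2, e_3] = (c, d), [e_1, e_4] = (a', b'),
   [e_2, e_4] = (c', d'), [e_3, e_4] = (p, q). *)
Definition solv (a b c d a' b' c' d' p q : R) : bracket R 4 := fun x y =>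
  let X i j := x 0 i * y 0 j - x 0 j * y 0 i in
  rv4 (a * X i1 i3 + c * X i2 i3 + a' * X i1 i4 + c' * X i2 i4 + p * X i3 i4)
      (b * X i1 i3 + d * X i2 i3 + b' * X i1 i4 + d' * X i2 i4 + q * X i3 i4)
      0 0.

Lemma rv4P (P : 'rV[R]_4 -> Prop) :
  (forall a b c d, P (rv4 a b c d)) -> forall x, P x.
Proof.
move=> h x; have -> : x = rv4 (x 0 i1) (x 0 i2) (x 0 i3) (x 0 i4); last exact: h.
apply/rowP => -[[|[|[|[|//]]]] Hi]; rewrite mxE /=; congr (x 0 _); exact: val_inj.
Qed.

Lemma rv4_eta x : x = rv4 (x 0 i1) (x 0 i2) (x 0 i3) (x 0 i4).
Proof.
apply/rowP => -[[|[|[|[|//]]]] Hi]; rewrite mxE /=; congr (x 0 _); exact: val_inj.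
Qed.

Lemma rv4_1 a b c d : rv4 a b c d 0 i1 = a. Proof. by rewrite mxE. Qed.
Lemma rv4_2 a b c d : rv4 a b c d 0 i2 = b. Proof. by rewrite mxE. Qed.
Lemma rv4_3 a b c d : rv4 a b c d 0 i3 = c. Proof. by rewrite mxE. Qed.
Lemma rv4_4 a b c d : rv4 a b c d 0 i4 = d. Proof. by rewrite mxE. Qed.

Lemma sum_ord4 (V : zmodType) (F : 'I_4 -> V) :
  \sum_i F i = F i1 + F i2 + F i3 + F i4.
Proof.
rewrite !big_ord_recl big_ord0 addr0 !addrA.
by congr (F _ + F _ + F _ + F _); exact: val_inj.
Qed.

Lemma ip1 x y : ip 1%:M x y =
  x 0 i1 * y 0 i1 + x 0 i2 * y 0 i2 + x 0 i3 * y 0 i3 + x 0 i4 * y 0 i4.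
Proof. by rewrite /ip mulmx1 mxE sum_ord4 !mxE. Qed.

Lemma rv4D a b c d a' b' c' d' :
  rv4 a b c d + rv4 a' b' c' d' = rv4 (a + a') (b + b') (c + c') (d + d').
Proof. by apply/rowP => -[[|[|[|[|//]]]] Hi]; rewrite !mxE. Qed.

Lemma rv4Z k a b c d : k *: rv4 a b c d = rv4 (k * a) (k * b) (k * c) (k * d).
Proof. by apply/rowP => -[[|[|[|[|//]]]] Hi]; rewrite !mxE. Qed.

Lemma rv4N a b c d : - rv4 a b c d = rv4 (- a) (- b) (- c) (- d).
Proof. by apply/rowP => -[[|[|[|[|//]]]] Hi]; rewrite !mxE. Qed.

Lemma rv4_delta : (e_ R i1 = rv4 1 0 0 0) * (e_ R i2 = rv4 0 1 0 0)
  * (e_ R i3 = rv4 0 0 1 0) * (e_ R i4 = rv4 0 0 0 1).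
Proof.
by do !split; apply/rowP => -[[|[|[|[|//]]]] Hi]; rewrite !mxE.
Qed.

Lemma mulmx4 x r1 r2 r3 r4 : x *m mx4 r1 r2 r3 r4 =
  x 0 i1 *: r1 + x 0 i2 *: r2 + x 0 i3 *: r3 + x 0 i4 *: r4.
Proof.
by apply/rowP => j; rewrite mxE sum_ord4 !mxE.
Qed.

Lemma mx4_eta (M : 'M[R]_4) :
  M = mx4 (row i1 M) (row i2 M) (row i3 M) (row i4 M).
Proof.
apply/matrixP => -[[|[|[|[|//]]]] Hi] j; rewrite !mxE /=; congr (M _ _);
  exact: val_inj.
Qed.

(** Invertibility of [P] is automatic: on its kernel the homothety relation makes the positive
    definite form [G] vanish. *)
Lemma homothetic_mx4 (br br' : bracket R 4) (G G' : 'M[R]_4) (P : 'M_4) c :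
  is_inner_product G -> 0 < c ->
  (forall x y, br x y *m P = br' (x *m P) (y *m P)) ->
  (forall x y, ip G' (x *m P) (y *m P) = c * ip G x y) ->
  isomorphically_homothetic br G br' G'.
Proof.
move=> Gip c0 Pbr Pip; apply: (@homothetic_mx _ _ _ _ _ _ P c) => //.
rewrite -row_free_unit -kermx_eq0; apply/eqP/row_matrixP => i; rewrite row0.
apply: contraPeq (Pip (row i (kermx P)) (row i (kermx P))) => k0.
rewrite -row_mul mulmx_ker row0 /ip !mul0mx mxE => /esym/eqP.
by rewrite mulf_eq0 !gt_eqF //; exact: Gip.2.
Qed.

Lemma homothetic_eq (br br' : bracket R 4) (G : 'M[R]_4) :
  (forall x y, br x y = br' x y) -> isomorphically_homothetic br G br' G.
Proof.
move=> e; apply: (@homothetic_mx _ _ _ _ _ _ 1%:M 1) => [||x y|x y].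
- exact: unitmx1.
- exact: ltr01.
- by rewrite !mulmx1.
- by rewrite !mulmx1 mul1r.
Qed.

End Coordinates.

Arguments rv4 {R}.
Arguments solv {R}.

Ltac coord :=
  rewrite ?/solv /= ?mulmx4 ?rv4Z ?rv4N ?rv4D ?rv4_1 ?rv4_2 ?rv4_3 ?rv4_4.

Section NormalForm.
Variable R : realType.

(** A certificate rule: the goal is exhibited as a combination, with given coefficients, of three
    known equations. *)
Lemma eq_lincomb3 (k1 k2 k3 a1 b1 a2 b2 a3 b3 x y : R) :
  a1 = b1 -> a2 = b2 -> a3 = b3 ->
  x - y = k1 * (a1 - b1) + k2 * (a2 - b2) + k3 * (a3 - b3) -> x = y.
Proof. by move=> -> -> ->; rewrite !subrr !mulr0 !addr0 => /subr0_eq. Qed.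

(* [ad e_4 = beta + gamma * ad e_3] on span(e_1, e_2). *)
Definition solv2 (x y z beta gamma p q : R) : bracket R 4 :=
  solv x y z (- x) (beta + gamma * x) (gamma * y) (gamma * z) (beta - gamma * x) p q.

Lemma solv_rotate_plane (x y z beta gamma p q : R) :
  exists y' z' p' q', y' * z' = x ^+ 2 + y * z /\
    isomorphically_homothetic (solv2 x y z beta gamma p q) 1%:M
      (solv2 0 y' z' beta gamma p' q') 1%:M.
Proof.
have [c [s [cs rot]]] : exists c s : R, c ^+ 2 + s ^+ 2 = 1 /\
    (c ^+ 2 - s ^+ 2) * x + c * s * (y + z) = 0.
  have [->|x0] := eqVneq x 0; first by exists 1, 0; split; ring.
  (* The symmetric part of the block has entries x, h, h, -x and eigenvalues r and -r. The vector (r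
     + h, -x) has half the polar angle of (h, -x), so the double angle has cosine h / r and sine -x
     / r. It is non-zero because [x] is. *)
  pose h := (y + z) / 2%:R; pose r := Num.sqrt (x ^+ 2 + h ^+ 2).
  have r2 : r ^+ 2 = x ^+ 2 + h ^+ 2 by rewrite sqr_sqrtr // addr_ge0 ?sqr_ge0.
  pose d := (r + h) ^+ 2 + x ^+ 2.
  have d0 : 0 < d by rewrite /d ltr_wpDl ?sqr_ge0 // lt_def sqrf_eq0 x0 sqr_ge0.
  pose k := Num.sqrt d; have k2 : k ^+ 2 = d by rewrite sqr_sqrtr // ltW.
  have k0 : k != 0 by rewrite gt_eqF // sqrtr_gt0.
  have yzh : y + z = 2%:R * h by rewrite /h; field.
  exists ((r + h) / k), (- x / k); split.
    by rewrite !expr_div_n k2 -mulrDl sqrrN -/d divff // gt_eqF.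
  rewrite yzh; apply: (mulfI (expf_neq0 2 k0)); rewrite mulr0.
  transitivity (x * (r ^+ 2) - x * h ^+ 2 - x * x ^+ 2).
    by field.
  by rewrite r2; ring.
exists (c ^+ 2 * y - s ^+ 2 * z - 2%:R * c * s * x).
exists (c ^+ 2 * z - s ^+ 2 * y - 2%:R * c * s * x).
exists (c * p + s * q), (c * q - s * p); split.
  (* This quantity is minus the determinant of ad e_3 on the plane, a rotation invariant; the
     subtracted square is zero by [rot]. *)
  have -> : x ^+ 2 + y * z = (c ^+ 2 + s ^+ 2) ^+ 2 * (x ^+ 2 + y * z)
    - ((c ^+ 2 - s ^+ 2) * x + c * s * (y + z)) ^+ 2 by rewrite cs rot; ring.
  by ring.
apply: homothetic_sym.
apply: (@homothetic_mx4 _ _ _ _ _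
  (mx4 (rv4 c s 0 0) (rv4 (- s) c 0 0) (rv4 0 0 1 0) (rv4 0 0 0 1)) 1) => //.
- exact: inner_product1.
- set y' := c ^+ 2 * y - _ - _; set z' := c ^+ 2 * z - _ - _.
  set E := (c ^+ 2 - s ^+ 2) * x + c * s * (y + z) in rot.
  have c2 : c ^+ 2 = 1 - s ^+ 2 by rewrite -cs addrK.
  have H1 : s * z = - (s * y') - c * x.
    by transitivity (s * z - E * c); [rewrite rot; ring | rewrite /y' /E; ring: c2].
  have H2 : c * y = c * y' + s * x.
    by transitivity (c * y - E * s); [rewrite rot; ring | rewrite /y' /E; ring: c2].
  have H3 : c * z = c * z' + s * x.
    by transitivity (c * z - E * s); [rewrite rot; ring | rewrite /z' /E; ring: c2].
  have H4 : s * y = - (s * z') - c * x.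
    by transitivity (s * y - E * c); [rewrite rot; ring | rewrite /z' /E; ring: c2].
  move=> u v; move: y' z' H1 H2 H3 H4 => {}y' {}z' H1 H2 H3 H4.
  pose Z i j := u 0 i * v 0 j - u 0 j * v 0 i.
  rewrite /solv2; coord; congr rv4.
  + apply: (eq_lincomb3 (k1 := - Z i1 i3 - gamma * Z i1 i4)
      (k2 := - Z i2 i3 - gamma * Z i2 i4) (k3 := p * Z i3 i4) H1 H3 c2).
    by rewrite /Z; ring.
  + apply: (eq_lincomb3 (k1 := - Z i1 i3 - gamma * Z i1 i4)
      (k2 := Z i2 i3 + gamma * Z i2 i4) (k3 := q * Z i3 i4) H2 H4 c2).
    by rewrite /Z; ring.
  + by ring.
  + by ring.
- have c2 : c ^+ 2 = 1 - s ^+ 2 by rewrite -cs addrK.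
  by move=> u v; rewrite !ip1; coord; ring: c2.
Qed.

(** The direction e_4 - gamma e_3 acts on the plane by a homothety. The rotation has determinant 1,
    so [e_3, e_4] is unchanged, and the new diagonal entry of e_3 is gamma times that of e_4; this
    is the origin of the condition [b = 0 -> B = 0]. *)
Lemma solv_rotate_normal (y z beta gamma p q : R) :
  let u := Num.sqrt (1 + gamma ^+ 2) in
  isomorphically_homothetic (solv2 0 y z beta gamma p q) 1%:M
    (solv (gamma * beta / u) (u * y) (u * z) (gamma * beta / u)
      (beta / u) 0 0 (beta / u) p q) 1%:M.
Proof.
move=> u; have u2 : u ^+ 2 = 1 + gamma ^+ 2.
  by rewrite sqr_sqrtr // addr_ge0 ?sqr_ge0.
have u0 : u != 0 by rewrite gt_eqF // sqrtr_gt0 ltr_pwDl ?sqr_ge0.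
have g2 : gamma ^+ 2 = u ^+ 2 - 1 by rewrite u2; ring.
apply: homothetic_sym.
apply: (@homothetic_mx4 _ _ _ _ _ (mx4 (rv4 1 0 0 0) (rv4 0 1 0 0)
  (rv4 0 0 u^-1 (gamma / u)) (rv4 0 0 (- gamma / u) u^-1)) 1) => //.
- exact: inner_product1.
- by move=> a b; rewrite /solv2; coord; congr rv4; field: g2.
- by move=> a b; rewrite !ip1; coord; field: g2.
Qed.

Lemma solv_scale (k a b c d a' b' c' d' p q : R) : k != 0 ->
  isomorphically_homothetic (solv a b c d a' b' c' d' p q) 1%:M
    (solv (a / k) (b / k) (c / k) (d / k) (a' / k) (b' / k) (c' / k) (d' / k)
      (p / k) (q / k)) 1%:M.
Proof.
move=> k0; apply: (@homothetic_mx4 _ _ _ _ _ (mx4 (rv4 k 0 0 0) (rv4 0 k 0 0)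
  (rv4 0 0 k 0) (rv4 0 0 0 k)) (k ^+ 2)) => //.
- exact: inner_product1.
- by rewrite lt_def sqrf_eq0 k0 sqr_ge0.
- by move=> x y; coord; congr rv4; field.
- by move=> x y; rewrite !ip1; coord; ring.
Qed.

(** This isometry and the next two make the remaining discrete choices: the order of the
    off-diagonal entries of ad e_3, the sign of [b], and the sign of [B]. *)
Lemma solv_swap (a b c d a' b' c' d' p q : R) :
  isomorphically_homothetic (solv a b c d a' b' c' d' p q) 1%:M
    (solv d c b a d' c' b' a' q p) 1%:M.
Proof.
apply: (@homothetic_mx4 _ _ _ _ _ (mx4 (rv4 0 1 0 0) (rv4 1 0 0 0)
  (rv4 0 0 1 0) (rv4 0 0 0 1)) 1) => //.
- exact: inner_product1.
- by move=> x y; coord; congr rv4; ring.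
- by move=> x y; rewrite !ip1; coord; ring.
Qed.

Lemma solv_flip4 (a b c d a' b' c' d' p q : R) :
  isomorphically_homothetic (solv a b c d a' b' c' d' p q) 1%:M
    (solv a b c d (- a') (- b') (- c') (- d') (- p) (- q)) 1%:M.
Proof.
apply: (@homothetic_mx4 _ _ _ _ _ (mx4 (rv4 1 0 0 0) (rv4 0 1 0 0)
  (rv4 0 0 1 0) (rv4 0 0 0 (- 1))) 1) => //.
- exact: inner_product1.
- by move=> x y; coord; congr rv4; ring.
- by move=> x y; rewrite !ip1; coord; ring.
Qed.

Lemma solv_flip13 (a b c d a' b' c' d' p q : R) :
  isomorphically_homothetic (solv a b c d a' b' c' d' p q) 1%:M
    (solv (- a) b c (- d) a' (- b') (- c') d' p (- q)) 1%:M.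
Proof.
apply: (@homothetic_mx4 _ _ _ _ _ (mx4 (rv4 (- 1) 0 0 0) (rv4 0 1 0 0)
  (rv4 0 0 (- 1) 0) (rv4 0 0 0 1)) 1) => //.
- exact: inner_product1.
- by move=> x y; coord; congr rv4; ring.
- by move=> x y; rewrite !ip1; coord; ring.
Qed.

End NormalForm.

(** * Derivations of e(1,1) and e(2), and orthonormal bases of their extensions *)

Section Extensions.
Variable R : realType.

Lemma sum_ord3 (V : zmodType) (F : 'I_3 -> V) :
  \sum_i F i = F i1 + F i2 + F i3.
Proof.
rewrite !big_ord_recl big_ord0 addr0 !addrA.
by congr (F _ + F _ + F _); exact: val_inj.
Qed.

Lemma eq_rv3 (x y : 'rV[R]_3) :
  [/\ x 0 i1 = y 0 i1, x 0 i2 = y 0 i2 & x 0 i3 = y 0 i3] -> x = y.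
Proof.
move=> [h1 h2 h3]; apply/rowP => -[[|[|[|//]]] Hi].
- by rewrite (_ : Ordinal Hi = i1) //; exact: val_inj.
- by rewrite (_ : Ordinal Hi = i2) //; exact: val_inj.
- by rewrite (_ : Ordinal Hi = i3) //; exact: val_inj.
Qed.

Lemma e_bracketE (l1 l2 : R) x y : e_bracket l1 l2 x y =
  (l1 * (x 0 i2 * y 0 i3 - x 0 i3 * y 0 i2)) *: e_ R i1 +
  (l2 * (x 0 i3 * y 0 i1 - x 0 i1 * y 0 i3)) *: e_ R i2.
Proof.
rewrite /e_bracket /lie_table !big_cons big_nil addr0 /= !scalerA.
by congr (_ *: _ + _ *: _); ring.
Qed.

(** On the ideal spanned by v_1 and v_2 the commutator of D with ad v_3 is a multiple d_33 of ad
    v_3. As ad v_3 is invertible there, multiplying by its inverse and taking traces gives d_33 = 0.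
    So D commutes with the non-scalar matrix ad v_3 and equals d + k ad v_3 on the ideal. *)
Lemma derivation_e_bracket (l1 l2 : R) (D : {linear 'rV[R]_3 -> 'rV[R]_3}) :
  l1 * l2 != 0 -> is_derivation (e_bracket l1 l2) D ->
  exists d k r s : R, forall x, D x =
    (d * x 0 i1 - k * l1 * x 0 i2 + r * x 0 i3) *: e_ R i1 +
    (k * l2 * x 0 i1 + d * x 0 i2 + s * x 0 i3) *: e_ R i2.
Proof.
rewrite mulf_eq0 negb_or => /andP[n1 n2] Dder.
pose d i j := D (e_ R i) 0 j.
have DE x j : D x 0 j = x 0 i1 * d i1 j + x 0 i2 * d i2 j + x 0 i3 * d i3 j.
  by rewrite {1}(row_sum_delta x) linear_sum summxE sum_ord3 !linearZ !mxE.
have h i j k : D (e_bracket l1 l2 (e_ R i) (e_ R j)) 0 k =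
  (e_bracket l1 l2 (D (e_ R i)) (e_ R j)
   + e_bracket l1 l2 (e_ R i) (D (e_ R j))) 0 k by rewrite Dder.
have e12 := h i1 i2 i1; have e12' := h i1 i2 i2.
have e23 := h i2 i3 i1; have e23' := h i2 i3 i2; have e23'' := h i2 i3 i3.
have e31 := h i3 i1 i1; have e31' := h i3 i1 i2; have e31'' := h i3 i1 i3.
move: e12 e12' e23 e23' e23'' e31 e31' e31'' => {h}.
rewrite !DE !e_bracketE !mxE /= -!/(d _ _) => e12 e12' e23 e23' e23'' e31 e31' e31''.
have d13 : d i1 i3 = 0 by apply: (mulfI n1); lra.
have d23 : d i2 i3 = 0 by apply: (mulfI n2); lra.
have d33 : d i3 i3 = 0.
  have : l1 * (d i1 i1 - d i2 i2 - d i3 i3) = 0 by lra.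
  have : l2 * (d i2 i2 - d i1 i1 - d i3 i3) = 0 by lra.
  move=> /eqP; rewrite mulf_eq0 (negbTE n2) /= => /eqP h2.
  move=> /eqP; rewrite mulf_eq0 (negbTE n1) /= => /eqP h1.
  lra.
have d22 : d i2 i2 = d i1 i1.
  have : l1 * (d i1 i1 - d i2 i2 - d i3 i3) = 0 by lra.
  by move=> /eqP; rewrite mulf_eq0 (negbTE n1) /= => /eqP h1; lra.
exists (d i1 i1), (d i1 i2 / l2), (d i3 i1), (d i3 i2) => x.
have d21 : d i2 i1 = - (d i1 i2 / l2 * l1).
  by apply: (mulfI n2); rewrite mulrN mulrA [l2 * (_ / _)]mulrC divfK //; lra.
have d12 : d i1 i2 = d i1 i2 / l2 * l2 by rewrite divfK.
apply/eq_rv3; split; rewrite DE !mxE /= ?d13 ?d23 ?d33 ?d21; first by ring.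
  by rewrite -d12 d22; ring.
by ring.
Qed.

Lemma ord4_shift : (lshift 1 (i1 : 'I_3) = i1 :> 'I_4) *
  (lshift 1 (i2 : 'I_3) = i2 :> 'I_4) * (lshift 1 (i3 : 'I_3) = i3 :> 'I_4) *
  (rshift 3 (0 : 'I_1) = i4 :> 'I_4).
Proof. by do !split; exact: val_inj. Qed.

Lemma semidirect_solv (l1 l2 d k r s : R) (D : 'rV[R]_3 -> 'rV[R]_3) :
  (forall x, D x =
    (d * x 0 i1 - k * l1 * x 0 i2 + r * x 0 i3) *: e_ R i1 +
    (k * l2 * x 0 i1 + d * x 0 i2 + s * x 0 i3) *: e_ R i2) ->
  forall x y, semidirect (e_bracket l1 l2) D x y =
  solv 0 (- l2) l1 0 (- d) (- (k * l2)) (k * l1) (- d) (- r) (- s) x y.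
Proof.
move=> DE x y; rewrite [LHS](@rv4_eta R (semidirect _ _ x y)).
have e1 : semidirect (e_bracket l1 l2) D x y 0 i1 = solv 0 (- l2) l1 0 (- d)
    (- (k * l2)) (k * l1) (- d) (- r) (- s) x y 0 i1.
  rewrite /semidirect -{1}(ord4_shift.1.1.1) row_mxEl !DE !e_bracketE.
  by coord; rewrite !mxE !ord4_shift /=; ring.
have e2 : semidirect (e_bracket l1 l2) D x y 0 i2 = solv 0 (- l2) l1 0 (- d)
    (- (k * l2)) (k * l1) (- d) (- r) (- s) x y 0 i2.
  rewrite /semidirect -{1}(ord4_shift.1.1.2) row_mxEl !DE !e_bracketE.
  by coord; rewrite !mxE !ord4_shift /=; ring.
have e3 : semidirect (e_bracket l1 l2) D x y 0 i3 = 0.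
  rewrite /semidirect -{1}(ord4_shift.1.2) row_mxEl !DE !e_bracketE.
  by rewrite !mxE /=; ring.
have e4 : semidirect (e_bracket l1 l2) D x y 0 i4 = 0.
  by rewrite /semidirect -{1}(ord4_shift.2) row_mxEr mxE.
by rewrite e1 e2 e3 e4; coord.
Qed.

End Extensions.

Section Extensions.
Variable R : realType.

Lemma solv_orthonormal (l1 l2 d k r s : R) (G : 'M[R]_4) :
  is_inner_product G ->
  exists x y z beta gamma p q kappa, [/\ 0 < kappa,
    - (x ^+ 2 + y * z) = kappa * (l1 * l2) &
    isomorphically_homothetic
      (solv 0 (- l2) l1 0 (- d) (- (k * l2)) (k * l1) (- d) (- r) (- s)) G
      (solv2 x y z beta gamma p q) 1%:M].
Proof.
move=> Gip; have [P Ptr PG] := trig_orthonormal_basis Gip.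
have Pu : P \in unitmx by have [] := mulmx1_unit (etrans (mulmxA _ _ _) PG).
have PE : P = mx4 (rv4 (P i1 i1) 0 0 0) (rv4 (P i2 i1) (P i2 i2) 0 0)
    (rv4 (P i3 i1) (P i3 i2) (P i3 i3) 0)
    (rv4 (P i4 i1) (P i4 i2) (P i4 i3) (P i4 i4)).
  have tr (i j : 'I_4) : (i < j)%N -> P i j = 0 by move: i j; apply/is_trig_mxP.
  rewrite {1}(mx4_eta P); congr mx4; rewrite [LHS]rv4_eta !mxE //.
  - by rewrite (tr i1 i2) // (tr i1 i3) // (tr i1 i4).
  - by rewrite (tr i2 i3) // (tr i2 i4).
  - by rewrite (tr i3 i4).
have : \det P != 0 by rewrite -unitfE -unitmxE.
have -> : \det P = P i1 i1 * P i2 i2 * P i3 i3 * P i4 i4.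
  rewrite det_trig // !big_ord_recl big_ord0 mulr1 !mulrA.
  by congr (P _ _ * P _ _ * P _ _ * P _ _); exact: val_inj.
rewrite !mulf_eq0 !negb_or => /andP[/andP[/andP[n1 n2] n3] n4].
have Pip x y : ip G (x *m P) (y *m P) = 1 * ip 1%:M x y.
  by rewrite mul1r /ip trmx_mul mulmxA -(mulmxA x) -(mulmxA x) PG.
move: PE Pip n1 n2 n3 n4.
move: (P i1 i1) (P i2 i1) (P i2 i2) (P i3 i1) (P i3 i2) (P i3 i3)
  (P i4 i1) (P i4 i2) (P i4 i3) (P i4 i4).
move=> a11 a21 a22 a31 a32 a33 a41 a42 a43 a44 -> Pip n1 n2 n3 n4.
(* [al] and [be] are the components of the bracket of the last two rows of [P] in the old basis;
   dividing by the triangular block expresses them in the new one. *)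
pose al := l1 * (a32 * a43 - a33 * a42) - d * (a31 * a44) + k * l1 * (a32 * a44)
  - r * (a33 * a44).
pose be := - l2 * (a31 * a43 - a33 * a41) - k * l2 * (a31 * a44)
  - d * (a32 * a44) - s * (a33 * a44).
exists (a33 * a21 * l2 / a22), (- (a11 * a33 * l2) / a22).
exists (a33 * (a22 ^+ 2 * l1 + a21 ^+ 2 * l2) / (a11 * a22)).
(* On the plane the new e_4 acts by a44 d + (a43 + a44 k) ad v_3 and the new e_3 by a33 ad v_3. The
   sign of the homothety changes because [solv] records [e_i, e_4]. *)
exists (- (a44 * d)), ((a43 + a44 * k) / a33).
exists ((al - be * a21 / a22) / a11), (be / a22), (a33 ^+ 2); split.
- by rewrite lt_def sqrf_eq0 n3 sqr_ge0.
- by field; rewrite n1 n2.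
apply: homothetic_sym; apply: (homothetic_mx4 _ ltr01 _ Pip).
  exact: inner_product1.
move=> x y; rewrite /solv2 /al /be; coord; congr rv4.
- by field; rewrite n1 n2 n3.
- by field; rewrite n1 n2 n3.
- by ring.
- by ring.
Qed.

End Extensions.

Section NormalForms.
Variable R : realType.

(* The normal form. In an orthonormal basis, [ad e_4] is the homothety [- b] of
   span(e_1, e_2), and [ad e_3] has there the dilation [- B], the rotation part w
   and the symmetric part s; the paper's lambda_1, lambda_2 are [w - s] and
   [w + s]. The value of [e_3, e_4] is doubled to avoid fractions in the
   connection. *)
Definition nbr (w s B b P Q : R) : bracket R 4 :=
  solv B (- (w + s)) (w - s) B b 0 0 b (2%:R * P) (2%:R * Q).

(** The off-diagonal entry of larger absolute value is scaled to 1. The other one, [w + s], then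
    carries in its sign the distinction between e(2) and e(1,1). *)
Definition normal_params (w s B b : R) : Prop :=
  [/\ w - s = 1, -1 <= w + s <= 1, 0 <= b, 0 <= B & b = 0 -> B = 0].

Lemma lie_iso_homothetic (br br' : bracket R 4) (G : 'M[R]_4) :
  is_inner_product G -> lie_isomorphic br br' ->
  exists2 G' : 'M[R]_4, is_inner_product G' & isomorphically_homothetic br G br' G'.
Proof.
move=> [Gsym Gpos] [f [fbij fbr]]; have Pu := lin1_mx_bij fbij.
pose Q := invmx (lin1_mx f).
exists (Q *m G *m Q^T).
  split=> [|x x0]; first by rewrite !trmx_mul trmxK Gsym mulmxA.
  have -> : x *m (Q *m G *m Q^T) *m x^T = (x *m Q) *m G *m (x *m Q)^T.
    by rewrite trmx_mul !mulmxA.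
  apply: Gpos; apply: contra x0 => /eqP xQ.
  by rewrite -(mulmxKV Pu x) -/Q xQ mul0mx.
apply: (homothetic_mx Pu ltr01) => x y; first by rewrite !mul_rV_lin1.
rewrite mul1r /ip !trmx_mul !mulmxA -(mulmxA _ _ Q) -(mulmxA _ Q^T).
by rewrite mulmxV // mulmx1 -trmx_mul mulmxV // trmx1 mulmx1.
Qed.

Lemma scaled_normal_form (y B b p q : R) : -1 <= y <= 1 -> (b = 0 -> B = 0) ->
  exists w s B' b' P Q, [/\ normal_params w s B' b', w + s = - y &
    isomorphically_homothetic (solv B y 1 B b 0 0 b p q) 1%:M
      (nbr w s B' b' P Q) 1%:M].
Proof.
move=> y1 bB.
wlog b0 : b p q bB / 0 <= b.
  move=> hw; have [b0|/ltW b0] := leP 0 b; first exact: hw.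
  have [||w [s [B' [b' [P [Q [np ws h]]]]]]] := hw (- b) (- p) (- q).
  - by move=> /eqP; rewrite oppr_eq0 => /eqP.
  - by rewrite oppr_ge0.
  exists w, s, B', b', P, Q; split=> //; apply: homothetic_trans h.
  by have := solv_flip4 B y 1 B b 0 0 b p q; rewrite !oppr0.
wlog B0 : B q bB / 0 <= B.
  move=> hw; have [B0|/ltW B0] := leP 0 B; first exact: hw.
  have [||w [s [B' [b' [P [Q [np ws h]]]]]]] := hw (- B) (- q).
  - by move=> /bB ->; rewrite oppr0.
  - by rewrite oppr_ge0.
  exists w, s, B', b', P, Q; split=> //; apply: homothetic_trans h.
  by have := solv_flip13 B y 1 B b 0 0 b p q; rewrite !oppr0.
exists ((1 - y) / 2%:R), ((- y - 1) / 2%:R), B, b, (p / 2%:R), (q / 2%:R).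
have e1 : (1 - y) / 2%:R + (- y - 1) / 2%:R = - y by field.
have e2 : (1 - y) / 2%:R - (- y - 1) / 2%:R = 1 by field.
split=> //; first by split=> //; rewrite e1 lerNl opprK lerNl andbC.
apply: homothetic_eq => u v.
rewrite /nbr e1 e2 opprK.
by congr solv; field.
Qed.

Lemma normal_form (br : bracket R 4) (G : 'M[R]_4) (l1 l2 : R)
    (D : {linear 'rV[R]_3 -> 'rV[R]_3}) :
  is_inner_product G -> l1 * l2 != 0 -> is_derivation (e_bracket l1 l2) D ->
  lie_isomorphic br (semidirect (e_bracket l1 l2) D) ->
  exists w s B b P Q, [/\ normal_params w s B b, 0 < (w + s) * (l1 * l2) &
    isomorphically_homothetic br G (nbr w s B b P Q) 1%:M].
Proof.
move=> Gip l0 Dder iso.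
have [d [k [r [s0 DE]]]] := derivation_e_bracket l0 Dder.
have [G' Gip' h1] := lie_iso_homothetic Gip iso.
have h2 := homothetic_trans h1 (homothetic_eq G' (semidirect_solv DE)).
have [x [y [z [be [ga [p [q [ka [ka0 dt h3]]]]]]]]] :=
  solv_orthonormal l1 l2 d k r s0 Gip'.
have [y' [z' [p' [q' [dt' h4]]]]] := solv_rotate_plane x y z be ga p q.
have h5 := homothetic_trans (homothetic_trans h2 h3)
  (homothetic_trans h4 (solv_rotate_normal y' z' be ga p' q')).
move: h5; set u := Num.sqrt _.
have u0 : 0 < u by rewrite sqrtr_gt0 ltr_pwDl ?sqr_ge0.
(* The sign of the determinant of ad e_3 on the plane is followed through all changes of basis; it
   decides which of the two groups occurs. *)
have : 0 < - ((u * y') * (u * z')) * (l1 * l2).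
  have -> : - ((u * y') * (u * z')) * (l1 * l2) = u ^+ 2 * ka * (l1 * l2) ^+ 2.
    rewrite -[RHS]mulrA [ka * _]mulrA -dt -dt'; ring.
  apply: mulr_gt0; last by rewrite exprn_even_gt0.
  by apply: mulr_gt0 => //; exact: exprn_gt0.
have : be / u = 0 -> ga * be / u = 0 by move=> e; rewrite -mulrA e mulr0.
move: (u * y') (u * z') (be / u) (ga * be / u).
clear h1 h2 h3 h4 dt dt' ka0 u0 u y z x be ga ka p q y' z' G' Gip' DE d k r s0.
move: p' q' => p q y z b B bB sgn h5.
wlog yz : y z p q sgn h5 / `|y| <= `|z|.
  move=> hw; have [yz|/ltW yz] := leP `|y| `|z|; first exact: (hw y z p q).
  apply: (hw z y q p) => //; first by rewrite [z * y]mulrC.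
  exact: (homothetic_trans h5 (solv_swap _ _ _ _ _ _ _ _ _ _)).
have z0 : z != 0 by apply: contraTneq sgn => ->; rewrite mulr0 oppr0 mul0r ltxx.
have [||w [s [B' [b' [P [Q [np ws h6]]]]]]] :=
  @scaled_normal_form (y / z) (B / z) (b / z) (p / z) (q / z).
- by rewrite -ler_norml normrM normfV ler_pdivrMr ?normr_gt0 // mul1r.
- by move=> /eqP; rewrite mulf_eq0 invr_eq0 (negbTE z0) orbF => /eqP/bB ->;
    rewrite mul0r.
exists w, s, B', b', P, Q; split=> //.
  rewrite ws; have -> : - (y / z) * (l1 * l2) = - (y * z) * (l1 * l2) * (z ^-1) ^+ 2.
    by field.
  by apply: mulr_gt0 => //; rewrite exprn_even_gt0 //= invr_eq0.
apply: homothetic_trans h5 _; apply: homothetic_trans h6.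
by have := solv_scale B y z B b 0 0 b p q z0; rewrite divff // !mul0r.
Qed.

End NormalForms.

(** * Curvature of the normal form *)

Section NormalGeometry.
Variables (R : realType) (w s B b P Q : R).
Implicit Types (x y z v : 'rV[R]_4).

Local Notation br := (nbr w s B b P Q).

Lemma nbr_lie : is_lie_bracket br.
Proof.
split=> [z a x y|z a x y|x|x y z]; rewrite /nbr /solv.
- by rewrite rv4Z rv4D !mxE; congr rv4; ring.
- by rewrite rv4Z rv4D !mxE; congr rv4; ring.
- rewrite [RHS](_ : 0 = rv4 0 0 0 0); last by rewrite [LHS]rv4_eta !mxE.
  by congr rv4; ring.
- rewrite [RHS](_ : 0 = rv4 0 0 0 0); last by rewrite [LHS]rv4_eta !mxE.
  by rewrite !rv4_1 !rv4_2 !rv4_3 !rv4_4 !rv4D; congr rv4; ring.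
Qed.

Definition nnabla x y : 'rV[R]_4 :=
  rv4 (x 0 i1 * (B * y 0 i3 + b * y 0 i4) - s * x 0 i2 * y 0 i3
        - w * x 0 i3 * y 0 i2 + P * (x 0 i3 * y 0 i4 - x 0 i4 * y 0 i3))
      (x 0 i2 * (B * y 0 i3 + b * y 0 i4) - s * x 0 i1 * y 0 i3
        + w * x 0 i3 * y 0 i1 + Q * (x 0 i3 * y 0 i4 - x 0 i4 * y 0 i3))
      (- B * (x 0 i1 * y 0 i1 + x 0 i2 * y 0 i2)
        + s * (x 0 i1 * y 0 i2 + x 0 i2 * y 0 i1)
        + P * (x 0 i1 * y 0 i4 + x 0 i4 * y 0 i1)
        + Q * (x 0 i2 * y 0 i4 + x 0 i4 * y 0 i2))
      (- b * (x 0 i1 * y 0 i1 + x 0 i2 * y 0 i2)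
        - P * (x 0 i1 * y 0 i3 + x 0 i3 * y 0 i1)
        - Q * (x 0 i2 * y 0 i3 + x 0 i3 * y 0 i2)).

Lemma nabla_nbr x y : nabla br 1%:M x y = nnabla x y.
Proof.
rewrite /nabla /sharp invmx1 mulmx1 [LHS]rv4_eta !mxE /koszul !ip1 !rv4_delta.
move: x y; elim/rv4P => x1 x2 x3 x4; elim/rv4P => y1 y2 y3 y4.
rewrite /nbr /nnabla; coord.
by congr rv4; field.
Qed.

Lemma nnablaE (x1 x2 x3 x4 y1 y2 y3 y4 : R) :
  nnabla (rv4 x1 x2 x3 x4) (rv4 y1 y2 y3 y4) =
  rv4 (x1 * (B * y3 + b * y4) - s * x2 * y3 - w * x3 * y2 + P * (x3 * y4 - x4 * y3))
      (x2 * (B * y3 + b * y4) - s * x1 * y3 + w * x3 * y1 + Q * (x3 * y4 - x4 * y3))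
      (- B * (x1 * y1 + x2 * y2) + s * (x1 * y2 + x2 * y1)
        + P * (x1 * y4 + x4 * y1) + Q * (x2 * y4 + x4 * y2))
      (- b * (x1 * y1 + x2 * y2) - P * (x1 * y3 + x3 * y1) - Q * (x2 * y3 + x3 * y2)).
Proof. by rewrite /nnabla !rv4_1 !rv4_2 !rv4_3 !rv4_4. Qed.

Lemma nnabla_delta (y1 y2 y3 y4 : R) (y := rv4 y1 y2 y3 y4) :
  (nnabla (e_ R i1) y = rv4 (B * y3 + b * y4) (- s * y3)
    (s * y2 - B * y1 + P * y4) (- b * y1 - P * y3)) *
  (nnabla (e_ R i2) y = rv4 (- s * y3) (B * y3 + b * y4)
    (s * y1 - B * y2 + Q * y4) (- b * y2 - Q * y3)) *
  (nnabla (e_ R i3) y = rv4 (P * y4 - w * y2) (Q * y4 + w * y1) 0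
    (- P * y1 - Q * y2)) *
  (nnabla (e_ R i4) y = rv4 (- P * y3) (- Q * y3) (P * y1 + Q * y2) 0).
Proof.
by rewrite /y !rv4_delta !nnablaE; split; [split; [split|]|]; congr rv4; ring.
Qed.

Lemma nbrE (x1 x2 x3 x4 y1 y2 y3 y4 : R) :
  br (rv4 x1 x2 x3 x4) (rv4 y1 y2 y3 y4) =
  rv4 (B * (x1 * y3 - x3 * y1) + (w - s) * (x2 * y3 - x3 * y2)
        + b * (x1 * y4 - x4 * y1) + 2%:R * P * (x3 * y4 - x4 * y3))
      (- (w + s) * (x1 * y3 - x3 * y1) + B * (x2 * y3 - x3 * y2)
        + b * (x2 * y4 - x4 * y2) + 2%:R * Q * (x3 * y4 - x4 * y3)) 0 0.
Proof.
by rewrite /nbr /solv !rv4_1 !rv4_2 !rv4_3 !rv4_4; congr rv4; ring.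
Qed.

Lemma nbr_delta (y1 y2 y3 y4 : R) (y := rv4 y1 y2 y3 y4) :
  (br (e_ R i1) y = rv4 (B * y3 + b * y4) (- (w + s) * y3) 0 0) *
  (br (e_ R i2) y = rv4 ((w - s) * y3) (B * y3 + b * y4) 0 0) *
  (br (e_ R i3) y = rv4 (2%:R * P * y4 - B * y1 - (w - s) * y2)
     (2%:R * Q * y4 + (w + s) * y1 - B * y2) 0 0) *
  (br (e_ R i4) y = rv4 (- b * y1 - 2%:R * P * y3) (- b * y2 - 2%:R * Q * y3) 0 0).
Proof.
by rewrite /y !rv4_delta !nbrE; split; [split; [split|]|]; congr rv4; ring.
Qed.

Lemma curv_nbr x y z : curv br 1%:M x y z =
  nnabla x (nnabla y z) - nnabla y (nnabla x z) - nnabla (br x y) z.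
Proof. by rewrite /curv !nabla_nbr. Qed.

Definition nricci x y : R :=
  (- 2%:R * (w * s + B ^+ 2 + b ^+ 2 - P ^+ 2)) * (x 0 i1 * y 0 i1)
  + (2%:R * (w * s - B ^+ 2 - b ^+ 2 + Q ^+ 2)) * (x 0 i2 * y 0 i2)
  - (2%:R * (s ^+ 2 + B ^+ 2 + P ^+ 2 + Q ^+ 2)) * (x 0 i3 * y 0 i3)
  - (2%:R * (b ^+ 2 + P ^+ 2 + Q ^+ 2)) * (x 0 i4 * y 0 i4)
  + (2%:R * (s * B + P * Q)) * (x 0 i1 * y 0 i2 + x 0 i2 * y 0 i1)
  - (3%:R * b * P) * (x 0 i1 * y 0 i3 + x 0 i3 * y 0 i1)
  + (3%:R * B * P - (w + s) * Q) * (x 0 i1 * y 0 i4 + x 0 i4 * y 0 i1)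
  - (3%:R * b * Q) * (x 0 i2 * y 0 i3 + x 0 i3 * y 0 i2)
  + (3%:R * B * Q + (w - s) * P) * (x 0 i2 * y 0 i4 + x 0 i4 * y 0 i2)
  - (2%:R * B * b) * (x 0 i3 * y 0 i4 + x 0 i4 * y 0 i3).

Lemma ricci_nbr x y : ricci br 1%:M x y = nricci x y.
Proof.
have lin1E (f : 'rV[R]_4 -> 'rV[R]_4) i : lin1_mx f i i = f (e_ R i) 0 i.
  by rewrite mxE.
rewrite /ricci /mxtrace sum_ord4 !lin1E !curv_nbr.
move: x y; elim/rv4P => x1 x2 x3 x4; elim/rv4P => y1 y2 y3 y4.
rewrite !nbr_delta !nnabla_delta !nnablaE !rv4N !rv4D.
rewrite /nricci !rv4_1 !rv4_2 !rv4_3 !rv4_4.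
by ring.
Qed.

Lemma metric_trace1 (T : 'rV[R]_4 -> 'rV[R]_4 -> R) : metric_trace 1%:M T =
  T (e_ R i1) (e_ R i1) + T (e_ R i2) (e_ R i2) + T (e_ R i3) (e_ R i3)
  + T (e_ R i4) (e_ R i4).
Proof.
have mx1E i j : (1%:M : 'M[R]_4) i j = (i == j)%:R by rewrite mxE.
rewrite /metric_trace invmx1.
by rewrite !sum_ord4 !mx1E /= !mul1r !mul0r !addr0 !add0r.
Qed.

Lemma nricciE (x1 x2 x3 x4 y1 y2 y3 y4 : R) :
  nricci (rv4 x1 x2 x3 x4) (rv4 y1 y2 y3 y4) =
  (- 2%:R * (w * s + B ^+ 2 + b ^+ 2 - P ^+ 2)) * (x1 * y1)
  + (2%:R * (w * s - B ^+ 2 - b ^+ 2 + Q ^+ 2)) * (x2 * y2)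
  - (2%:R * (s ^+ 2 + B ^+ 2 + P ^+ 2 + Q ^+ 2)) * (x3 * y3)
  - (2%:R * (b ^+ 2 + P ^+ 2 + Q ^+ 2)) * (x4 * y4)
  + (2%:R * (s * B + P * Q)) * (x1 * y2 + x2 * y1)
  - (3%:R * b * P) * (x1 * y3 + x3 * y1)
  + (3%:R * B * P - (w + s) * Q) * (x1 * y4 + x4 * y1)
  - (3%:R * b * Q) * (x2 * y3 + x3 * y2)
  + (3%:R * B * Q + (w - s) * P) * (x2 * y4 + x4 * y2)
  - (2%:R * B * b) * (x3 * y4 + x4 * y3).
Proof. by rewrite /nricci !rv4_1 !rv4_2 !rv4_3 !rv4_4. Qed.

Lemma scal_nbr :
  scal br 1%:M = - 2%:R * (s ^+ 2 + 3%:R * (B ^+ 2 + b ^+ 2) + P ^+ 2 + Q ^+ 2).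
Proof.
by rewrite /scal metric_trace1 !ricci_nbr !rv4_delta !nricciE; ring.
Qed.

End NormalGeometry.

(* Here T stands for t * tau, in which the Euler-Lagrange equation is linear. *)
Section CriticalTensor.
Variable R : realType.

Definition E11 (w s B b P Q T : R) : R :=
  4%:R * T * w * s - T * s ^+ 2 + T * B ^+ 2 + T * b ^+ 2 - 5%:R * T * P ^+ 2
    - T * Q ^+ 2 - 8%:R * w ^+ 3 * s + 4%:R * w ^+ 2 * s ^+ 2
    + 9%:R * w ^+ 2 * P ^+ 2 - 5%:R * w ^+ 2 * Q ^+ 2 - 16%:R * w * s ^+ 3
    - 30%:R * w * s * P ^+ 2 - 6%:R * w * s * Q ^+ 2 + 28%:R * w * B * P * Q
    + 2%:R * s ^+ 4 + 21%:R * s ^+ 2 * P ^+ 2 - s ^+ 2 * Q ^+ 2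
    - 2%:R * B ^+ 4 - 4%:R * B ^+ 2 * b ^+ 2 - 5%:R * B ^+ 2 * P ^+ 2
    + B ^+ 2 * Q ^+ 2 - 2%:R * b ^+ 4 - 5%:R * b ^+ 2 * P ^+ 2
    + b ^+ 2 * Q ^+ 2 + 30%:R * P ^+ 4 + 36%:R * P ^+ 2 * Q ^+ 2
    + 6%:R * Q ^+ 4.

Definition E12 (w s B b P Q T : R) : R :=
  - (4%:R * T * s * B) - 4%:R * T * P * Q + 16%:R * w ^+ 2 * s * B
    + 14%:R * w ^+ 2 * P * Q - 14%:R * w * B * P ^+ 2 + 14%:R * w * B * Q ^+ 2
    + 8%:R * s ^+ 3 * B + 10%:R * s ^+ 2 * P * Q + 8%:R * s * B ^+ 3
    + 8%:R * s * B * b ^+ 2 + 10%:R * s * B * P ^+ 2 + 10%:R * s * B * Q ^+ 2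
    - 6%:R * B ^+ 2 * P * Q - 6%:R * b ^+ 2 * P * Q + 24%:R * P ^+ 3 * Q
    + 24%:R * P * Q ^+ 3.

Definition E13 (w s B b P Q T : R) : R :=
  6%:R * T * b * P - 3%:R * w ^+ 2 * b * P + 18%:R * w * s * b * P
    - 6%:R * w * B * b * Q - 15%:R * s ^+ 2 * b * P - 9%:R * B ^+ 2 * b * P
    - 9%:R * b ^+ 3 * P - 36%:R * b * P ^+ 3 - 36%:R * b * P * Q ^+ 2.

Definition E14 (w s B b P Q T : R) : R :=
  2%:R * T * w * Q + 2%:R * T * s * Q - 6%:R * T * B * P - w ^+ 3 * Q
    - 7%:R * w ^+ 2 * s * Q + 5%:R * w ^+ 2 * B * P - 11%:R * w * s ^+ 2 * Q
    - 16%:R * w * s * B * P + 3%:R * w * B ^+ 2 * Q - 3%:R * w * b ^+ 2 * Q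
    - 12%:R * w * P ^+ 2 * Q - 12%:R * w * Q ^+ 3 - 5%:R * s ^+ 3 * Q
    + 15%:R * s ^+ 2 * B * P - 3%:R * s * B ^+ 2 * Q - 3%:R * s * b ^+ 2 * Q
    - 12%:R * s * P ^+ 2 * Q - 12%:R * s * Q ^+ 3 + 9%:R * B ^+ 3 * P
    + 9%:R * B * b ^+ 2 * P + 36%:R * B * P ^+ 3 + 36%:R * B * P * Q ^+ 2.

Definition E22 (w s B b P Q T : R) : R :=
  - (4%:R * T * w * s) - T * s ^+ 2 + T * B ^+ 2 + T * b ^+ 2 - T * P ^+ 2
    - 5%:R * T * Q ^+ 2 + 8%:R * w ^+ 3 * s + 4%:R * w ^+ 2 * s ^+ 2
    - 5%:R * w ^+ 2 * P ^+ 2 + 9%:R * w ^+ 2 * Q ^+ 2 + 16%:R * w * s ^+ 3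
    + 6%:R * w * s * P ^+ 2 + 30%:R * w * s * Q ^+ 2 - 28%:R * w * B * P * Q
    + 2%:R * s ^+ 4 - s ^+ 2 * P ^+ 2 + 21%:R * s ^+ 2 * Q ^+ 2
    - 2%:R * B ^+ 4 - 4%:R * B ^+ 2 * b ^+ 2 + B ^+ 2 * P ^+ 2
    - 5%:R * B ^+ 2 * Q ^+ 2 - 2%:R * b ^+ 4 + b ^+ 2 * P ^+ 2
    - 5%:R * b ^+ 2 * Q ^+ 2 + 6%:R * P ^+ 4 + 36%:R * P ^+ 2 * Q ^+ 2
    + 30%:R * Q ^+ 4.

Definition E23 (w s B b P Q T : R) : R :=
  6%:R * T * b * Q - 3%:R * w ^+ 2 * b * Q - 18%:R * w * s * b * Q
    + 6%:R * w * B * b * P - 15%:R * s ^+ 2 * b * Q - 9%:R * B ^+ 2 * b * Q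
    - 9%:R * b ^+ 3 * Q - 36%:R * b * P ^+ 2 * Q - 36%:R * b * Q ^+ 3.

Definition E24 (w s B b P Q T : R) : R :=
  - (2%:R * T * w * P) + 2%:R * T * s * P - 6%:R * T * B * Q + w ^+ 3 * P
    - 7%:R * w ^+ 2 * s * P + 5%:R * w ^+ 2 * B * Q + 11%:R * w * s ^+ 2 * P
    + 16%:R * w * s * B * Q - 3%:R * w * B ^+ 2 * P + 3%:R * w * b ^+ 2 * P
    + 12%:R * w * P ^+ 3 + 12%:R * w * P * Q ^+ 2 - 5%:R * s ^+ 3 * P
    + 15%:R * s ^+ 2 * B * Q - 3%:R * s * B ^+ 2 * P - 3%:R * s * b ^+ 2 * P
    - 12%:R * s * P ^+ 3 - 12%:R * s * P * Q ^+ 2 + 9%:R * B ^+ 3 * Q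
    + 9%:R * B * b ^+ 2 * Q + 36%:R * B * P ^+ 2 * Q + 36%:R * B * Q ^+ 3.

Definition E33 (w s B b P Q T : R) : R :=
  3%:R * T * s ^+ 2 + T * B ^+ 2 - 3%:R * T * b ^+ 2 + 3%:R * T * P ^+ 2
    + 3%:R * T * Q ^+ 2 - 12%:R * w ^+ 2 * s ^+ 2 - 3%:R * w ^+ 2 * P ^+ 2
    - 3%:R * w ^+ 2 * Q ^+ 2 + 18%:R * w * s * P ^+ 2 - 18%:R * w * s * Q ^+ 2
    - 6%:R * s ^+ 4 - 8%:R * s ^+ 2 * B ^+ 2 - 15%:R * s ^+ 2 * P ^+ 2
    - 15%:R * s ^+ 2 * Q ^+ 2 + 12%:R * s * B * P * Q - 2%:R * B ^+ 4
    + 4%:R * B ^+ 2 * b ^+ 2 - 11%:R * B ^+ 2 * P ^+ 2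
    - 11%:R * B ^+ 2 * Q ^+ 2 + 6%:R * b ^+ 4 + 15%:R * b ^+ 2 * P ^+ 2
    + 15%:R * b ^+ 2 * Q ^+ 2 - 18%:R * P ^+ 4 - 36%:R * P ^+ 2 * Q ^+ 2
    - 18%:R * Q ^+ 4.

Definition E34 (w s B b P Q T : R) : R :=
  4%:R * T * B * b - 8%:R * s ^+ 2 * B * b + 12%:R * s * b * P * Q
    - 8%:R * B ^+ 3 * b - 8%:R * B * b ^+ 3 - 26%:R * B * b * P ^+ 2
    - 26%:R * B * b * Q ^+ 2.

Definition E44 (w s B b P Q T : R) : R :=
  - (T * s ^+ 2) - 3%:R * T * B ^+ 2 + T * b ^+ 2 + 3%:R * T * P ^+ 2
    + 3%:R * T * Q ^+ 2 + 4%:R * w ^+ 2 * s ^+ 2 - w ^+ 2 * P ^+ 2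
    - w ^+ 2 * Q ^+ 2 + 6%:R * w * s * P ^+ 2 - 6%:R * w * s * Q ^+ 2
    + 2%:R * s ^+ 4 + 8%:R * s ^+ 2 * B ^+ 2 - 5%:R * s ^+ 2 * P ^+ 2
    - 5%:R * s ^+ 2 * Q ^+ 2 - 12%:R * s * B * P * Q + 6%:R * B ^+ 4
    + 4%:R * B ^+ 2 * b ^+ 2 + 15%:R * B ^+ 2 * P ^+ 2
    + 15%:R * B ^+ 2 * Q ^+ 2 - 2%:R * b ^+ 4 - 11%:R * b ^+ 2 * P ^+ 2
    - 11%:R * b ^+ 2 * Q ^+ 2 - 18%:R * P ^+ 4 - 36%:R * P ^+ 2 * Q ^+ 2
    - 18%:R * Q ^+ 4.

Definition EF (w s B b P Q T : R) (x y : 'rV[R]_4) : R :=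
  E11 w s B b P Q T * (x 0 i1 * y 0 i1) + E22 w s B b P Q T * (x 0 i2 * y 0 i2)
  + E33 w s B b P Q T * (x 0 i3 * y 0 i3) + E44 w s B b P Q T * (x 0 i4 * y 0 i4)
  + E12 w s B b P Q T * (x 0 i1 * y 0 i2 + x 0 i2 * y 0 i1)
  + E13 w s B b P Q T * (x 0 i1 * y 0 i3 + x 0 i3 * y 0 i1)
  + E14 w s B b P Q T * (x 0 i1 * y 0 i4 + x 0 i4 * y 0 i1)
  + E23 w s B b P Q T * (x 0 i2 * y 0 i3 + x 0 i3 * y 0 i2)
  + E24 w s B b P Q T * (x 0 i2 * y 0 i4 + x 0 i4 * y 0 i2)
  + E34 w s B b P Q T * (x 0 i3 * y 0 i4 + x 0 i4 * y 0 i3).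

End CriticalTensor.

Section NormalCritical.
Variables (R : realType) (w s B b P Q : R).
Implicit Types (x y z v : 'rV[R]_4).

Local Notation br := (nbr w s B b P Q).
Local Notation nric := (nricci w s B b P Q).
Local Notation nnab := (nnabla w s B b P Q).

Lemma raise2_1 (T : 'rV[R]_4 -> 'rV[R]_4 -> R) k l :
  raise2 1%:M T k l = T (e_ R k) (e_ R l).
Proof. by rewrite raise2E invmx1 trmx1 mulmx1 mul1mx mxE. Qed.

Lemma curv_ricci_nbr x y : curv_ricci br 1%:M x y =
  ip 1%:M (curv br 1%:M x (e_ R i1) (\row_l nric (e_ R i1) (e_ R l))) y
  + ip 1%:M (curv br 1%:M x (e_ R i2) (\row_l nric (e_ R i2) (e_ R l))) y
  + ip 1%:M (curv br 1%:M x (e_ R i3) (\row_l nric (e_ R i3) (e_ R l))) y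
  + ip 1%:M (curv br 1%:M x (e_ R i4) (\row_l nric (e_ R i4) (e_ R l))) y.
Proof.
have h k : \sum_(l < 4) curv4 br 1%:M x (e_ R k) y (e_ R l)
      * raise2 1%:M (ricci br 1%:M) k l =
    ip 1%:M (curv br 1%:M x (e_ R k) (\row_l nric (e_ R k) (e_ R l))) y.
  have sc : scalar (fun z => ip 1%:M (curv br 1%:M x (e_ R k) z) y).
    move=> a u v; rewrite curv_linear3; last exact: inner_product1.
      exact: (ip_bilinear 1%:M).1.
    exact: nbr_lie.
  rewrite (scalar_sum _ sc); apply: eq_bigr => l _.
  by rewrite raise2_1 ricci_nbr [RHS]mulrC mxE.
by rewrite /curv_ricci sum_ord4 !h.
Qed.

Lemma rough_laplacian_nbr x y : rough_laplacian br 1%:M (ricci br 1%:M) x y =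
  let D v x y := - nric (nnab v x) y
                 - nric x (nnab v y) in
  let D2 u := - D (nnab u u) x y - D u (nnab u x) y
              - D u x (nnab u y) in
  D2 (e_ R i1) + D2 (e_ R i2) + D2 (e_ R i3) + D2 (e_ R i4).
Proof.
by rewrite /rough_laplacian metric_trace1 /nabla2_form /nabla_form /= !nabla_nbr
  !ricci_nbr.
Qed.

Lemma rv4_row (f : 'I_4 -> R) : \row_l f l = rv4 (f i1) (f i2) (f i3) (f i4).
Proof. by rewrite [LHS]rv4_eta !mxE. Qed.

Lemma norm2_nbr : norm2 1%:M (ricci br 1%:M) = 2%:R * (
  2%:R * ((w * s + B ^+ 2 + b ^+ 2 - P ^+ 2) ^+ 2
    + (w * s - B ^+ 2 - b ^+ 2 + Q ^+ 2) ^+ 2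
    + (s ^+ 2 + B ^+ 2 + P ^+ 2 + Q ^+ 2) ^+ 2 + (b ^+ 2 + P ^+ 2 + Q ^+ 2) ^+ 2
    + 2%:R * (s * B + P * Q) ^+ 2 + 2%:R * (B * b) ^+ 2)
  + 9%:R * (b ^+ 2 * (P ^+ 2 + Q ^+ 2))
  + (3%:R * B * P - (w + s) * Q) ^+ 2 + (3%:R * B * Q + (w - s) * P) ^+ 2).
Proof.
have h k l : raise2 1%:M (ricci br 1%:M) k l * ricci br 1%:M (e_ R k) (e_ R l) =
    nric (e_ R k) (e_ R l) ^+ 2.
  by rewrite raise2_1 ricci_nbr.
rewrite /norm2; under eq_bigr do under eq_bigr do rewrite h.
rewrite !sum_ord4 !rv4_delta !nricciE.
rewrite !(mulr0, mulr1, mul0r, addr0, add0r, subr0, sub0r, oppr0).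
by ring.
Qed.

Lemma energy_nbr t : energy br 1%:M t =
  norm2 1%:M (ricci br 1%:M) + t * scal br 1%:M * scal br 1%:M.
Proof. by rewrite /energy expr2 mulrA. Qed.

Lemma ip1E (x1 x2 x3 x4 y1 y2 y3 y4 : R) :
  ip 1%:M (rv4 x1 x2 x3 x4) (rv4 y1 y2 y3 y4) =
  x1 * y1 + x2 * y2 + x3 * y3 + x4 * y4.
Proof. by rewrite ip1 !rv4_1 !rv4_2 !rv4_3 !rv4_4. Qed.

Lemma nbr_deltar (y1 y2 y3 y4 : R) (y := rv4 y1 y2 y3 y4) :
  (br y (e_ R i1) = rv4 (- B * y3 - b * y4) ((w + s) * y3) 0 0) *
  (br y (e_ R i2) = rv4 (- (w - s) * y3) (- B * y3 - b * y4) 0 0) *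
  (br y (e_ R i3) = rv4 (B * y1 + (w - s) * y2 - 2%:R * P * y4)
     (B * y2 - (w + s) * y1 - 2%:R * Q * y4) 0 0) *
  (br y (e_ R i4) = rv4 (b * y1 + 2%:R * P * y3) (b * y2 + 2%:R * Q * y3) 0 0).
Proof.
by rewrite /y !rv4_delta !nbrE; split; [split; [split|]|]; congr rv4; ring.
Qed.

Lemma nricci_row :
  (\row_l nric (e_ R i1) (e_ R l) =
    rv4 (- 2%:R * (w * s + B ^+ 2 + b ^+ 2 - P ^+ 2)) (2%:R * (s * B + P * Q))
      (- (3%:R * b * P)) (3%:R * B * P - (w + s) * Q)) *
  (\row_l nric (e_ R i2) (e_ R l) =
    rv4 (2%:R * (s * B + P * Q)) (2%:R * (w * s - B ^+ 2 - b ^+ 2 + Q ^+ 2))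
      (- (3%:R * b * Q)) (3%:R * B * Q + (w - s) * P)) *
  (\row_l nric (e_ R i3) (e_ R l) =
    rv4 (- (3%:R * b * P)) (- (3%:R * b * Q))
      (- (2%:R * (s ^+ 2 + B ^+ 2 + P ^+ 2 + Q ^+ 2))) (- (2%:R * B * b))) *
  (\row_l nric (e_ R i4) (e_ R l) =
    rv4 (3%:R * B * P - (w + s) * Q) (3%:R * B * Q + (w - s) * P)
      (- (2%:R * B * b)) (- (2%:R * (b ^+ 2 + P ^+ 2 + Q ^+ 2)))).
Proof.
by rewrite !rv4_row !rv4_delta !nricciE; split; [split; [split|]|];
  congr rv4; ring.
Qed.

Lemma F_critical_expr_nbr t x y :
  - rough_laplacian br 1%:M (ricci br 1%:M) x y
  + 2%:R^-1 * energy br 1%:M t * ip 1%:M x y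
  - 2%:R * curv_ricci br 1%:M x y
  - 2%:R * t * scal br 1%:M * ricci br 1%:M x y =
  EF w s B b P Q (t * scal br 1%:M) x y.
Proof.
(* Also in the energy [t] occurs only through t tau, as (t tau) tau; hence the product may be
   replaced by an independent variable. *)
rewrite -(mulrA 2%:R t) energy_nbr norm2_nbr; move: (t * scal br 1%:M) => T.
have half (a c : R) : 2%:R^-1 * (2%:R * a + T * (- 2%:R * c)) = a - T * c by field.
rewrite scal_nbr half ricci_nbr.
move: x y; elim/rv4P => x1 x2 x3 x4; elim/rv4P => y1 y2 y3 y4.
rewrite curv_ricci_nbr !curv_nbr !nricci_row !nbr_deltar !nnabla_delta !nnablaE.
rewrite rough_laplacian_nbr /= !nnabla_delta !rv4_delta !nnablaE !nricciE.
rewrite !rv4N !rv4D !ip1E.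
rewrite /EF /E11 /E12 /E13 /E14 /E22 /E23 /E24 /E33 /E34 /E44.
rewrite !rv4_1 !rv4_2 !rv4_3 !rv4_4.
by ring.
Qed.

End NormalCritical.

(** * Solution of the critical equations *)

Section CriticalParameters.
Variables (R : realType) (w s B b P Q T : R).

Definition critical_eqs : Prop :=
  [/\ [/\ E11 w s B b P Q T = 0, E22 w s B b P Q T = 0, E33 w s B b P Q T = 0
        & E44 w s B b P Q T = 0],
      [/\ E12 w s B b P Q T = 0, E13 w s B b P Q T = 0 & E14 w s B b P Q T = 0]
    & [/\ E23 w s B b P Q T = 0, E24 w s B b P Q T = 0 & E34 w s B b P Q T = 0]].

Hypothesis crit : critical_eqs.

Let e11 : E11 w s B b P Q T = 0. Proof. by case: crit => [[]]. Qed.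
Let e22 : E22 w s B b P Q T = 0. Proof. by case: crit => [[]]. Qed.
Let e12 : E12 w s B b P Q T = 0. Proof. by case: crit => _ []. Qed.
Let e13 : E13 w s B b P Q T = 0. Proof. by case: crit => _ []. Qed.
Let e14 : E14 w s B b P Q T = 0. Proof. by case: crit => _ []. Qed.
Let e23 : E23 w s B b P Q T = 0. Proof. by case: crit => _ _ []. Qed.
Let e24 : E24 w s B b P Q T = 0. Proof. by case: crit => _ _ []. Qed.
Let e34 : E34 w s B b P Q T = 0. Proof. by case: crit => _ _ []. Qed.

Let K := B ^+ 2 + b ^+ 2.
Let n := P ^+ 2 + Q ^+ 2.
Let de := Q ^+ 2 - P ^+ 2.
Let Y := K - s ^+ 2 - w ^+ 2.
(** The common factor of the mixed equations: [rel13] and [rel23] say that, for b <> 0, the vector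
    (P, Q) is in the kernel of the matrix with rows (X + 6 w s, - 2 w B) and (2 w B, X - 6 w s). *)
Let X := 2%:R * T - w ^+ 2 - 5%:R * s ^+ 2 - 3%:R * K - 12%:R * n.

Let nge0 : 0 <= n. Proof. by rewrite addr_ge0 ?sqr_ge0. Qed.
Let Kge0 : 0 <= K. Proof. by rewrite addr_ge0 ?sqr_ge0. Qed.

Let cancel0 (a c : R) : a != 0 -> a * c = 0 -> c = 0.
Proof. by move=> a0 /eqP; rewrite mulf_eq0 (negbTE a0) => /eqP. Qed.

Let rel13 : b * (P * (X + 6%:R * w * s) - 2%:R * w * B * Q) = 0.
Proof.
transitivity (E13 w s B b P Q T / 3%:R); last by rewrite e13 mul0r.
by rewrite /E13 /X /K /n; field.
Qed.

Let rel23 : b * (Q * (X - 6%:R * w * s) + 2%:R * w * B * P) = 0.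
Proof.
transitivity (E23 w s B b P Q T / 3%:R); last by rewrite e23 mul0r.
by rewrite /E23 /X /K /n; field.
Qed.

(** Modulo [X], the sum of E11 and E22 is minus a sum of non-negative terms, one of which is 7 s^2
    n. *)
Let no_flat_axis : w = 0 -> X = 0 -> n != 0 -> s = 0.
Proof.
move=> w0 X0 n0.
have : (s ^+ 2 - K) ^+ 2 + 7%:R * (s ^+ 2 * n) + K * n = 0.
  transitivity (- (E11 w s B b P Q T + E22 w s B b P Q T)
    + X * (K - s ^+ 2 - 3%:R * n)); last by rewrite e11 e22 X0; ring.
  by rewrite /E11 /E22 /X /K /n w0; ring.
move=> h; have [s2 Kn] : s ^+ 2 * n = 0 /\ K * n = 0.
  have h1 := sqr_ge0 (s ^+ 2 - K); have h2 := mulr_ge0 (sqr_ge0 s) nge0.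
  have h3 := mulr_ge0 Kge0 nge0; split; lra.
move: s2 => /eqP; rewrite mulf_eq0 (negbTE n0) orbF sqrf_eq0 => /eqP; exact.
Qed.

(** With b = B = 0 the equations E13 and E23 are void and E14, E24 replace them: divided by w + s
    and w - s, they say that X - 6 w s kills Q and X + 6 w s kills P. If only P survives, n = w s
    contradicts the sign of w s; if both do, w = 0 and then s = 0; if only Q does, n = - w s and E11
    + E22 forces s = 0. *)
Lemma critical_unimodular :
  w + s != 0 -> w - s != 0 -> w * s <= 0 -> b = 0 -> B = 0 -> n = 0.
Proof.
move=> l0 m0 ws b0 B0; apply/eqP/negPn/negP => n0.
have K0 : K = 0 by rewrite /K b0 B0; ring.
have q14 : Q * (X - 6%:R * w * s) = 0.
  apply: (cancel0 l0); transitivity (E14 w s B b P Q T); last exact: e14.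
  by rewrite /E14 /X /K /n b0 B0; ring.
have q24 : P * (X + 6%:R * w * s) = 0.
  apply: (cancel0 m0); transitivity (- E24 w s B b P Q T); last by rewrite e24 oppr0.
  by rewrite /E24 /X /K /n b0 B0; ring.
have [P0|P0] := eqVneq P 0; last first.
  have XE : X = - 6%:R * w * s by have := cancel0 P0 q24; lra.
  have [Q0|Q0] := eqVneq Q 0.
    have : (w + s) ^+ 2 * (n - w * s) = 0.
      transitivity ((E11 w s B b P Q T - E22 w s B b P Q T
        - (X + 6%:R * w * s) * (4%:R * w * s - 2%:R * n)) / 12%:R).
        by rewrite /E11 /E22 /X /K /n b0 B0 Q0; field.
      by rewrite e11 e22 XE; ring.
    move=> /(cancel0 (expf_neq0 2 l0)) h.
    have : 0 < n by rewrite lt_def n0.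
    by move=> *; lra.
  have X0 : X = 6%:R * w * s by have := cancel0 Q0 q14; lra.
  have w0 : w = 0.
    have : P * (Q * (12%:R * w ^+ 2)) = 0.
      transitivity (E12 w s B b P Q T + 2%:R * P * Q * X).
        by rewrite /E12 /X /K /n b0 B0; ring.
      have ws0 : w * s = 0 by lra.
      by rewrite e12 X0 -(mulrA 6%:R w s) ws0; ring.
    by move=> /(cancel0 P0)/(cancel0 Q0)/eqP; rewrite mulf_eq0 pnatr_eq0 sqrf_eq0
      => /eqP.
  move: l0; rewrite w0 add0r (no_flat_axis w0) ?eqxx //.
  by rewrite X0 w0 mulr0 mul0r.
have Q0 : Q != 0 by apply: contraNneq n0 => Q0; rewrite /n P0 Q0 expr0n addr0.
have X0 : X = 6%:R * w * s by have := cancel0 Q0 q14; lra.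
have nE : n = - (w * s).
  have : (w - s) ^+ 2 * (n + w * s) = 0.
    transitivity ((- (E11 w s B b P Q T - E22 w s B b P Q T)
      + (X - 6%:R * w * s) * (4%:R * w * s + 2%:R * n)) / 12%:R).
      by rewrite /E11 /E22 /X /K /n b0 B0 P0; field.
    by rewrite e11 e22 X0; ring.
  by move=> /(cancel0 (expf_neq0 2 m0)) h; lra.
have : (w - s) * (s * (s ^+ 2 - w ^+ 2)) = 0.
  transitivity (E11 w s B b P Q T + E22 w s B b P Q T
    + (X - 6%:R * w * s) * (s ^+ 2 + 3%:R * n)
    - (n + w * s) * (w - s) * (w + 7%:R * s)).
    by rewrite /E11 /E22 /X /K /n b0 B0 P0; ring.
  by rewrite e11 e22 X0 nE; ring.
move=> /(cancel0 m0)/eqP; rewrite mulf_eq0 subr_sqr !mulf_eq0.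
rewrite [s + w]addrC -[s - w]opprB oppr_eq0 (negbTE l0) (negbTE m0) !orbF => /eqP s0.
by move: n0; rewrite nE s0 mulr0 oppr0 eqxx.
Qed.

(** The first two outcomes are the symmetric families, the third gives (1) and (5), the fourth gives
    (2). For B <> 0 the value of T comes from E34, for B = 0 from the sum or the difference of E11
    and E22. *)
Lemma critical_abelian : (b = 0 -> B = 0) -> P = 0 -> Q = 0 ->
  [\/ s = 0, w = 0 /\ K = s ^+ 2,
     [/\ w = 0, s != 0, K != s ^+ 2 & T = 2%:R * s ^+ 2 + 2%:R * K] |
     [/\ B = 0, w != 0, s != 0, T = 2%:R * w ^+ 2 + 4%:R * s ^+ 2 &
       b ^+ 4 - (w ^+ 2 + 2%:R * s ^+ 2) * b ^+ 2 + s ^+ 4 - w ^+ 2 * s ^+ 2 = 0]].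
Proof.
move=> bB P0 Q0; have [s0|s0] := eqVneq s 0; first by apply: Or41.
have n4 : 4%:R != 0 :> R by rewrite pnatr_eq0.
have [B0|B0] := eqVneq B 0; last first.
  have b0 : b != 0 by apply: contraNneq B0 => /bB ->.
  have T0 : T - 2%:R * s ^+ 2 - 2%:R * K = 0.
    apply: (cancel0 b0); apply: (cancel0 B0); apply: (cancel0 n4).
    by rewrite -[RHS]e34 /E34 /K P0 Q0; ring.
  have w0 : w = 0.
    have : 4%:R * (s * (B * (4%:R * w ^+ 2))) = 0.
      transitivity (E12 w s B b P Q T + 4%:R * s * B * (T - 2%:R * s ^+ 2 - 2%:R * K)).
        by rewrite /E12 /K P0 Q0; ring.
      by rewrite e12 T0; ring.
    move=> /(cancel0 n4)/(cancel0 s0)/(cancel0 B0)/(cancel0 n4)/eqP.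
    by rewrite sqrf_eq0 => /eqP.
  have [Ks|Ks] := eqVneq K (s ^+ 2); first by apply: Or42.
  by apply: Or43; split=> //; lra.
have [w0|w0] := eqVneq w 0.
  have [Ks|Ks] := eqVneq K (s ^+ 2); first by apply: Or42.
  apply: Or43; split=> //.
  have Ks0 : K - s ^+ 2 != 0 by rewrite subr_eq0.
  have n2 : 2%:R != 0 :> R by rewrite pnatr_eq0.
  have : T - 2%:R * s ^+ 2 - 2%:R * K = 0.
    apply: (cancel0 Ks0); apply: (cancel0 n2).
    transitivity (E11 w s B b P Q T + E22 w s B b P Q T); last by rewrite e11 e22 addr0.
    by rewrite /E11 /E22 /K P0 Q0 w0; ring.
  by move=> h; lra.
apply: Or44.
have T0 : T - 2%:R * w ^+ 2 - 4%:R * s ^+ 2 = 0.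
  have n8 : 8%:R != 0 :> R by rewrite pnatr_eq0.
  apply: (cancel0 s0); apply: (cancel0 w0); apply: (cancel0 n8).
  transitivity (E11 w s B b P Q T - E22 w s B b P Q T); last by rewrite e11 e22 subr0.
  by rewrite /E11 /E22 /K P0 Q0 B0; ring.
split=> //; first by lra.
apply: (cancel0 n4).
transitivity (2%:R * (b ^+ 2 - s ^+ 2) * (T - 2%:R * w ^+ 2 - 4%:R * s ^+ 2)
  - (E11 w s B b P Q T + E22 w s B b P Q T)); last by rewrite e11 e22 T0; ring.
by rewrite /E11 /E22 P0 Q0 B0; ring.
Qed.

(** Modulo the mixed equations, the remaining ones determine P Q, then n = w^2, then de. Imposing
    the circle identity on these values leaves Y = - 6 w^2 and 9 s^2 = 9 w^2 + B^2, which no real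
    parameters satisfy. *)
Let no_oblique : b != 0 -> w != 0 -> n != 0 -> B = 0.
Proof.
move=> b0 w0 n0; apply/eqP/negPn/negP => B0.
have r1 := cancel0 b0 rel13; have r2 := cancel0 b0 rel23.
have n2 : 2%:R != 0 :> R by rewrite pnatr_eq0.
have n4 : 4%:R != 0 :> R by rewrite pnatr_eq0.
(* This combination of the two mixed relations eliminates X. *)
have spi : 6%:R * s * (P * Q) - B * n = 0.
  apply: (cancel0 w0); apply: (cancel0 n2).
  transitivity (Q * (P * (X + 6%:R * w * s) - 2%:R * w * B * Q)
    - P * (Q * (X - 6%:R * w * s) + 2%:R * w * B * P)); first by rewrite /n; ring.
  by rewrite r1 r2; ring.
have s0 : s != 0.
  apply: contraNneq (mulf_neq0 B0 n0) => s0; move: spi; rewrite s0 => h.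
  by apply/eqP; lra.
have T0 : T - 2%:R * s ^+ 2 - 2%:R * K - 6%:R * n = 0.
  apply: (cancel0 B0); apply: (cancel0 b0); apply: (cancel0 n4).
  transitivity (E34 w s B b P Q T - 2%:R * b * (6%:R * s * (P * Q) - B * n)).
    by rewrite /E34 /K /n; ring.
  by rewrite e34 spi; ring.
(* E34 has fixed T; from here on X is replaced by Y, which does not contain T. *)
have XY : X = Y.
  transitivity (Y + 2%:R * (T - 2%:R * s ^+ 2 - 2%:R * K - 6%:R * n)).
    by rewrite /X /Y; ring.
  by rewrite T0 mulr0 addr0.
have Ypi : w * B * de - P * Q * Y = 0.
  apply: (cancel0 n2).
  transitivity (- (Q * (P * (X + 6%:R * w * s) - 2%:R * w * B * Q)
    + P * (Q * (X - 6%:R * w * s) + 2%:R * w * B * P))); last by rewrite r1 r2; ring.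
  by rewrite XY /de; ring.
have Yn : Y * n - 6%:R * w * s * de = 0.
  transitivity (P * (P * (X + 6%:R * w * s) - 2%:R * w * B * Q)
    + Q * (Q * (X - 6%:R * w * s) + 2%:R * w * B * P)); last by rewrite r1 r2; ring.
  by rewrite XY /de /n; ring.
have nw : w ^+ 2 - n = 0.
  apply: (cancel0 B0); apply: (cancel0 s0).
  have n16 : 16%:R != 0 :> R by rewrite pnatr_eq0.
  apply: (cancel0 n16).
  transitivity (E12 w s B b P Q T
    + 4%:R * (s * B + P * Q) * (T - 2%:R * s ^+ 2 - 2%:R * K - 6%:R * n)
    - 14%:R * (w * B * de - P * Q * Y) + 2%:R * s * (6%:R * s * (P * Q) - B * n)).
    by rewrite /E12 /Y /de /K /n; ring.
  by rewrite e12 T0 Ypi spi; ring.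
have sde : 6%:R * s * de - w * Y = 0.
  apply: (cancel0 w0).
  transitivity (- (Y * n - 6%:R * w * s * de) - Y * (w ^+ 2 - n)); first by ring.
  by rewrite Yn nw; ring.
have sG : 48%:R * s ^+ 2 * Y + 36%:R * s ^+ 2 * w ^+ 2 + 7%:R * Y ^+ 2
    + 28%:R * w ^+ 2 * B ^+ 2 = 0.
  apply: (cancel0 w0).
  transitivity (3%:R * s * (E11 w s B b P Q T - E22 w s B b P Q T)
    - 3%:R * s * (8%:R * w * s + 4%:R * de) * (T - 2%:R * s ^+ 2 - 2%:R * K - 6%:R * n)
    + 36%:R * w * s ^+ 2 * (w ^+ 2 - n) - 7%:R * Y * (6%:R * s * de - w * Y)
    - 28%:R * w * B * (6%:R * s * (P * Q) - B * n)
    + 28%:R * w * B ^+ 2 * (w ^+ 2 - n)).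
    by rewrite /E11 /E22 /Y /de /K /n; ring.
  by rewrite e11 e22 T0 nw sde spi; ring.
(* This is the identity de^2 + 4 (P Q)^2 = n^2 multiplied by 36 s^2, with 6 s de = w Y, 6 s P Q = B
   n and n = w^2 inserted. *)
have circ : 36%:R * s ^+ 2 * w ^+ 2 - Y ^+ 2 - 4%:R * B ^+ 2 * w ^+ 2 = 0.
  apply: (cancel0 (expf_neq0 2 w0)).
  transitivity ((6%:R * s * de - w * Y) * (6%:R * s * de + w * Y)
    + 4%:R * (6%:R * s * (P * Q) - B * n) * (6%:R * s * (P * Q) + B * n)
    + (36%:R * s ^+ 2 - 4%:R * B ^+ 2) * (w ^+ 2 - n) * (w ^+ 2 + n)).
    by rewrite /de /n; ring.
  by rewrite sde spi nw; ring.
have Yw : Y + 6%:R * w ^+ 2 = 0.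
  have n48 : 48%:R != 0 :> R by rewrite pnatr_eq0.
  apply: (cancel0 (expf_neq0 2 s0)); apply: (cancel0 n48).
  transitivity (48%:R * s ^+ 2 * Y + 36%:R * s ^+ 2 * w ^+ 2 + 7%:R * Y ^+ 2
    + 28%:R * w ^+ 2 * B ^+ 2
    + 7%:R * (36%:R * s ^+ 2 * w ^+ 2 - Y ^+ 2 - 4%:R * B ^+ 2 * w ^+ 2)); first by ring.
  by rewrite sG circ; ring.
have Bs : 9%:R * s ^+ 2 - 9%:R * w ^+ 2 - B ^+ 2 = 0.
  apply: (cancel0 (expf_neq0 2 w0)); apply: (cancel0 n4).
  transitivity (36%:R * s ^+ 2 * w ^+ 2 - Y ^+ 2 - 4%:R * B ^+ 2 * w ^+ 2
    + (Y + 6%:R * w ^+ 2) * (Y - 6%:R * w ^+ 2)); first by ring.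
  by rewrite circ Yw; ring.
have w2 : 0 < w ^+ 2 by rewrite exprn_even_gt0.
(* Inserting s^2 = w^2 + B^2 / 9 turns Y + 6 w^2 = 0 into 8 B^2 / 9 + b^2 + 4 w^2 = 0. *)
move: Yw; rewrite /Y /K => Yw.
have := sqr_ge0 b; have := sqr_ge0 B; move=> *; lra.
Qed.

(** Once B = 0, the mixed relations say that X + 6 w s kills P and X - 6 w s kills Q. For s = 0 both
    read X = 0 and the direction of (P, Q) stays free: family (3). For s <> 0 only one of P and Q
    survives; P alone would lead to n = w s, against the sign of w s, so it is Q: family (4). *)
Lemma critical_cocycle : w + s != 0 -> w - s != 0 -> w * s <= 0 -> b != 0 -> n != 0 ->
  B = 0 /\
  ([/\ s = 0, b ^+ 2 = w ^+ 2 & T = 2%:R * w ^+ 2 + 6%:R * n] \/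
   [/\ P = 0, w * s != 0, Q ^+ 2 = - (w * s),
      2%:R * T = w ^+ 2 - 6%:R * w * s + 5%:R * s ^+ 2 + 3%:R * b ^+ 2 &
      b ^+ 4 - (w ^+ 2 + 7%:R * w * s + 2%:R * s ^+ 2) * b ^+ 2
      + s * (w + s) * (w - s) ^+ 2 = 0]).
Proof.
move=> l0 m0 ws b0 n0.
have r1 := cancel0 b0 rel13; have r2 := cancel0 b0 rel23.
have w0 : w != 0.
  apply/eqP => w0; move: l0; rewrite no_flat_axis ?w0 ?addr0 ?eqxx //.
  apply: (cancel0 n0).
  transitivity (P * (P * (X + 6%:R * w * s) - 2%:R * w * B * Q)
    + Q * (Q * (X - 6%:R * w * s) + 2%:R * w * B * P)); last by rewrite r1 r2; ring.
  by rewrite w0 /n; ring.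
have B0 := no_oblique b0 w0 n0; split=> //.
have {}r1 : P * (X + 6%:R * w * s) = 0 by rewrite -[RHS]r1 B0; ring.
have {}r2 : Q * (X - 6%:R * w * s) = 0 by rewrite -[RHS]r2 B0; ring.
have npos : 0 < n by rewrite lt_def n0.
have w2 : 0 < w ^+ 2 by rewrite exprn_even_gt0.
have n4 : 4%:R != 0 :> R by rewrite pnatr_eq0.
have n8 : 8%:R != 0 :> R by rewrite pnatr_eq0.
have n12 : 12%:R != 0 :> R by rewrite pnatr_eq0.
have wn : w ^+ 2 + n != 0 by rewrite gt_eqF // addr_gt0.
have [s0|s0] := eqVneq s 0.
  left; have X0 : X = 0.
    apply: (cancel0 n0); transitivity (P * (P * (X + 6%:R * w * s))
      + Q * (Q * (X - 6%:R * w * s))); first by rewrite s0 /n; ring.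
    by rewrite r1 r2; ring.
  have bw : w ^+ 2 - b ^+ 2 = 0.
    apply: (cancel0 n0); apply: (cancel0 n0); apply: (cancel0 n12).
    (* Modulo X, E12 is 12 P Q (w^2 - b^2) and E11 - E22 is 12 (P^2 - Q^2) (w^2 - b^2). These
       weights produce 12 n^2 (w^2 - b^2), which treats all directions of (P, Q) at once. *)
    transitivity (4%:R * P * Q * (E12 w s B b P Q T + 2%:R * P * Q * X)
      + (P ^+ 2 - Q ^+ 2) * (E11 w s B b P Q T - E22 w s B b P Q T
        - 2%:R * de * X)).
      by rewrite /E12 /E11 /E22 /X /de /K /n B0 s0; ring.
    by rewrite e12 e11 e22 X0; ring.
  split=> //; first by lra.
  by move: X0; rewrite /X /K B0 s0 => X0; lra.
right; have [P0|P0] := eqVneq P 0.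
  have Q0 : Q != 0 by apply: contraNneq n0 => Q0; rewrite /n P0 Q0 expr0n addr0.
  have X0 : X - 6%:R * w * s = 0 := cancel0 Q0 r2.
  have nE : n + w * s = 0.
    (* Modulo X - 6 w s, the difference E11 - E22 is a multiple of ((w - s)^2 - b^2) (n + w s). If
       the first factor vanishes, E11 + E22 gives s (w - s) (w^2 + n) = 0, which is impossible. *)
    have [bm|bm] := eqVneq ((w - s) ^+ 2 - b ^+ 2) 0.
      have : 8%:R * (s * ((w - s) * (w ^+ 2 + n))) = 0.
        transitivity (E11 w s B b P Q T + E22 w s B b P Q T
          - (X - 6%:R * w * s) * (b ^+ 2 - s ^+ 2 - 3%:R * n)
          - ((w - s) ^+ 2 - b ^+ 2) * ((w - s) ^+ 2 + b ^+ 2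
             - (w ^+ 2 + 6%:R * w * s + 2%:R * s ^+ 2 - n))).
          by rewrite /E11 /E22 /X /K /n B0 P0; ring.
        by rewrite e11 e22 X0 bm; ring.
      move=> /(cancel0 n8)/(cancel0 s0)/(cancel0 m0)/eqP.
      by rewrite (negbTE wn).
    apply: (cancel0 bm); apply: (cancel0 n12).
    transitivity (- (E11 w s B b P Q T - E22 w s B b P Q T)
      + (X - 6%:R * w * s) * (4%:R * w * s + 2%:R * n)).
      by rewrite /E11 /E22 /X /K /n B0 P0; ring.
    by rewrite e11 e22 X0; ring.
  have QE : Q ^+ 2 = - (w * s) by move: nE; rewrite /n P0 => nE; lra.
  split=> //; first by rewrite mulf_neq0.
    by move: X0; rewrite /X /K /n B0 P0 QE => X0; lra.
  transitivity (- (E11 w s B b P Q T + E22 w s B b P Q T)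
    + (X - 6%:R * w * s) * (b ^+ 2 - s ^+ 2 - 3%:R * n)
    + (n + w * s) * (w ^+ 2 + 6%:R * w * s - 7%:R * s ^+ 2 - b ^+ 2)).
    by rewrite /E11 /E22 /X /K /n B0 P0; ring.
  by rewrite e11 e22 X0 nE; ring.
have X0 : X + 6%:R * w * s = 0 := cancel0 P0 r1.
have Q0 : Q = 0.
  apply/eqP/negPn/negP => Q0; have X1 := cancel0 Q0 r2.
  have : w * s = 0 by lra.
  by move/eqP; rewrite mulf_eq0 (negbTE w0) (negbTE s0).
exfalso; have [bm|bm] := eqVneq ((w + s) ^+ 2 - b ^+ 2) 0.
  have : 8%:R * (s * ((w + s) * (w ^+ 2 + n))) = 0.
    transitivity (- (E11 w s B b P Q T + E22 w s B b P Q T)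
      + (X + 6%:R * w * s) * (b ^+ 2 - s ^+ 2 - 3%:R * n)
      + ((w + s) ^+ 2 - b ^+ 2) * ((w + s) ^+ 2 + b ^+ 2
         - (w ^+ 2 - 6%:R * w * s + 2%:R * s ^+ 2 - n))).
      by rewrite /E11 /E22 /X /K /n B0 Q0; ring.
    by rewrite e11 e22 X0 bm; ring.
  move=> /(cancel0 n8)/(cancel0 s0)/(cancel0 l0)/eqP.
  by rewrite (negbTE wn).
have : n - w * s = 0.
  apply: (cancel0 bm); apply: (cancel0 n12).
  transitivity (E11 w s B b P Q T - E22 w s B b P Q T
    - (X + 6%:R * w * s) * (4%:R * w * s - 2%:R * n)).
    by rewrite /E11 /E22 /X /K /n B0 Q0; ring.
  by rewrite e11 e22 X0; ring.
by move=> h; lra.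
Qed.

End CriticalParameters.

(** * Local symmetry and the parallel Ricci tensor *)

Lemma locally_symmetric_ricci (R : realType) (n : nat) (br : bracket R n)
    (G : 'M[R]_n) : is_lie_bracket br -> is_inner_product G ->
  locally_symmetric br G -> forall v x y, nabla_form br G (ricci br G) v x y = 0.
Proof.
move=> lie Gip sym v x y.
pose A x y := lin1_mx (fun z => curv br G z x y).
pose N := lin1_mx (nabla br G v).
have AE x' y' z : z *m A x' y' = curv br G z x' y' :=
  lin1_mxE z (curv_linear1 lie Gip x' y').
have NE z : z *m N = nabla br G v z := lin1_mxE z (nabla_linear2 lie Gip v).
have : A x y *m N - N *m A x y - A (nabla br G v x) y - A x (nabla br G v y) = 0.
  apply: eq_mulmxr => z; rewrite mulmx0 !mulmxBr 2!mulmxA !AE !NE.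
  by rewrite -(sym v z x y).
(* The first two terms form a commutator, so their traces cancel; the other two traces are those of
   the covariant derivative of the Ricci tensor. *)
move=> /(congr1 (fun M => \tr M)); rewrite /= !raddfB /= mxtrace_mulC subrr sub0r.
by rewrite mxtrace0.
Qed.

Section NormalSymmetric.
Variables (R : realType) (w s B b P Q : R).
Implicit Types (x y z v : 'rV[R]_4).

Lemma F_critical_nbr t : F_critical (nbr w s B b P Q) 1%:M t <->
  critical_eqs w s B b P Q (t * scal (nbr w s B b P Q) 1%:M).
Proof.
set T := t * _; split=> [crit|[[e11 e22 e33 e44] [e12 e13 e14] [e23 e24 e34]] x y].
  have h i j : EF w s B b P Q T (e_ R i) (e_ R j) = 0.
    by rewrite -F_critical_expr_nbr crit.
  split; split.
  - by rewrite -(h i1 i1) /EF !mxE /=; ring.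
  - by rewrite -(h i2 i2) /EF !mxE /=; ring.
  - by rewrite -(h i3 i3) /EF !mxE /=; ring.
  - by rewrite -(h i4 i4) /EF !mxE /=; ring.
  - by rewrite -(h i1 i2) /EF !mxE /=; ring.
  - by rewrite -(h i1 i3) /EF !mxE /=; ring.
  - by rewrite -(h i1 i4) /EF !mxE /=; ring.
  - by rewrite -(h i2 i3) /EF !mxE /=; ring.
  - by rewrite -(h i2 i4) /EF !mxE /=; ring.
  - by rewrite -(h i3 i4) /EF !mxE /=; ring.
rewrite F_critical_expr_nbr -/T /EF e11 e22 e33 e44 e12 e13 e14 e23 e24 e34.
by rewrite !mul0r !addr0.
Qed.

End NormalSymmetric.

Section SymmetricFamilies.
Variables (R : realType).

(* The curvature of a hyperbolic 3-space times a line, flat when [B = b = 0]. *)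
Lemma curv_nbr_rotation (w B b : R) (x1 x2 x3 x4 y1 y2 y3 y4 z1 z2 z3 z4 : R)
    (th := fun u3 u4 => B * u3 + b * u4) (K := B ^+ 2 + b ^+ 2) :
  curv (nbr w 0 B b 0 0) 1%:M (rv4 x1 x2 x3 x4) (rv4 y1 y2 y3 y4)
    (rv4 z1 z2 z3 z4) =
  let hyz := K * (y1 * z1 + y2 * z2) + th y3 y4 * th z3 z4 in
  let hxz := K * (x1 * z1 + x2 * z2) + th x3 x4 * th z3 z4 in
  let r := (x1 * z1 + x2 * z2) * th y3 y4 - (y1 * z1 + y2 * z2) * th x3 x4 in
  rv4 (hxz * y1 - hyz * x1) (hxz * y2 - hyz * x2) (B * r) (b * r).
Proof.
rewrite curv_nbr !nbrE !nnablaE !rv4N !rv4D /th /K /=.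
by congr rv4; ring.
Qed.

(** The parameter [w] is absent from the curvature: the rotation part of ad e_3 is skew and commutes
    with the rest of the action. *)
Lemma nbr_rotation_symmetric (w B b : R) :
  locally_symmetric (nbr w 0 B b 0 0) 1%:M.
Proof.
move=> v x y z; rewrite /nabla_curv !nabla_nbr.
move: v x y z; elim/rv4P => v1 v2 v3 v4; elim/rv4P => x1 x2 x3 x4.
elim/rv4P => y1 y2 y3 y4; elim/rv4P => z1 z2 z3 z4.
rewrite !nnablaE !curv_nbr_rotation /= !nnablaE !rv4N !rv4D.
rewrite [RHS](_ : 0 = rv4 0 0 0 0); last by rewrite [LHS]rv4_eta !mxE.
by congr rv4; ring.
Qed.

(* The curvature of a product of two hyperbolic planes. *)
Lemma curv_nbr_product (s B b : R) (x1 x2 x3 x4 y1 y2 y3 y4 z1 z2 z3 z4 : R)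
    (th := fun u3 u4 => B * u3 + b * u4) : B ^+ 2 = s ^+ 2 - b ^+ 2 ->
  curv (nbr 0 s B b 0 0) 1%:M (rv4 x1 x2 x3 x4) (rv4 y1 y2 y3 y4)
    (rv4 z1 z2 z3 z4) =
  let U := x1 * th y3 y4 - s * x2 * y3 - (y1 * th x3 x4 - s * y2 * x3) in
  let V := x2 * th y3 y4 - s * x1 * y3 - (y2 * th x3 x4 - s * y1 * x3) in
  rv4 (V * s * z3 - U * th z3 z4) (U * s * z3 - V * th z3 z4)
    (B * (U * z1 + V * z2) - s * (U * z2 + V * z1)) (b * (U * z1 + V * z2)).
Proof.
move=> K; rewrite curv_nbr !nbrE !nnablaE !rv4N !rv4D /th /=.
by congr rv4; ring: K.
Qed.

Lemma nbr_product_symmetric (s B b : R) : B ^+ 2 = s ^+ 2 - b ^+ 2 ->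
  locally_symmetric (nbr 0 s B b 0 0) 1%:M.
Proof.
move=> K v x y z; rewrite /nabla_curv !nabla_nbr.
move: v x y z; elim/rv4P => v1 v2 v3 v4; elim/rv4P => x1 x2 x3 x4.
elim/rv4P => y1 y2 y3 y4; elim/rv4P => z1 z2 z3 z4.
rewrite !nnablaE !curv_nbr_product // /= !nnablaE !rv4N !rv4D.
rewrite [RHS](_ : 0 = rv4 0 0 0 0); last by rewrite [LHS]rv4_eta !mxE.
by congr rv4; ring: K.
Qed.

Lemma nbr_ricci_parallel (w s B b P Q : R) :
  locally_symmetric (nbr w s B b P Q) 1%:M -> forall v x y,
  nricci w s B b P Q (nnabla w s B b P Q v x) y
  + nricci w s B b P Q x (nnabla w s B b P Q v y) = 0.
Proof.
move=> sym v x y; have :=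
  locally_symmetric_ricci (nbr_lie _ _ _ _ _ _) (inner_product1 _ _)
  sym v x y.
rewrite /nabla_form !ricci_nbr !nabla_nbr -opprD => /eqP.
by rewrite oppr_eq0 => /eqP.
Qed.

Lemma nbr_abelian_not_symmetric (s B b : R) : s != 0 -> B ^+ 2 + b ^+ 2 != s ^+ 2 ->
  ~ locally_symmetric (nbr 0 s B b 0 0) 1%:M.
Proof.
move=> s0 K /nbr_ricci_parallel/(_ (e_ R i1) (e_ R i2) (e_ R i3)).
rewrite !rv4_delta !nnablaE !nricciE => e.
have : 2%:R * s * (B ^+ 2 + b ^+ 2 - s ^+ 2) = 0 by rewrite -e; ring.
by move/eqP; rewrite !mulf_eq0 pnatr_eq0 (negbTE s0) subr_eq0 (negbTE K).
Qed.

Lemma nbr_diagonal_not_symmetric (w s b Q : R) : b != 0 -> w * s != Q ^+ 2 ->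
  ~ locally_symmetric (nbr w s 0 b 0 Q) 1%:M.
Proof.
move=> b0 wsQ /nbr_ricci_parallel/(_ (e_ R i1) (e_ R i1) (e_ R i4)).
rewrite !rv4_delta !nnablaE !nricciE => e.
have : 2%:R * b * (w * s - Q ^+ 2) = 0 by rewrite -[RHS]oppr0 -e; ring.
by move/eqP; rewrite !mulf_eq0 pnatr_eq0 (negbTE b0) subr_eq0 (negbTE wsQ).
Qed.

End SymmetricFamilies.

(** * The listed metrics *)

Section Listed.
Variable R : realType.
Implicit Types (x y : 'rV[R]_4).

(** The factor is fixed to 1 because a homothety of factor [c] would multiply the energy by
    [c^-2]. *)
Definition isometric (br br' : bracket R 4) : Prop :=
  exists2 f : {linear 'rV[R]_4 -> 'rV[R]_4}, is_lie_iso br br' f &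
    forall x y, ip 1%:M (f x) (f y) = 1 * ip 1%:M x y.

Lemma isometric_mx (br br' : bracket R 4) (P : 'M[R]_4) :
  (forall x y, br x y *m P = br' (x *m P) (y *m P)) ->
  (forall x y, ip 1%:M (x *m P) (y *m P) = 1 * ip 1%:M x y) -> isometric br br'.
Proof.
move=> Pbr Pip.
have PP : P *m P^T = 1%:M.
  by apply: eq_ip_mx => x y; rewrite -[RHS]mul1r -Pip /ip mulmx1 trmx_mul !mulmxA.
have [Pu _] := mulmx1_unit PP.
exists (mulmxr P) => //; split=> //.
by exists (mulmxr (invmx P)) => x /=; rewrite ?mulmxK ?mulmxKV.
Qed.

Lemma isometric_refl (br : bracket R 4) : isometric br br.
Proof. by apply: (@isometric_mx _ _ 1%:M) => x y; rewrite ?mulmx1 ?mul1r. Qed.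

Lemma isometric_homothetic (br br' : bracket R 4) : isometric br br' ->
  isomorphically_homothetic br 1%:M br' 1%:M.
Proof. by move=> [f iso fip]; exists f, 1; split. Qed.

Lemma isometric_energy (br br' : bracket R 4) t : is_lie_bracket br ->
  isometric br br' -> energy br' 1%:M t = energy br 1%:M t.
Proof.
move=> lie h; have lie' := homothetic_lie lie (isometric_homothetic h).
have ip1 := inner_product1 R 4; case: h => f [fbij fbr] fip.
by rewrite (energy_hom lie lie' ip1 ip1 fbij ltr01 fbr fip) invr1 expr1n mul1r.
Qed.

Lemma critical_abelian_family (s B b : R) :
  critical_eqs 0 s B b 0 0 (2%:R * s ^+ 2 + 2%:R * (B ^+ 2 + b ^+ 2)).
Proof.
split; split;
  rewrite /E11 /E22 /E33 /E44 /E12 /E13 /E14 /E23 /E24 /E34; ring.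
Qed.

Lemma critical_diagonal_family (w s b : R) :
  b ^+ 4 - (w ^+ 2 + 2%:R * s ^+ 2) * b ^+ 2 + s ^+ 4 - w ^+ 2 * s ^+ 2 = 0 ->
  critical_eqs w s 0 b 0 0 (2%:R * w ^+ 2 + 4%:R * s ^+ 2).
Proof.
set q := _ - _ => q0.
have m2 a : a = - 2%:R * q -> a = 0 by move=> ->; rewrite q0 mulr0.
split; split.
- by apply: m2; rewrite /E11 /q; ring.
- by apply: m2; rewrite /E22 /q; ring.
- by transitivity (6%:R * q); [rewrite /E33 /q; ring | rewrite q0 mulr0].
- by apply: m2; rewrite /E44 /q; ring.
all: by rewrite /E12 /E13 /E14 /E23 /E24 /E34; ring.
Qed.

Lemma critical_round_family (Q : R) :
  critical_eqs 1 0 0 1 0 Q (2%:R + 6%:R * Q ^+ 2).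
Proof.
split; split;
  rewrite /E11 /E22 /E33 /E44 /E12 /E13 /E14 /E23 /E24 /E34; ring.
Qed.

Lemma critical_cocycle_family (w s b Q : R) : Q ^+ 2 = - (w * s) ->
  b ^+ 4 - (w ^+ 2 + 7%:R * w * s + 2%:R * s ^+ 2) * b ^+ 2
    + s * (w + s) * (w - s) ^+ 2 = 0 ->
  critical_eqs w s 0 b 0 Q
    ((w ^+ 2 - 6%:R * w * s + 5%:R * s ^+ 2 + 3%:R * b ^+ 2) / 2%:R).
Proof.
set q := _ + s * _ * _ => Q2 q0; pose z := Q ^+ 2 + w * s.
have z0 : z = 0 by rewrite /z Q2 addNr.
(* Each equation lies in the ideal generated by [q] and [z]; the multipliers are given case by
   case. *)
have comb k c a : a = k * q + c * z -> a = 0.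
  by move=> ->; rewrite q0 z0 !mulr0 addr0.
split; split.
- apply: (comb (- 1 / 2%:R) (- (11%:R / 2%:R) * w ^+ 2 - 9%:R * w * s
    - 7%:R / 2%:R * s ^+ 2 - b ^+ 2 / 2%:R + 6%:R * Q ^+ 2)).
  by rewrite /E11 /q /z; field.
- apply: (comb (- 1 / 2%:R) (13%:R / 2%:R * w ^+ 2 + 15%:R * w * s
    + 17%:R / 2%:R * s ^+ 2 - 25%:R / 2%:R * b ^+ 2 + 30%:R * Q ^+ 2)).
  by rewrite /E22 /q /z; field.
- apply: (comb (3%:R / 2%:R) (- (3%:R / 2%:R) * w ^+ 2 - 9%:R * w * s
    - 15%:R / 2%:R * s ^+ 2 + 39%:R / 2%:R * b ^+ 2 - 18%:R * Q ^+ 2)).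
  by rewrite /E33 /q /z; field.
- apply: (comb (- 1 / 2%:R) (w ^+ 2 / 2%:R + 3%:R * w * s
    + 5%:R / 2%:R * s ^+ 2 - 13%:R / 2%:R * b ^+ 2 - 18%:R * Q ^+ 2)).
  by rewrite /E44 /q /z; field.
- by rewrite /E12; ring.
- by rewrite /E13; ring.
- by apply: (comb 0 (- 12%:R * (w + s) * Q)); rewrite /E14 /z; field.
- by apply: (comb 0 (- 36%:R * b * Q)); rewrite /E23 /z; field.
- by rewrite /E24; ring.
- by rewrite /E34; ring.
Qed.

Lemma bracket1E : bracket1 R = nbr 0 (- 1) 0 0 0 0.
Proof.
apply/funext => x; apply/funext => y; rewrite /bracket1 /lie_table !big_cons big_nil.
by rewrite /= !rv4_delta addr0 !rv4Z !rv4D /nbr /solv; congr rv4; ring.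
Qed.

(** [w] and [s] are the solution of w + s = l, w - s = 1. *)
Lemma bracket4E (l b D : R) : bracket4 l b D =
  nbr ((l + 1) / 2%:R) ((l - 1) / 2%:R) 0 b 0 (D / 2%:R).
Proof.
apply/funext => x; apply/funext => y; rewrite /bracket4 /lie_table !big_cons big_nil.
by rewrite /= !rv4_delta addr0 !rv4Z !rv4D /nbr /solv; congr rv4; field.
Qed.

Lemma bracket2E (l b : R) : bracket2 l b =
  nbr ((l + 1) / 2%:R) ((l - 1) / 2%:R) 0 b 0 0.
Proof.
apply/funext => x; apply/funext => y; rewrite /bracket2 /lie_table !big_cons big_nil.
by rewrite /= !rv4_delta addr0 !rv4Z !rv4D /nbr /solv; congr rv4; field.
Qed.

Lemma bracket3E (D : R) : bracket3 D = nbr 1 0 0 1 0 (D / 2%:R).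
Proof.
apply/funext => x; apply/funext => y; rewrite /bracket3 /lie_table !big_cons big_nil.
by rewrite /= !rv4_delta addr0 !rv4Z !rv4N !rv4Z !rv4D /nbr /solv; congr rv4; field.
Qed.

Lemma bracket5E (A b : R) : bracket5 A b = solv2 0 1 1 b A 0 0.
Proof.
apply/funext => x; apply/funext => y; rewrite /bracket5 /lie_table !big_cons big_nil.
rewrite /= !rv4_delta addr0 !rv4Z !rv4D !rv4Z !rv4D /solv2 /solv.
by congr rv4; ring.
Qed.

(** In family (5) ad e_4 still has the trace-free part A ad e_3; the rotation of span(e_3, e_4) with
    tangent [A] removes it. *)
Lemma bracket5_isometric (A b : R) (u := Num.sqrt (1 + A ^+ 2)) :
  isometric (nbr 0 (- u) (A * b / u) (b / u) 0 0) (bracket5 A b).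
Proof.
have u2 : u ^+ 2 = 1 + A ^+ 2 by rewrite sqr_sqrtr // addr_ge0 ?sqr_ge0.
have u0 : u != 0 by rewrite gt_eqF // sqrtr_gt0 ltr_pwDl ?sqr_ge0.
have A2 : A ^+ 2 = u ^+ 2 - 1 by rewrite u2; ring.
rewrite bracket5E; apply: (@isometric_mx _ _ (mx4 (rv4 1 0 0 0) (rv4 0 1 0 0)
  (rv4 0 0 u^-1 (A / u)) (rv4 0 0 (- A / u) u^-1))).
- by move=> x y; rewrite /nbr /solv2; coord; congr rv4; field: A2.
- by move=> x y; rewrite !ip1; coord; field: A2.
Qed.

Lemma listed_nbr br t E : listed br t E ->
  exists w s B b P Q, [/\ isometric (nbr w s B b P Q) br,
    critical_eqs w s B b P Q (t * scal (nbr w s B b P Q) 1%:M),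
    ~ locally_symmetric (nbr w s B b P Q) 1%:M &
    energy (nbr w s B b P Q) 1%:M t = E].
Proof.
case=> {br t E} [|l b l1 b0 eq2|D D0|l b D l0 l1 D0 Dl b0 eq4|A b b0 A0 bA].
- exists 0, (- 1), 0, 0, 0, 0; have T : - 1 * scal (nbr 0 (- 1) 0 0 0 0) 1%:M
    = 2%:R * (- 1) ^+ 2 + 2%:R * (0 ^+ 2 + 0 ^+ 2) :> R by rewrite scal_nbr; ring.
  split; first by rewrite -bracket1E; exact: isometric_refl.
  + by rewrite T; exact: critical_abelian_family.
  + by apply: nbr_abelian_not_symmetric; rewrite ?oppr_eq0 ?oner_eq0 //;
      rewrite sqrrN expr1n expr0n /= addr0 eq_sym oner_eq0.
  + by rewrite energy_nbr norm2_nbr T scal_nbr; ring.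
- have b2 : 0 < b ^+ 2 by rewrite exprn_gt0.
  have d0 : 12%:R * b ^+ 2 + (l - 1) ^+ 2 != 0.
    by rewrite gt_eqF // ltr_wpDr ?sqr_ge0 // mulr_gt0 ?ltr0n.
  exists ((l + 1) / 2%:R), ((l - 1) / 2%:R), 0, b, 0, 0.
  set w := (l + 1) / _; set s := (l - 1) / _.
  set t := - _; have T : t * scal (nbr w s 0 b 0 0) 1%:M =
      2%:R * w ^+ 2 + 4%:R * s ^+ 2.
    by rewrite scal_nbr /t /w /s; field; rewrite d0.
  have q0 : b ^+ 4 - (w ^+ 2 + 2%:R * s ^+ 2) * b ^+ 2 + s ^+ 4 - w ^+ 2 * s ^+ 2 = 0.
    transitivity ((4%:R * b ^+ 4 - (3%:R * l ^+ 2 - 2%:R * l + 3%:R) * b ^+ 2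
      - (l - 1) ^+ 2 * l) / 4%:R); last by rewrite eq2 mul0r.
    by rewrite /w /s; field.
  split; first by rewrite -bracket2E; exact: isometric_refl.
  + by rewrite T; exact: critical_diagonal_family.
  + apply: nbr_diagonal_not_symmetric; first by rewrite gt_eqF.
    rewrite expr0n /= /w /s !mulf_neq0 ?invr_eq0 ?pnatr_eq0 //; apply/eqP => h; lra.
  + rewrite energy_nbr norm2_nbr T scal_nbr.
    (* The energy is the stated value plus a multiple of the equation satisfied by [b]. *)
    transitivity (12%:R * (b ^+ 4 - (w ^+ 2 + 2%:R * s ^+ 2) * b ^+ 2 + s ^+ 4
      - w ^+ 2 * s ^+ 2) + 4%:R * l * (l - 1) ^+ 2); last by rewrite q0; ring.
    by rewrite /w /s; field.
- have d0 : D ^+ 2 + 12%:R != 0 by rewrite gt_eqF // ltr_wpDl ?sqr_ge0 ?ltr0n.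
  exists 1, 0, 0, 1, 0, (D / 2%:R); set t := - _.
  have T : t * scal (nbr 1 0 0 1 0 (D / 2%:R)) 1%:M = 2%:R + 6%:R * (D / 2%:R) ^+ 2.
    by rewrite scal_nbr /t; field; rewrite d0.
  split; first by rewrite -bracket3E; exact: isometric_refl.
  + by rewrite T; exact: critical_round_family.
  + apply: nbr_diagonal_not_symmetric; first exact: oner_neq0.
    by rewrite mulr0 eq_sym sqrf_eq0 mulf_neq0 ?invr_eq0 ?pnatr_eq0 // gt_eqF.
  + by rewrite energy_nbr norm2_nbr T scal_nbr; field.
- have b2 : 0 < b ^+ 2 by rewrite exprn_gt0.
  have d0 : 12%:R * b ^+ 2 - 2%:R * l + 2%:R != 0 by rewrite gt_eqF //; lra.
  exists ((l + 1) / 2%:R), ((l - 1) / 2%:R), 0, b, 0, (D / 2%:R).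
  have D2 : D ^+ 2 = 1 - l ^+ 2 by rewrite -Dl addrK.
  have Qn0 : D / 2%:R != 0 by rewrite mulf_neq0 ?invr_eq0 ?pnatr_eq0 // gt_eqF.
  set w := (l + 1) / _; set s := (l - 1) / _.
  have Q2 : (D / 2%:R) ^+ 2 = - (w * s) by rewrite /w /s; field: D2.
  set t := - _; have T : t * scal (nbr w s 0 b 0 (D / 2%:R)) 1%:M =
      (w ^+ 2 - 6%:R * w * s + 5%:R * s ^+ 2 + 3%:R * b ^+ 2) / 2%:R.
    by rewrite scal_nbr Q2 /t /w /s; field; rewrite d0.
  have q0 : b ^+ 4 - (w ^+ 2 + 7%:R * w * s + 2%:R * s ^+ 2) * b ^+ 2
      + s * (w + s) * (w - s) ^+ 2 = 0.
    transitivity ((2%:R * b ^+ 4 - (5%:R * l ^+ 2 - l - 2%:R) * b ^+ 2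
      + l * (l - 1)) / 2%:R); last by rewrite eq4 mul0r.
    by rewrite /w /s; field.
  split; first by rewrite -bracket4E; exact: isometric_refl.
  + by rewrite T; exact: critical_cocycle_family.
  + apply: nbr_diagonal_not_symmetric; first by rewrite gt_eqF.
    have : 0 < (D / 2%:R) ^+ 2 by rewrite exprn_even_gt0.
    by move=> h; apply/eqP => e; lra.
  + rewrite energy_nbr norm2_nbr T scal_nbr.
    have Q4 : (D / 2%:R) ^+ 4 = (w * s) ^+ 2 by rewrite (exprM _ 2 2) Q2 sqrrN.
    transitivity (3%:R * (b ^+ 4 - (w ^+ 2 + 7%:R * w * s + 2%:R * s ^+ 2) * b ^+ 2
      + s * (w + s) * (w - s) ^+ 2) + (w ^+ 2 + 6%:R * w * s + 5%:R * s ^+ 2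
      + 15%:R * b ^+ 2 + 12%:R * (D / 2%:R) ^+ 2) * ((D / 2%:R) ^+ 2 + w * s)
      + (l - 1) * (3%:R * (l + 3%:R) * b ^+ 2 - 2%:R * l)).
      by rewrite /w /s; field.
    by rewrite q0 Q2 addNr; ring.
- have b2 : 0 < b ^+ 2 by rewrite exprn_gt0.
  have u2 : Num.sqrt (1 + A ^+ 2) ^+ 2 = 1 + A ^+ 2.
    by rewrite sqr_sqrtr // addr_ge0 ?sqr_ge0.
  have iso := bracket5_isometric A b; move: u2 iso.
  have : Num.sqrt (1 + A ^+ 2) != 0 by rewrite gt_eqF // sqrtr_gt0 ltr_pwDl ?sqr_ge0.
  move: (Num.sqrt (1 + A ^+ 2)) => u u0 u2 iso.
  have K : (A * b / u) ^+ 2 + (b / u) ^+ 2 = b ^+ 2.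
    have A2 : A ^+ 2 = u ^+ 2 - 1 by rewrite u2; ring.
    by field: A2.
  exists 0, (- u), (A * b / u), (b / u), 0, 0; set t := - (_ / _).
  have d0 : A ^+ 2 + 3%:R * b ^+ 2 + 1 != 0.
    by rewrite gt_eqF //; have := sqr_ge0 A; move=> h; lra.
  have T : t * scal (nbr 0 (- u) (A * b / u) (b / u) 0 0) 1%:M =
      2%:R * (- u) ^+ 2 + 2%:R * ((A * b / u) ^+ 2 + (b / u) ^+ 2).
    by rewrite scal_nbr K sqrrN u2 /t; field; rewrite d0.
  split=> //.
  + by rewrite T; exact: critical_abelian_family.
  (* Here K = b^2 and s^2 = 1 + A^2, so the excluded locus b^2 - A^2 = 1 is the product of two
     hyperbolic planes. *)
  + apply: nbr_abelian_not_symmetric; first by rewrite oppr_eq0.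
    rewrite K sqrrN u2; apply: contra bA => /eqP ->.
    by apply/eqP; ring.
  + rewrite energy_nbr norm2_nbr T scal_nbr.
    transitivity (- 16%:R * (u * (b / u)) ^+ 2); first by ring.
    by rewrite [u * _]mulrC divfK // mulNr.
Qed.

End Listed.

(** * From the critical parameters to the list *)

Section NormalListed.
Variable R : realType.

(** Family (4) does not reach -1 < l < 0. There the constant term l (l - 1) is positive, so either
    all terms are non-negative, or the coefficient of b^2 is negative and so is the discriminant. *)
Lemma equation4_pos (l b : R) : -1 < l -> b != 0 -> equation4 l b -> 0 < l \/ l = 0.
Proof.
move=> l1 b0 eq4; have [l0|l0] := ltP l 0; last first.
  by move: l0; rewrite le_eqVlt => /orP[/eqP <-|]; [right | left].
exfalso; have y0 : 0 < b ^+ 2 by rewrite exprn_even_gt0.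
have ll : 0 < l * (l - 1) by rewrite nmulr_rgt0 //; lra.
have b4 : b ^+ 4 = b ^+ 2 * b ^+ 2 by ring.
have yy := mulr_gt0 y0 y0.
move: eq4; rewrite /equation4 b4; move: (b ^+ 2) y0 yy => y y0 yy eq4.
have [c0|c0] := leP (5%:R * l ^+ 2 - l - 2%:R) 0.
  have := mulr_le0_ge0 c0 (ltW y0); lra.
(* The discriminant in [b ^+ 2] is negative here: it equals
   [(l + 1) * (25 l^3 - 35 l^2 + 8 l + 4)]. *)
have cub : 25%:R * l ^+ 3 - 35%:R * l ^+ 2 + 8%:R * l + 4%:R < 0.
  (* With c = 5 l^2 - l - 2 > 0, adding 5 (- l) c and 6 c to the cubic leaves 12 l - 8 < 0. *)
  have : 0 < - l * (5%:R * l ^+ 2 - l - 2%:R) by rewrite mulr_gt0 // oppr_gt0.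
  have -> : - l * (5%:R * l ^+ 2 - l - 2%:R)
    = - 5%:R * l ^+ 3 + l ^+ 2 + 2%:R * l by ring.
  move=> h; lra.
have : 0 < (l + 1) * - (25%:R * l ^+ 3 - 35%:R * l ^+ 2 + 8%:R * l + 4%:R).
  by rewrite mulr_gt0 ?oppr_gt0 //; lra.
have := sqr_ge0 (4%:R * y - (5%:R * l ^+ 2 - l - 2%:R)).
have e : (4%:R * y - (5%:R * l ^+ 2 - l - 2%:R)) ^+ 2 =
  8%:R * (2%:R * (y * y) - (5%:R * l ^+ 2 - l - 2%:R) * y + l * (l - 1))
  - (l + 1) * - (25%:R * l ^+ 3 - 35%:R * l ^+ 2 + 8%:R * l + 4%:R) by ring.
by rewrite e eq4 => h1 h2; lra.
Qed.

(** The parameters are found by inverting the rotation and the scaling: A / 1 = B / b is the ratio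
    of the two traces, and u^2 = 1 + A^2 turns u^2 b into K / b. *)
Lemma bracket5_homothetic (B b : R) (K := B ^+ 2 + b ^+ 2) : b != 0 ->
  isomorphically_homothetic (bracket5 (B / b) (K / b)) 1%:M
    (nbr 0 (- 1) B b 0 0) 1%:M.
Proof.
move=> b0; rewrite bracket5E.
have h := solv_rotate_normal 1 1 (K / b) (B / b) 0 0; move: h => /=.
set u := Num.sqrt _ => h.
have u2 : u ^+ 2 = K / b ^+ 2.
  rewrite sqr_sqrtr ?addr_ge0 ?sqr_ge0 // /K; by field.
have u0 : u != 0 by rewrite gt_eqF // sqrtr_gt0 ltr_pwDl ?sqr_ge0.
have KE : K = u ^+ 2 * b ^+ 2 by rewrite u2 divfK // expf_neq0.
apply: homothetic_trans h _.
have := solv_scale (B / b * (K / b) / u) (u * 1) (u * 1) (B / b * (K / b) / u)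
  (K / b / u) 0 0 (K / b / u) 0 0 u0.
have -> : u * 1 / u = 1 by rewrite mulr1 divff.
have -> : B / b * (K / b) / u / u = B by rewrite KE; field; rewrite u0 b0.
have -> : K / b / u / u = b by rewrite KE; field; rewrite u0 b0.
by rewrite /nbr !(mulr0, mul0r, add0r, opprK).
Qed.

(** With s = 0 the action on the plane is by similarities, which commute with its rotations, so (P,
    Q) can be turned onto the second axis. *)
Lemma nbr_round_homothetic (P Q : R) (r := Num.sqrt (P ^+ 2 + Q ^+ 2)) : r != 0 ->
  isomorphically_homothetic (nbr 1 0 0 1 P Q) 1%:M (nbr 1 0 0 1 0 r) 1%:M.
Proof.
move=> r0; have r2 : r ^+ 2 = P ^+ 2 + Q ^+ 2.
  by rewrite sqr_sqrtr // addr_ge0 ?sqr_ge0.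
have P2 : P ^+ 2 = r ^+ 2 - Q ^+ 2 by rewrite r2 addrK.
apply/homothetic_sym/isometric_homothetic.
apply: (@isometric_mx _ _ _ (mx4 (rv4 (Q / r) (- P / r) 0 0)
  (rv4 (P / r) (Q / r) 0 0) (rv4 0 0 1 0) (rv4 0 0 0 1))).
- by move=> x y; rewrite /nbr; coord; congr rv4; field: P2.
- by move=> x y; rewrite !ip1; coord; field: P2.
Qed.

Lemma nbr_flip12 (w s b Q : R) :
  isomorphically_homothetic (nbr w s 0 b 0 Q) 1%:M (nbr w s 0 b 0 (- Q)) 1%:M.
Proof.
apply/isometric_homothetic/(@isometric_mx _ _ _ (mx4 (rv4 (- 1) 0 0 0)
  (rv4 0 (- 1) 0 0) (rv4 0 0 1 0) (rv4 0 0 0 1))).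
- by move=> x y; rewrite /nbr; coord; congr rv4; ring.
- by move=> x y; rewrite !ip1; coord; ring.
Qed.

Lemma nbr_abelian_listed (w s B b t : R) : normal_params w s B b -> w + s != 0 ->
  ~ locally_symmetric (nbr w s B b 0 0) 1%:M ->
  critical_eqs w s B b 0 0 (t * scal (nbr w s B b 0 0) 1%:M) ->
  exists br' E, listed br' t E /\
    isomorphically_homothetic (nbr w s B b 0 0) 1%:M br' 1%:M.
Proof.
move=> [ws1 /andP[l1 l2] b0 B0 bB] l0 nsym crit.
have wE : w = s + 1 by lra.
have K0 : 0 <= B ^+ 2 + b ^+ 2 by rewrite addr_ge0 ?sqr_ge0.
case: (critical_abelian crit bB erefl erefl).
- by move=> s0; case: nsym; rewrite s0; exact: nbr_rotation_symmetric.
- move=> [w0 K]; case: nsym; rewrite w0; apply: nbr_product_symmetric.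
  by rewrite -K addrK.
- move=> [w0 s0 K T]; have sE : s = - 1 by lra.
  move: T K; rewrite scal_nbr w0 sE sqrrN expr1n => T K.
  have n0 : 1 + 3%:R * (B ^+ 2 + b ^+ 2) != 0 by rewrite gt_eqF //; lra.
  have tE : t = - ((1 + (B ^+ 2 + b ^+ 2)) / (1 + 3%:R * (B ^+ 2 + b ^+ 2))).
    apply: (mulIf n0); rewrite mulNr divfK //; move: T; rewrite !expr0n /= !addr0.
    by move=> T; lra.
  have [b00|bn0] := eqVneq b 0.
    exists (bracket1 R), 0; split.
      move: tE; rewrite b00 (bB b00) !expr0n /= !addr0 mulr0 addr0 divr1 => ->.
      exact: Listed1.
    by rewrite b00 (bB b00) bracket1E; apply/isometric_homothetic/isometric_refl.
  have bpos : 0 < b by rewrite lt_def bn0.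
  set K' := B ^+ 2 + b ^+ 2 in tE K K0 n0 *.
  have Kpos : 0 < K' by rewrite /K' ltr_wpDl ?sqr_ge0 // exprn_gt0.
  exists (bracket5 (B / b) (K' / b)), (- (16%:R * (K' / b) ^+ 2)); split.
    have B2 : B ^+ 2 = K' - b ^+ 2 by rewrite /K' addrK.
    have -> : t = - (((B / b) ^+ 2 + (K' / b) ^+ 2 + 1)
        / ((B / b) ^+ 2 + 3%:R * (K' / b) ^+ 2 + 1)).
      have e1 : (B / b) ^+ 2 + (K' / b) ^+ 2 + 1 = (1 + K') * (K' / b ^+ 2).
        by field: B2.
      have e2 : (B / b) ^+ 2 + 3%:R * (K' / b) ^+ 2 + 1
          = (1 + 3%:R * K') * (K' / b ^+ 2) by field: B2.
      rewrite e1 e2 tE; congr (- _).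
      by rewrite -mulf_div divff ?mulr1 // mulf_neq0 ?invr_eq0 ?expf_neq0 ?gt_eqF.
    apply: Listed5; [exact: divr_gt0|exact: divr_ge0|].
    have -> : (K' / b) ^+ 2 - (B / b) ^+ 2 = (K' ^+ 2 - K' + b ^+ 2) / b ^+ 2.
      by field: B2.
    (* For these parameters the excluded equation becomes K' (K' - 1) = 0, that is K' = s^2 = 1. *)
    apply: contra K => /eqP h.
    have {}h : K' ^+ 2 - K' + b ^+ 2 = b ^+ 2.
      by rewrite -[RHS]mul1r -h divfK // expf_neq0.
    have : K' * (K' - 1) = 0 by lra.
    by move/eqP; rewrite mulf_eq0 gt_eqF //= subr_eq0.
  exact/homothetic_sym/bracket5_homothetic.
- move=> [B00 w0 s0 T q0]; have bn0 : b != 0.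
    apply/eqP => b00; have : s ^+ 2 * ((w + s) * (w - s)) = 0.
      by rewrite -[RHS]oppr0 -q0 b00; ring.
    by move/eqP; rewrite ws1 mulr1 !mulf_eq0 !(negbTE s0) (negbTE l0).
  have bpos : 0 < b by rewrite lt_def bn0.
  have b2 : 0 < b ^+ 2 by rewrite exprn_gt0.
  pose l := w + s; exists (bracket2 l b), (4%:R * l * (l - 1) ^+ 2); split; last first.
    rewrite bracket2E B00; have -> : (l + 1) / 2%:R = w by rewrite /l wE; field.
    have -> : (l - 1) / 2%:R = s by rewrite /l wE; field.
    exact/isometric_homothetic/isometric_refl.
  have -> : t = - ((3%:R * l ^+ 2 - 2%:R * l + 3%:R) / (12%:R * b ^+ 2 + (l - 1) ^+ 2)).
    have n0 : 12%:R * b ^+ 2 + (l - 1) ^+ 2 != 0.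
      by rewrite gt_eqF // ltr_wpDr ?sqr_ge0 // mulr_gt0 ?ltr0n.
    apply: (mulIf n0); rewrite mulNr divfK //.
    by move: T; rewrite scal_nbr B00 /l wE => T; lra.
  have ln0 : l != 0 by [].
  (* The endpoints l = -1 and l = 1 are w = 0 and s = 0, which belong to other outcomes. *)
  have lm1 : l != - 1 by apply: contra w0 => /eqP h; apply/eqP; rewrite /l in h; lra.
  have lp1 : l != 1 by apply: contra s0 => /eqP h; apply/eqP; rewrite /l in h; lra.
  apply: Listed2 => //.
    have [h|h] := ltP l 0; [left|right]; split=> //.
    + by rewrite lt_def lm1.
    + by rewrite lt_def ln0.
    + by rewrite lt_def eq_sym lp1.
  rewrite /equation2 -(mulr0 4%:R) -q0 /l wE; ring.
Qed.

Lemma nbr_cocycle_listed (w s B b P Q t : R) : normal_params w s B b ->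
  w + s != 0 -> P ^+ 2 + Q ^+ 2 != 0 ->
  critical_eqs w s B b P Q (t * scal (nbr w s B b P Q) 1%:M) ->
  exists br' E, listed br' t E /\
    isomorphically_homothetic (nbr w s B b P Q) 1%:M br' 1%:M.
Proof.
move=> [ws1 /andP[l1 l2] b0 B0 bB] l0 n0 crit.
have wE : w = s + 1 by lra.
have m0 : w - s != 0 by rewrite ws1 oner_neq0.
have wsle : w * s <= 0 by rewrite wE mulr_ge0_le0 //; lra.
have bn0 : b != 0.
  apply: contra n0 => /eqP b00; apply/eqP.
  by have := critical_unimodular crit l0 m0 wsle b00 (bB b00).
have bpos : 0 < b by rewrite lt_def bn0.
have [B00 [[s0 bw T]|[P0 ws0 Q2 T q0]]] := critical_cocycle crit l0 m0 wsle bn0 n0.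
  have w1 : w = 1 by lra.
  have b1 : b = 1.
    by move/eqP: bw; rewrite w1 expr1n sqrf_eq1 => /orP[]/eqP // h; lra.
  move: T; rewrite scal_nbr B00 s0 w1 b1 => T; set r := Num.sqrt (P ^+ 2 + Q ^+ 2).
  have npos : 0 < P ^+ 2 + Q ^+ 2 by rewrite lt_def n0 addr_ge0 ?sqr_ge0.
  have rpos : 0 < r by rewrite sqrtr_gt0.
  have r2 : r ^+ 2 = P ^+ 2 + Q ^+ 2 by rewrite sqr_sqrtr // ltW.
  exists (bracket3 (2%:R * r)), (- (5%:R * (2%:R * r) ^+ 2)); split.
    have -> : t = - ((3%:R * (2%:R * r) ^+ 2 + 4%:R) / ((2%:R * r) ^+ 2 + 12%:R)).
      have d0 : (2%:R * r) ^+ 2 + 12%:R != 0 by rewrite gt_eqF // ltr_wpDl ?sqr_ge0.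
      apply: (mulIf d0); rewrite mulNr divfK // !exprMn r2.
      by lra.
    by apply: Listed3; rewrite mulr_gt0.
  rewrite bracket3E [2%:R * r]mulrC mulfK ?pnatr_eq0 //.
  by apply: nbr_round_homothetic; rewrite gt_eqF.
pose l := w + s; have b2 : 0 < b ^+ 2 by rewrite exprn_gt0.
have eq4 : equation4 l b by rewrite /equation4 -(mulr0 2%:R) -q0 /l wE; ring.
have lm1 : -1 < l.
  rewrite lt_def l1 andbT; apply: contra ws0 => /eqP h; apply/eqP.
  have w0 : w = 0 by move: h; rewrite /l => h; lra.
  by rewrite w0 mul0r.
have lp1 : l < 1.
  rewrite lt_def l2 andbT eq_sym; apply: contra ws0 => /eqP h; apply/eqP.
  have s0 : s = 0 by move: h; rewrite /l => h; lra.
  by rewrite s0 mulr0.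
have lpos : 0 < l.
  by case: (equation4_pos lm1 bn0 eq4) => // h; move: l0; rewrite -/l h eqxx.
have Qn0 : Q != 0 by move: n0; rewrite P0 expr0n add0r sqrf_eq0.
have listD D : 0 < D -> D ^+ 2 = 4%:R * Q ^+ 2 ->
    listed (bracket4 l b D) t ((l - 1) * (3%:R * (l + 3%:R) * b ^+ 2 - 2%:R * l)).
  move=> D0 D2; have -> : t = - ((3%:R * b ^+ 2 - 2%:R * l + 3%:R)
      / (12%:R * b ^+ 2 - 2%:R * l + 2%:R)).
    have d0 : 12%:R * b ^+ 2 - 2%:R * l + 2%:R != 0 by rewrite gt_eqF //; lra.
    apply: (mulIf d0); rewrite mulNr divfK //.
    by move: T; rewrite scal_nbr B00 P0 Q2 /l wE => T; lra.
  by apply: Listed4 => //; rewrite D2 Q2 /l wE; ring.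
have brE D : bracket4 l b D = nbr w s 0 b 0 (D / 2%:R).
  rewrite bracket4E; have -> : (l + 1) / 2%:R = w by rewrite /l wE; field.
  by have -> : (l - 1) / 2%:R = s by rewrite /l wE; field.
rewrite B00 P0; have [Qpos|Qneg] := ltP 0 Q.
  exists (bracket4 l b (2%:R * Q)); eexists; split.
    by apply: listD; [rewrite mulr_gt0 | ring].
  rewrite brE [2%:R * Q]mulrC mulfK ?pnatr_eq0 //.
  exact/isometric_homothetic/isometric_refl.
exists (bracket4 l b (2%:R * - Q)); eexists; split.
  apply: listD; last by ring.
  by rewrite mulr_gt0 ?ltr0n // oppr_gt0 lt_def eq_sym Qn0.
rewrite brE [2%:R * - Q]mulrC mulfK ?pnatr_eq0 //.
exact: nbr_flip12.
Qed.

Lemma nbr_listed (w s B b P Q t : R) : normal_params w s B b -> w + s != 0 ->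
  ~ locally_symmetric (nbr w s B b P Q) 1%:M ->
  F_critical (nbr w s B b P Q) 1%:M t ->
  exists br' E, listed br' t E /\
    isomorphically_homothetic (nbr w s B b P Q) 1%:M br' 1%:M.
Proof.
move=> np l0 nsym /F_critical_nbr crit.
have [n0|n0] := eqVneq (P ^+ 2 + Q ^+ 2) 0; last exact: nbr_cocycle_listed crit.
move/eqP: n0; rewrite paddr_eq0 ?sqr_ge0 // !sqrf_eq0 => /andP[/eqP P0 /eqP Q0].
by move: nsym crit; rewrite P0 Q0; exact: nbr_abelian_listed.
Qed.

End NormalListed.

(** * The groups carrying the listed metrics *)

Section Groups.
Variable R : realType.

Lemma e_bracket_derivation (l1 l2 d k r s : R) :
  exists2 D : {linear 'rV[R]_3 -> 'rV[R]_3}, is_derivation (e_bracket l1 l2) D &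
  forall x, D x =
    (d * x 0 i1 - k * l1 * x 0 i2 + r * x 0 i3) *: e_ R i1 +
    (k * l2 * x 0 i1 + d * x 0 i2 + s * x 0 i3) *: e_ R i2.
Proof.
pose f (x : 'rV[R]_3) := (d * x 0 i1 - k * l1 * x 0 i2 + r * x 0 i3) *: e_ R i1 +
  (k * l2 * x 0 i1 + d * x 0 i2 + s * x 0 i3) *: e_ R (i2 : 'I_3).
have fl : linear f.
  by move=> a x y; apply/eq_rv3; split; rewrite !mxE /=; ring.
pose D : {linear 'rV[R]_3 -> 'rV[R]_3} := HB.pack_for
  {linear 'rV[R]_3 -> 'rV[R]_3} f (GRing.isLinear.Build _ _ _ _ f fl).
exists D => // x y; rewrite -[D : _ -> _]/f /f !e_bracketE.
by apply/eq_rv3; split; rewrite !mxE /=; ring.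
Qed.

(** With v_4 acting by D one has [e_i, e_4] = - D e_i, whence the signs of the data of D; the sign
    of [l] selects the group. *)
Lemma solv_extends (l b k q : R) : l != 0 ->
  let br := solv 0 (- l) 1 0 b (- (k * l)) k b 0 q in
  extends_e11 br \/ extends_e2 br.
Proof.
move=> l0 br; have [D Dder DE] := e_bracket_derivation 1 l (- b) k 0 (- q).
have iso : lie_isomorphic br (semidirect (e_bracket 1 l) D).
  have [f iso _] := isometric_refl br; exists f; case: iso => fbij fbr.
  split=> // x y; rewrite fbr (semidirect_solv DE) /br.
  by rewrite !opprK oppr0 mulr1.
have [ln|lp] := ltP l 0; [left | right]; exists 1, l, D; split=> //.
  by rewrite mul1r.
by rewrite mul1r lt_def l0.
Qed.

Lemma listed_extends br t E : @listed R br t E -> extends_e11 br \/ extends_e2 br.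
Proof.
have eq_ext br1 br2 : br1 = br2 -> extends_e11 br2 \/ extends_e2 br2 ->
    extends_e11 br1 \/ @extends_e2 R br1 by move=> ->.
case=> {br t E} [|l b l1 b0 eq2|D D0|l b D l0 l1 D0 Dl b0 eq4|A b b0 A0 bA].
- apply: eq_ext (@solv_extends (- 1) 0 0 0 _); last by rewrite oppr_eq0 oner_eq0.
  by rewrite bracket1E /nbr; congr solv; ring.
- apply: eq_ext (@solv_extends l b 0 0 _); last by apply/eqP => l0; lra.
  by rewrite bracket2E /nbr; congr solv; field.
- apply: eq_ext (@solv_extends 1 1 0 D _); last exact: oner_neq0.
  by rewrite bracket3E /nbr; congr solv; field.
- apply: eq_ext (@solv_extends l b 0 D _); last by rewrite gt_eqF.
  by rewrite bracket4E /nbr; congr solv; field.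
- apply: eq_ext (@solv_extends (- 1) b A 0 _); last by rewrite oppr_eq0 oner_eq0.
  by rewrite bracket5E /solv2; congr solv; ring.
Qed.

Lemma bracket1_e11_times_line : is_e11_times_line (bracket1 R).
Proof.
exists 1, (- 1); split; first by rewrite mul1r ltrN10.
have [f [fbij fbr] _] := isometric_refl (bracket1 R); exists f; split=> // x y.
rewrite fbr (@semidirect_solv _ 1 (- 1) 0 0 0 0); last first.
  by move=> z; rewrite !mul0r !addr0 subrr !scale0r addr0.
by rewrite bracket1E /nbr; congr solv; ring.
Qed.

End Groups.

(** * Algebraic Ricci solitons *)

Section Solitons.
Variable R : realType.

(** The derivation Ric - l Id preserves the derived algebra span(e_1, e_2), so the mixed components
    of the Ricci tensor vanish; this gives P = Q = 0 in both cases. The diagonal conditions then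
    force w s = 0. *)
Lemma nbr_soliton (w s B b P Q : R) : w - s = 1 -> w + s != 0 -> (b = 0 -> B = 0) ->
  is_algebraic_ricci_soliton (nbr w s B b P Q) 1%:M ->
  is_einstein (nbr w s B b P Q) 1%:M \/
  [/\ w = 0, s = - 1 & [/\ B = 0, b = 0, P = 0 & Q = 0]].
Proof.
move=> m1 l0 bB [l [D [Dder ricD]]].
have cancel0 (a c : R) : a != 0 -> a * c = 0 -> c = 0.
  by move=> a0 /eqP; rewrite mulf_eq0 (negbTE a0) => /eqP.
have ricE x : ricci_op (nbr w s B b P Q) 1%:M x =
    \row_k nricci w s B b P Q x (e_ R k).
  rewrite /ricci_op /sharp invmx1 mulmx1; apply/rowP => k.
  by rewrite [LHS]mxE ricci_nbr [RHS]mxE.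
have DE i : D (e_ R i) = (\row_k nricci w s B b P Q (e_ R i) (e_ R k)) - l *: e_ R i.
  by rewrite -ricE ricD addrC addKr.
have [[[D1 D2] D3] D4] := (nricci_row w s B b P Q).
have {}D1 := etrans (DE i1) (congr1 (fun u => u - l *: e_ R i1) D1).
have {}D2 := etrans (DE i2) (congr1 (fun u => u - l *: e_ R i2) D2).
have {}D3 := etrans (DE i3) (congr1 (fun u => u - l *: e_ R i3) D3).
have {}D4 := etrans (DE i4) (congr1 (fun u => u - l *: e_ R i4) D4).
move: D1 D2 D3 D4; rewrite !rv4_delta !rv4Z !rv4N !rv4D -!rv4_delta => D1 D2 D3 D4.
have Dn a c : D (rv4 a c 0 0) = a *: D (e_ R i1) + c *: D (e_ R i2).
  rewrite -!linearZ -linearD /=; congr (D _).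
  by rewrite !rv4_delta !rv4Z !rv4D; congr rv4; ring.
have h i j : D (nbr w s B b P Q (e_ R i) (e_ R j)) =
  nbr w s B b P Q (D (e_ R i)) (e_ R j) + nbr w s B b P Q (e_ R i) (D (e_ R j)).
  exact: Dder.
have h14 := h i1 i4; have h24 := h i2 i4; have h13 := h i1 i3; have h23 := h i2 i3.
move: h14 h24 h13 h23; rewrite D1 D2 D3 D4 !nbr_deltar !nbr_delta.
have -> : nbr w s B b P Q (e_ R i1) (e_ R i4) = rv4 b 0 0 0.
  by rewrite !rv4_delta nbrE; congr rv4; ring.
have -> : nbr w s B b P Q (e_ R i2) (e_ R i4) = rv4 0 b 0 0.
  by rewrite !rv4_delta nbrE; congr rv4; ring.
have -> : nbr w s B b P Q (e_ R i1) (e_ R i3) = rv4 B (- (w + s)) 0 0.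
  by rewrite !rv4_delta nbrE; congr rv4; ring.
have -> : nbr w s B b P Q (e_ R i2) (e_ R i3) = rv4 (w - s) B 0 0.
  by rewrite !rv4_delta nbrE; congr rv4; ring.
rewrite !Dn D1 D2 !rv4Z !rv4D.
have rv4_inj a1 a2 a3 a4 c1 c2 c3 c4 : rv4 a1 a2 a3 a4 = rv4 c1 c2 c3 c4 :> 'rV[R]_4 ->
    [/\ a1 = c1, a2 = c2, a3 = c3 & a4 = c4].
  move=> e; split; [have := congr1 (fun u : 'rV[R]_4 => u 0 i1) e
    | have := congr1 (fun u : 'rV[R]_4 => u 0 i2) e
    | have := congr1 (fun u : 'rV[R]_4 => u 0 i3) e
    | have := congr1 (fun u : 'rV[R]_4 => u 0 i4) e];
    by rewrite /= ?rv4_1 ?rv4_2 ?rv4_3 ?rv4_4.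
move=> /rv4_inj [h141 h142 h143 h144] /rv4_inj [h241 h242 h243 h244].
move=> /rv4_inj [h131 h132 h133 h134] /rv4_inj [h231 h232 h233 h234].
clear D1 D2 D3 D4 Dn h DE ricE ricD Dder D rv4_inj.
have wE : w = s + 1 by rewrite -m1 addrC subrK.
have n3 : 3%:R != 0 :> R by rewrite pnatr_eq0.
have n2 : 2%:R != 0 :> R by rewrite pnatr_eq0.
have n4 : 4%:R != 0 :> R by rewrite pnatr_eq0.
have [b0|b0] := eqVneq b 0.
  have B0 := bB b0; move: h131 h132 h133 h134 h231 h232 h233 h234.
  rewrite b0 B0 => h131 h132 h133 h134 h231 h232 h233 h234.
  have P0 : P = 0.
    apply: (cancel0 _ _ l0); transitivity ((w + s) * ((w - s) * P)).
      by rewrite m1 mul1r.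
    by move: h134 => h134; lra.
  have Q0 : Q = 0.
    apply: (cancel0 _ _ l0); transitivity ((w - s) * ((w + s) * Q)).
      by rewrite m1 mul1r.
    by move: h234 => h234; lra.
  move: h132 h231; rewrite P0 Q0 => h132 h231.
  have e1 : 4%:R * (w * s) - (- 2%:R * s ^+ 2 - l) = 0.
    by apply: (cancel0 _ _ l0); lra.
  have e2 : - 4%:R * (w * s) - (- 2%:R * s ^+ 2 - l) = 0.
    by transitivity ((w - s) * (- 4%:R * (w * s) - (- 2%:R * s ^+ 2 - l)));
      [rewrite m1 mul1r | lra].
  have /eqP : w * s = 0 by lra.
  rewrite mulf_eq0 => /orP[/eqP w0|/eqP s0].
    by right; split=> //; lra.
  left; exists 0 => x y; rewrite s0 ricci_nbr /nricci; ring.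
left.
have P0 : P = 0.
  by apply: (cancel0 _ _ b0); apply: (cancel0 _ _ b0); apply: (cancel0 _ _ n3); lra.
have Q0 : Q = 0.
  by apply: (cancel0 _ _ b0); apply: (cancel0 _ _ b0); apply: (cancel0 _ _ n3); lra.
move: h141 h142 h131 h132 h231; rewrite P0 Q0 => h141 h142 h131 h132 h231.
(* The e_2-component of the derivation rule on [e_1, e_4] is 2 (w + s) b B = 0, from the Ricci
   component - 2 B b between e_3 and e_4. *)
have B0 : B = 0.
  apply: (cancel0 _ _ b0); apply: (cancel0 _ _ l0); apply: (cancel0 _ _ n2); lra.
move: h141 h131 h132 h231; rewrite B0 => h141 h131 h132 h231.
have lE : - 2%:R * b ^+ 2 - l = 0 by apply: (cancel0 _ _ b0); lra.
have e1 : 4%:R * (w * s) - (- 2%:R * s ^+ 2 - l) = 0.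
  by apply: (cancel0 _ _ l0); lra.
have e2 : - 4%:R * (w * s) - (- 2%:R * s ^+ 2 - l) = 0.
  by transitivity ((w - s) * (- 4%:R * (w * s) - (- 2%:R * s ^+ 2 - l)));
    [rewrite m1 mul1r | lra].
have ws : w * s = 0 by lra.
have s2 : s ^+ 2 = b ^+ 2 by lra.
exists (- 2%:R * b ^+ 2) => x y; rewrite ricci_nbr ip1 /nricci ws s2; ring.
Qed.

Lemma bracket1_soliton : is_algebraic_ricci_soliton (bracket1 R) 1%:M.
Proof.
(* The Ricci operator is diag(0, 0, -2, 0), that is -2 Id + diag(2, 2, 0, 2). *)
exists (- 2%:R), (mulmxr (mx4 (rv4 2%:R 0 0 0) (rv4 0 2%:R 0 0) (rv4 0 0 0 0)
  (rv4 0 0 0 2%:R))); rewrite bracket1E; split=> [x y|x] /=.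
  by rewrite /nbr; coord; congr rv4; ring.
rewrite /ricci_op /sharp invmx1 mulmx1 rv4_row !ricci_nbr.
elim/rv4P: x => x1 x2 x3 x4; rewrite !rv4_delta !nricciE; coord.
by congr rv4; ring.
Qed.

Lemma bracket1_not_einstein : ~ is_einstein (bracket1 R) 1%:M.
Proof.
move=> [c]; rewrite bracket1E => e; have := e (e_ R i1) (e_ R i1).
have := e (e_ R i3) (e_ R i3).
rewrite !ricci_nbr !rv4_delta !nricciE !ip1E => h1 h2; lra.
Qed.

End Solitons.

(** * Positive roots of the biquadratic equations *)

Section ParameterCounts.
Variable R : realType.

(** The two roots in b^2 have the negative product - d / a, so exactly one is positive, whatever the
    sign of [c]. *)
Lemma biquadratic_unique_root (a c d : R) : 0 < a -> 0 < d ->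
  exists! b : R, 0 < b /\ a * b ^+ 4 - c * b ^+ 2 - d = 0.
Proof.
move=> a0 d0; pose De := c ^+ 2 + 4%:R * a * d.
have ad : 0 < a * d by rewrite mulr_gt0.
have De0 : 0 < De by have := sqr_ge0 c; rewrite /De => h; lra.
pose r := Num.sqrt De; have r2 : r ^+ 2 = De by rewrite sqr_sqrtr // ltW.
have r0 : 0 < r by rewrite sqrtr_gt0.
have rc : `|c| < r.
  by rewrite -sqrtr_sqr ltr_sqrt // /De; lra.
have cr : 0 < c + r by have := ler_norm (- c); rewrite normrN => h; lra.
have cr' : c - r < 0 by have := ler_norm c => h; lra.
pose y := (c + r) / (2%:R * a).
have y0 : 0 < y by rewrite divr_gt0 // mulr_gt0.
have an0 : a != 0 by rewrite gt_eqF.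
have fact b : a * b ^+ 4 - c * b ^+ 2 - d =
    a * (b ^+ 2 - y) * (b ^+ 2 - (c - r) / (2%:R * a)).
  have dE : d = (r ^+ 2 - c ^+ 2) / (4%:R * a) by rewrite r2 /De; field.
  by rewrite dE /y; field.
exists (Num.sqrt y); split=> [|b [b0 e]].
  by split; [rewrite sqrtr_gt0 | rewrite fact sqr_sqrtr ?ltW // subrr mulr0 mul0r].
move: e; rewrite fact => /eqP; rewrite !mulf_eq0 (negbTE an0) /= => /orP[] /eqP h.
  by rewrite -(subr0_eq h) sqrtr_sqr gtr0_norm.
have : 0 < b ^+ 2 by rewrite exprn_gt0.
rewrite (subr0_eq h) pmulr_lgt0 ?invr_gt0 ?mulr_gt0 // => h'; lra.
Qed.

Lemma biquadratic_two_roots (a c d : R) : 0 < a -> 0 < c -> 0 < d ->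
  0 < c ^+ 2 - 4%:R * a * d ->
  exists b1 b2 : R, b1 != b2 /\ forall b : R,
    0 < b /\ a * b ^+ 4 - c * b ^+ 2 + d = 0 <-> b = b1 \/ b = b2.
Proof.
move=> a0 c0 d0; set De := _ - _ => De0.
have ad : 0 < a * d by rewrite mulr_gt0.
pose r := Num.sqrt De; have r2 : r ^+ 2 = De by rewrite sqr_sqrtr // ltW.
have r0 : 0 < r by rewrite sqrtr_gt0.
have rc : r < c.
  by rewrite -[c]gtr0_norm // -sqrtr_sqr ltr_sqrt ?exprn_gt0 // /De; lra.
have an0 : a != 0 by rewrite gt_eqF.
pose y1 := (c + r) / (2%:R * a); pose y2 := (c - r) / (2%:R * a).
have y1p : 0 < y1 by rewrite divr_gt0 ?mulr_gt0 // addr_gt0.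
have y2p : 0 < y2 by rewrite divr_gt0 ?mulr_gt0 // subr_gt0.
have fact b : a * b ^+ 4 - c * b ^+ 2 + d = a * (b ^+ 2 - y1) * (b ^+ 2 - y2).
  have dE : d = (c ^+ 2 - r ^+ 2) / (4%:R * a) by rewrite r2 /De; field.
  by rewrite dE /y1 /y2; field.
exists (Num.sqrt y1), (Num.sqrt y2); split.
  apply/eqP => e; have : y1 = y2 by rewrite -[y1]sqr_sqrtr ?ltW // e sqr_sqrtr ?ltW.
  rewrite /y1 /y2 => /(mulIf _); rewrite invr_eq0 mulf_neq0 ?pnatr_eq0 // => /(_ isT) h.
  by lra.
move=> b; split=> [[b0 /eqP]|].
  rewrite fact !mulf_eq0 (negbTE an0) /= => /orP[]/eqP/subr0_eq h; [left|right];
  by rewrite -h sqrtr_sqr gtr0_norm.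
by move=> [] ->; rewrite fact sqrtr_gt0 sqr_sqrtr ?ltW // subrr ?mulr0 ?mul0r.
Qed.

Lemma equation2_negative (l : R) : -1 < l -> l < 0 ->
  exists b1 b2 : R, b1 != b2 /\ forall b : R,
    0 < b /\ equation2 l b <-> b = b1 \/ b = b2.
Proof.
move=> l1 l0; have l2 := sqr_ge0 l; have lm := sqr_ge0 (l - 1).
have c0 : 0 < 3%:R * l ^+ 2 - 2%:R * l + 3%:R by lra.
have d0 : 0 < - ((l - 1) ^+ 2 * l).
  rewrite -mulrN mulr_gt0 ?oppr_gt0 // exprn_even_gt0 //= subr_eq0 lt_eqF //; lra.
have [|b1 [b2 [b12 h]]] := biquadratic_two_roots (ltr0n R 4) c0 d0.
  (* The discriminant factors, and both factors are positive for -1 < l < 0. *)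
  have -> : (3%:R * l ^+ 2 - 2%:R * l + 3%:R) ^+ 2 - 4%:R * 4%:R * - ((l - 1) ^+ 2 * l)
    = (l + 1) ^+ 2 * (9%:R * l ^+ 2 - 14%:R * l + 9%:R) by ring.
  rewrite mulr_gt0 //; last by lra.
  by rewrite exprn_even_gt0 //= gt_eqF //; lra.
by exists b1, b2; split.
Qed.

End ParameterCounts.

Theorem theorem3p3 (R : realType) :
  (* the classification *)
  (forall (br : bracket R 4) (G : 'M[R]_4),
      is_lie_bracket br -> is_inner_product G ->
      extends_e11 br \/ extends_e2 br ->
      ~ locally_symmetric br G ->
      forall t : R,
        F_critical br G t <->
        exists br' : bracket R 4, exists E : R,
          listed br' t E /\ isomorphically_homothetic br G br' 1%:M)
  (* the listed metrics are non-symmetric left-invariant metrics on these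
     groups, the first one lives on the direct product of E(1,1) and the line,
     and the energies are as stated *)
  /\ (forall (br : bracket R 4) (t E : R), listed br t E ->
        [/\ is_lie_bracket br, extends_e11 br \/ extends_e2 br,
            ~ locally_symmetric br 1%:M & energy br 1%:M t = E])
  /\ is_e11_times_line (bracket1 R)
  (* the numbers of admissible parameters *)
  /\ (forall l : R, -1 < l -> l < 0 ->
        exists b1 b2 : R,
          b1 != b2 /\ forall b : R,
            0 < b /\ equation2 l b <-> b = b1 \/ b = b2)
  /\ (forall l : R, 0 < l -> l < 1 ->
        exists! b : R, 0 < b /\ equation2 l b)
  /\ (forall l : R, 0 < l -> l < 1 ->
        (exists! D : R, 0 < D /\ D ^+ 2 + l ^+ 2 = 1)
        /\ (exists! b : R, 0 < b /\ equation4 l b))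
  (* the algebraic Ricci solitons *)
  /\ (forall (br : bracket R 4) (G : 'M[R]_4),
        is_lie_bracket br -> is_inner_product G -> extends_e11 br ->
        (~ is_einstein br G /\ is_algebraic_ricci_soliton br G <->
         isomorphically_homothetic br G (bracket1 R) 1%:M))
  /\ (forall (br : bracket R 4) (G : 'M[R]_4),
        is_lie_bracket br -> is_inner_product G -> extends_e2 br ->
        ~ (~ is_einstein br G /\ is_algebraic_ricci_soliton br G)).
Proof.
have ip1 := inner_product1 R 4.
have reduce br G : is_inner_product G -> extends_e11 br \/ extends_e2 br ->
    exists w s B b P Q, [/\ normal_params w s B b, w + s != 0 &
      isomorphically_homothetic br G (@nbr R w s B b P Q) 1%:M].
  move=> Gip [] [l1 [l2 [D [l0 Dder iso]]]].
    have [|w [s [B [b [P [Q [np sgn h]]]]]]] := normal_form Gip _ Dder iso.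
      by rewrite lt_eqF.
    exists w, s, B, b, P, Q; split=> //.
    by apply: contraTneq sgn => ->; rewrite mul0r ltxx.
  have [|w [s [B [b [P [Q [np sgn h]]]]]]] := normal_form Gip _ Dder iso.
    by rewrite gt_eqF.
  exists w, s, B, b, P, Q; split=> //.
  by apply: contraTneq sgn => ->; rewrite mul0r ltxx.
have listed_lie br t E : @listed R br t E -> is_lie_bracket br.
  move=> /listed_nbr [w [s [B [b [P [Q [iso _ _ _]]]]]]].
  exact: homothetic_lie (nbr_lie w s B b P Q) (isometric_homothetic iso).
split; [|split; [|split; [|split; [|split; [|split; [|split]]]]]].
- move=> br G lie Gip ext nsym t; split=> [crit|[br' [E [lst h]]]].
    have [w [s [B [b [P [Q [np l0 h]]]]]]] := reduce br G Gip ext.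
    have [||br' [E [lst h']]] := @nbr_listed R w s B b P Q t np l0.
    + move=> sym; apply: nsym.
      apply: homothetic_locally_symmetric sym; [exact: nbr_lie|by []..|].
      exact: homothetic_sym.
    + exact: homothetic_F_critical lie Gip ip1 h crit.
    exists br', E; split=> //; exact: homothetic_trans h h'.
  have [w [s [B [b [P [Q [iso crit _ _]]]]]]] := listed_nbr lst.
  have h' := homothetic_trans (isometric_homothetic iso) (homothetic_sym h).
  apply: (homothetic_F_critical (nbr_lie w s B b P Q) ip1 Gip h').
  exact/F_critical_nbr.
- move=> br t E lst; have [w [s [B [b [P [Q [iso _ nsym en]]]]]]] := listed_nbr lst.
  split; [exact: listed_lie lst|exact: listed_extends lst| |].
    move=> sym; apply: nsym; apply: homothetic_locally_symmetric sym => //.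
      exact: listed_lie lst.
    exact/homothetic_sym/isometric_homothetic.
  by rewrite (isometric_energy t (nbr_lie w s B b P Q) iso).
- exact: bracket1_e11_times_line.
- exact: equation2_negative.
- move=> l l0 l1; apply: biquadratic_unique_root; first by rewrite ltr0n.
  by rewrite mulr_gt0 // exprn_even_gt0 //= subr_eq0 lt_eqF.
- move=> l l0 l1; split.
    have l2 : 0 < 1 - l ^+ 2 by rewrite subr_gt0 expr_lt1 // ltW.
    exists (Num.sqrt (1 - l ^+ 2)); split=> [|D [D0 DE]].
      by rewrite sqrtr_gt0 sqr_sqrtr ?ltW // subrK.
    by rewrite -DE addrK sqrtr_sqr gtr0_norm.
  have [|b [bE bU]] := @biquadratic_unique_root R 2%:R
      (5%:R * l ^+ 2 - l - 2%:R) (l * (1 - l)) (ltr0n R 2).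
    by rewrite mulr_gt0 // subr_gt0.
  have e x : equation4 l x <-> 2%:R * x ^+ 4 - (5%:R * l ^+ 2 - l - 2%:R) * x ^+ 2
      - l * (1 - l) = 0.
    by rewrite /equation4; have <- : l * (l - 1) = - (l * (1 - l)) by ring.
  exists b; split=> [|x [x0 /e xE]]; last exact: bU.
  by case: bE => b0 /e.
- move=> br G lie Gip [l1 [l2 [D [l0 Dder iso]]]]; split=> [[nein sol]|h].
    have [|w [s [B [b [P [Q [np sgn h]]]]]]] := normal_form Gip _ Dder iso.
      by rewrite lt_eqF.
    have ln0 : w + s != 0 by apply: contraTneq sgn => ->; rewrite mul0r ltxx.
    have sol' := homothetic_soliton lie Gip ip1 h sol.
    case: np => m1 _ _ _ bB.
    case: (nbr_soliton m1 ln0 bB sol') => [ein|[w0 s0 [B0 b0 P0 Q0]]].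
      by case: nein; apply: homothetic_einstein ein => //;
        [exact: nbr_lie|exact: homothetic_sym].
    by rewrite bracket1E; rewrite w0 s0 B0 b0 P0 Q0 in h.
  have lie1 : is_lie_bracket (bracket1 R) := homothetic_lie lie h.
  split.
    move=> ein; apply: (@bracket1_not_einstein R).
    exact: homothetic_einstein h ein.
  exact: homothetic_soliton (homothetic_sym h) (bracket1_soliton R).
- move=> br G lie Gip [l1 [l2 [D [l0 Dder iso]]]] [nein sol].
  have [|w [s [B [b [P [Q [np sgn h]]]]]]] := normal_form Gip _ Dder iso.
    by rewrite gt_eqF.
  have ln0 : w + s != 0 by apply: contraTneq sgn => ->; rewrite mul0r ltxx.
  have sol' := homothetic_soliton lie Gip ip1 h sol.
  case: np => m1 _ _ _ bB.
  case: (nbr_soliton m1 ln0 bB sol') => [ein|[w0 s0 _]].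
    by apply: nein; apply: homothetic_einstein ein => //;
      [exact: nbr_lie|exact: homothetic_sym].
  (* A non-Einstein soliton has w + s = -1, whereas l1 l2 > 0 makes w + s positive. *)
  by move: sgn; rewrite w0 s0 add0r mulN1r oppr_gt0 ltNge ltW.
Qed.
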